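(* For a generic choice of the Carnot group structure $W\subset\mathfrak{so}(d)$, $\dim W=l$, and of $p\in\Delta^2$, $$\mathrm{Card}\{\text{critical manifolds of }J|_{\Omega_p}\text{ with energy less than }s\}\le O(s)^l,$$ that is, there is a constant $C>0$ (depending on $W$ and $p$) such that for all sufficiently large $s$ this number is at most $C s^l$.
   Context: Let $W\subset\mathfrak{so}(d)$ be an $l$-dimensional linear subspace (the Carnot group structure) with basis $A_1,\dots,A_l$, $A_k=(a^k_{ij})$. The step-two Carnot group $G$ defined by $W$ is $\mathbb{R}^{d+l}$ with coordinates $(x,y)$, $x\in\mathbb{R}^d$, $y\in\mathbb{R}^l$, with the distribution spanned by the vector fields $E_i=\frac{\partial}{\partial x_i}-\frac12\sum_{k}\sum_{j} a^k_{ij}x_j\frac{\partial}{\partial y_k}$, $i=1,\dots,d$, declared orthonormal. The origin is $e=0$ and $\Delta^2=\{0\}\times\mathbb{R}^l\simeq\mathbb{R}^l$. Admissible curves $\gamma:[0,2\pi]\to G$ starting at $e$ are identified with their controls $u\in L^2([0,2\pi],\mathbb{R}^d)$ ($\dot\gamma=\sum_iu_iE_i(\gamma)$ a.e.). End-point map: $F(u)=\left(\int_0^{2\pi}u\,dt,\ \frac12\int_0^{2\pi}\left\langle\int_0^tu(\tau)d\tau,A\,u(t)\right\rangle dt\right)$, $A=(A_1,\dots,A_l)$. $\Omega_p=F^{-1}(p)$; $H=\{u:\int_0^{2\pi}u=0\}$ and $q=F|_H:H\to\Delta^2\simeq\mathbb{R}^l$ (for $p\in\Delta^2$, $\Omega_p=q^{-1}(p)$).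 Energy: $J(u)=\frac12\|u\|_{L^2}^2$. A covector $\omega\in(\Delta^2)^*$ is a Lagrange multiplier for $p\in\Delta^2$ if there is $u\in H$ with $q(u)=p$ and $\omega(D_uq\,v)=D_uJ\,v$ for all $v\in H$; the critical manifold $C_\omega$ of $J|_{\Omega_p}$ is the set of all such $u$. (For generic $W,p$, $J|_{\Omega_p}$ is a Morse-Bott function on the Hilbert manifold $\Omega_p$ whose critical set is the disjoint union of the compact manifolds $C_\omega$, and $J$ is constant on each of them.) Genericity: ''for generic $W$ and generic $p\in\Delta^2$'' means for all $W$ in the Grassmannian of $l$-planes of $\mathfrak{so}(d)$ outside a countable union of semialgebraic subsets of positive codimension and, for each such $W$, for all $p\in\Delta^2\simeq\mathbb{R}^l$ outside a countable union of semialgebraic subsets of positive codimension (depending on $W$). *)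

(* Defs.v *)
From HB Require Import structures.
From mathcomp Require Import all_boot all_order all_algebra.
From mathcomp Require Import all_classical all_reals all_analysis.
From mathcomp Require mpoly.

Set Implicit Arguments.
Unset Strict Implicit.
Unset Printing Implicit Defensive.

Import Order.TTheory GRing.Theory Num.Theory.
Import numFieldNormedType.Exports.

Local Open Scope classical_set_scope.
Local Open Scope ring_scope.

Section Semialgebraic.
Variables (R : realType) (n : nat).

Definition peval (f : mpoly.mpoly n R) (x : 'rV[R]_n) : R :=
  mpoly.meval (fun i => x ord0 i) f.

Inductive semialgebraic : set 'rV[R]_n -> Prop :=
| semialgebraic_eq0 f : semialgebraic [set x | peval f x = 0]
| semialgebraic_gt0 f : semialgebraic [set x | 0 < peval f x]
| semialgebraicU S T : semialgebraic S -> semialgebraic T ->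
    semialgebraic (S `|` T)
| semialgebraicC S : semialgebraic S -> semialgebraic (~` S).

(* The dimension of a semialgebraic set is the largest k such that its
   projection to some k of the coordinates has nonempty interior. *)
Definition dim_ge (S : set 'rV[R]_n) (k : nat) : Prop :=
  exists2 f : 'I_k -> 'I_n, injective f &
    interior [set colsub f x | x in S] !=set0.

Definition positive_codim (S : set 'rV[R]_n) : Prop :=
  forall k, dim_ge S k -> (k < n)%N.

Definition negligible_semialgebraic (S : set 'rV[R]_n) : Prop :=
  semialgebraic S /\ positive_codim S.

Definition generic_point (P : 'rV[R]_n -> Prop) : Prop :=
  exists2 Y : nat -> set 'rV[R]_n,
    (forall i, negligible_semialgebraic (Y i)) &
    forall x, ~ (\bigcup_i Y i) x -> P x.

End Semialgebraic.

Section Grassmannian.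
Variables (R : realType) (vT : vectType R) (U : {vspace vT}) (l : nat).

Definition grassmannian : set {vspace vT} :=
  [set W | (W <= U)%VS /\ \dim W = l].

(* When F ++ K is a basis of U, this is the affine chart of the Grassmannian
   whose image is the set of l-planes of U complementary to <<K>>: it maps the
   matrix X of a linear map <<F>> -> <<K>> to the graph of that map. *)
Definition gr_chart (m : nat) (F : l.-tuple vT) (K : m.-tuple vT)
    (x : 'rV[R]_(l * m)) : {vspace vT} :=
  <<[tuple (tnth F i + \sum_j vec_mx x i j *: tnth K j)%R | i < l]>>%VS.

Definition gr_negligible_semialgebraic (S : set {vspace vT}) : Prop :=
  forall (m : nat) (F : l.-tuple vT) (K : m.-tuple vT),
    basis_of U (F ++ K) -> negligible_semialgebraic (gr_chart F K @^-1` S).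

Definition generic_plane (P : {vspace vT} -> Prop) : Prop :=
  exists2 Z : nat -> set {vspace vT},
    (forall i, gr_negligible_semialgebraic (Z i)) &
    forall W, grassmannian W -> ~ (\bigcup_i Z i) W -> P W.

End Grassmannian.

(* The subspace of the matrices B such that B + B^T = 0. *)
Definition so (R : realType) (d : nat) : {vspace 'M[R]_d} :=
  lker (linfun (fun B : 'M[R]_d => B + B^T)).

Section Controls.
Variable R : realType.

Definition I2pi : set R := `[0, 2 * pi].

Lemma measurable_I2pi : measurable (I2pi : set (measurableTypeR R)).
Proof. exact: measurable_itv. Qed.

Definition leb2pi : {measure set (measurableTypeR R) -> \bar R} :=
  mrestr (@lebesgue_measure R) measurable_I2pi.

(* Elements of L^2([0, 2 pi], R^d) are represented by square-integrable
   functions that are not identified when they agree almost everywhere on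
   [0, 2 pi] (their values outside of [0, 2 pi] are irrelevant).  All notions
   below are invariant under this identification; the critical manifolds, in
   particular, are saturated sets of representatives, so that they are in
   bijection with the corresponding sets of classes. *)
Definition control (d : nat) : Type :=
  {ffun 'I_d -> LfunType leb2pi (lee1n 2)}.

Definition norm2 (d : nat) (u : control d) : R :=
  Num.sqrt (\int[lebesgue_measure]_(t in I2pi) \sum_(i < d) (u i t) ^+ 2).

Definition energy (d : nat) (u : control d) : R := 2^-1 * norm2 u ^+ 2.

Definition position (d : nat) (u : control d) (t : R) : 'rV[R]_d :=
  \row_i \int[lebesgue_measure]_(tau in `[0, t]) u i tau.

Definition endpoint (d l : nat) (A : l.-tuple 'M[R]_d) (u : control d) :
    'rV[R]_d * 'rV[R]_l :=
  (position u (2 * pi),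
   \row_k (2^-1 * \int[lebesgue_measure]_(t in I2pi)
     \sum_(i < d) position u t ord0 i *
       \sum_(j < d) tnth A k i j * u j t)).

Definition Hloop (d : nat) : set (control d) :=
  [set u | position u (2 * pi) = 0].

Definition qmap (d l : nat) (A : l.-tuple 'M[R]_d) (u : control d) :
  'rV[R]_l := (endpoint A u).2.

(* Frechet differential at u of the restriction of f to Hloop, for the L^2
   norm; only the values of df on Hloop matter. *)
Definition is_differential (d : nat) (V : normedModType R)
    (f : control d -> V) (u : control d) (df : control d -> V) : Prop :=
  [/\ (forall (a : R) (v w : control d), Hloop v -> Hloop w ->
         df (a *: v + w) = a *: df v + df w),
      (exists M : R, forall v, Hloop v -> `|df v| <= M * norm2 v) &
      (forall e : R, 0 < e -> exists2 delta : R, 0 < delta &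
         forall v, Hloop v -> norm2 v < delta ->
           `|f (u + v) - f u - df v| <= e * norm2 v)].

Definition critical_manifold (d l : nat) (A : l.-tuple 'M[R]_d)
    (p : 'rV[R]_l) (omega : {scalar 'rV[R]_l}) : set (control d) :=
  [set u | [/\ Hloop u, qmap A u = p &
    exists Dq : control d -> 'rV[R]_l, exists DJ : control d -> R^o,
      [/\ is_differential (qmap A) u Dq,
          is_differential (@energy d : control d -> R^o) u DJ &
          forall v, Hloop v -> omega (Dq v) = DJ v]]].

Definition lagrange_multiplier (d l : nat) (A : l.-tuple 'M[R]_d)
    (p : 'rV[R]_l) (omega : {scalar 'rV[R]_l}) : Prop :=
  critical_manifold A p omega !=set0.

Definition critical_manifolds_below (d l : nat) (A : l.-tuple 'M[R]_d)
    (p : 'rV[R]_l) (s : R) : set (set (control d)) :=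
  [set C | exists omega : {scalar 'rV[R]_l},
    [/\ lagrange_multiplier A p omega, C = critical_manifold A p omega &
        exists2 u, C u & energy u < s]].

End Controls.

(* Main.v *)
(* Let B = sum_k w_k A_k be the matrix of a Lagrange multiplier w. A critical
   point u satisfies u + B x = const, x being the primitive of u, hence
   u(t) = sum_n (cos(nt) a_n + sin(nt) b_n) with B a_n = - n b_n, B b_n = n a_n
   and p_k = pi sum_n (1/n) <a_n, A_k b_n>; moreover J(u) = w.p. For generic W and
   p there is c > 0 such that |B b| >= c |w| for every antisymmetric b paired to p;
   applied to b = sum_n (pi/2n) (a_n b_n^T - b_n a_n^T), this gives |w| = O(J), so
   that J < s forces all the frequencies n to be O(s).

   By the conic version of Caratheodory's theorem, p is carried by at most l of the
   modes (a_n, b_n), so w is compatible with one of O(s)^l tuples of l frequencies.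
   For a given tuple, the number of possible w is bounded uniformly. Indeed, let p
   be generic over a countable subring K of R containing the entries of the A_k.
   A derivation D of R that vanishes on K satisfies sum_k w_k D p_k = D (w.p). So
   J = w.p is algebraic over K[p] (otherwise D p = 0 and D J = 1 would be possible
   for some D), and w is determined by J (take D p_k = delta_jk). Hence the possible
   J form a countable fibre of a definable family, and such fibres are uniformly
   finite by quantifier elimination. *)
From HB Require Import structures.
From mathcomp Require Import all_boot all_order all_algebra.
From mathcomp Require Import all_classical all_reals all_analysis.
From mathcomp Require Import measurable_realfun.
From mathcomp Require mpoly.
From mathcomp Require ordered_qelim qe_rcf.
From mathcomp Require complex polyrcf sesquilinear spectral.
From mathcomp Require Import ring lra zify.
Require Import Defs.
Import (canonicals) mpoly complex.

Set Implicit Arguments.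
Unset Strict Implicit.
Unset Printing Implicit Defensive.

Import Order.TTheory GRing.Theory Num.Theory.
Import numFieldNormedType.Exports.

Local Open Scope classical_set_scope.
Local Open Scope ring_scope.

(** Both genericity conditions rest on one identity: tr(B^T D b) = 0 for every derivation D of R
    whenever B and b are antisymmetric and B b = 0. With D moving the chart coordinates of W, it
    shows that the bad planes have empty interior; with D moving p, it shows that B b is nonzero
    when w is nonzero and b is paired to p. Derivations play the part of tangent vectors: they act
    on the real entries of a single solution, so no smoothness of the family of solutions is needed.
    They come from Zorn's lemma, and D p can be prescribed freely because genericity is algebraic
    independence over K. The integer frequencies lie in K, hence are killed by D. The bound |B b| >=
    c |w| is not a plain compactness statement, since the b paired to p form an unbounded set. The
    condition on W makes |B b| large when b is large, which leaves a compact region. Countability of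
    the energies for each tuple of frequencies is not enough, since the tuples vary with s: the
    frequencies are therefore parameters of one definable family. *)

(** * Definable sets over R: quantifier elimination and uniform bounds on countable fibres *)

Section Definable.
Variable R : realType.
Import ordered_qelim.

(** [rterm] excludes inverses, so these are polynomial functions, with real coefficients, of
    finitely many entries of an environment; entries beyond its end read as 0. *)
Definition polyfun (g : seq R -> R) : Prop :=
  exists2 t : GRing.term R, GRing.rterm t & forall e, g e = GRing.eval e t.

Definition definable (P : seq R -> Prop) : Prop :=
  exists2 f : ord.formula R, ord.rformula f & forall e, P e <-> ord.holds e f.

Lemma polyfun_const c : polyfun (fun=> c).
Proof. by exists (GRing.Const c). Qed.

Lemma polyfun_nth i : polyfun (fun e => e`_i).
Proof. by exists (GRing.Var _ i). Qed.

Lemma polyfunD g h : polyfun g -> polyfun h -> polyfun (fun e => g e + h e).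
Proof.
move=> [t rt gt] [u ru hu]; exists (GRing.Add t u) => /= [|e]; first by rewrite rt.
by rewrite gt hu.
Qed.

Lemma polyfunN g : polyfun g -> polyfun (fun e => - g e).
Proof. by move=> [t rt gt]; exists (GRing.Opp t) => //= e; rewrite gt. Qed.

Lemma polyfunB g h : polyfun g -> polyfun h -> polyfun (fun e => g e - h e).
Proof. by move=> pg ph; apply: polyfunD => //; apply: polyfunN. Qed.

Lemma polyfunM g h : polyfun g -> polyfun h -> polyfun (fun e => g e * h e).
Proof.
move=> [t rt gt] [u ru hu]; exists (GRing.Mul t u) => /= [|e]; first by rewrite rt.
by rewrite gt hu.
Qed.

Lemma polyfun_sum (I : Type) (r : seq I) (Q : pred I) (g : I -> seq R -> R) :
  (forall i, polyfun (g i)) -> polyfun (fun e => \sum_(i <- r | Q i) g i e).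
Proof.
move=> pg; elim: r => [|i r IHr].
  by exists (GRing.Const 0) => // e; rewrite big_nil.
have [t rt gt] : polyfun (fun e => (if Q i then g i e else 0) +
    \sum_(j <- r | Q j) g j e).
  by apply: polyfunD => //; case: (Q i); [exact: pg | exact: polyfun_const].
exists t => // e; rewrite -gt big_cons; case: (Q i) => //.
by rewrite add0r.
Qed.

Lemma definable_eq g h : polyfun g -> polyfun h -> definable (fun e => g e = h e).
Proof.
move=> [t rt gt] [u ru hu]; exists (ord.Equal t u) => /= [|e]; first by rewrite rt.
by rewrite gt hu.
Qed.

Lemma definable_and P Q :
  definable P -> definable Q -> definable (fun e => P e /\ Q e).
Proof.
move=> [f rf fP] [g rg gQ]; exists (ord.And f g) => /= [|e]; first by rewrite rf.
by rewrite fP gQ.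
Qed.

Lemma definable_not P : definable P -> definable (fun e => ~ P e).
Proof. by move=> [f rf fP]; exists (ord.Not f) => //= e; rewrite fP. Qed.

Lemma definable_exists_nth P i :
  definable P -> definable (fun e => exists x, P (set_nth 0 e i x)).
Proof.
move=> [f rf fP]; exists (ord.Exists i f) => //= e.
by split=> -[x Px]; exists x; apply/fP.
Qed.

Lemma definable_ext P Q : (forall e, P e <-> Q e) -> definable P -> definable Q.
Proof. by move=> PQ [f rf fP]; exists f => // e; rewrite -PQ. Qed.

Lemma definable_forall_fin (I : finType) (P : I -> seq R -> Prop) :
  (forall i, definable (P i)) -> definable (fun e => forall i, P i e).
Proof.
move=> dP.
suff [f rf fP] : definable (fun e => forall i, i \in enum I -> P i e).
  exists f => // e; rewrite -fP; split=> [Pe i _ //|Pe i].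
  by apply: Pe; rewrite mem_enum.
elim: (enum I) => [|i r IHr]; first by exists (ord.Bool true).
have := definable_and (dP i) IHr; apply: definable_ext => e; split.
  by move=> [Pi Pr] j; rewrite inE => /predU1P[->|/Pr].
by move=> Pe; split=> [|j jr]; apply: Pe; rewrite inE ?eqxx ?jr ?orbT.
Qed.

(** Tarski's quantifier elimination for real closed fields. *)
Lemma definable_qf P : definable P ->
  exists f : ord.formula R, [/\ ord.qf_form f, ord.rformula f &
    forall e, P e <-> ord.holds e f].
Proof.
move=> [f rf fP].
exists (ord.quantifier_elim (fun i bc => qe_rcf.qfr_to_formula (qe_rcf.wproj i bc)) f).
have /andP[qf rqf] := ord.quantifier_elim_wf (@qe_rcf.wf_QE_wproj R) rf.
split=> // e; rewrite fP.
have := ord.quantifier_elim_rformP (@qe_rcf.wf_QE_wproj R)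
  (@qe_rcf.valid_QE_wproj R) e rf.
move=> h; split => [/h/(ord.qf_evalP e qf)//|/(ord.qf_evalP e qf)/h//].
Qed.

(** On a list of size exactly N, [set_nth] at N appends an entry, so m nested quantifiers build the
    suffix [ys] one entry at a time. *)
Lemma definable_exists_block P N m : definable P ->
  exists2 Q, definable Q & forall xs, size xs = N ->
    ((exists2 ys, size ys = m & P (xs ++ ys)) <-> Q xs).
Proof.
move=> dP; elim: m N => [|m IHm] N.
  exists P => // xs _; split=> [[ys /size0nil ->]|Px]; first by rewrite cats0.
  by exists [::]; rewrite ?cats0.
have [Q dQ QP] := IHm N.+1.
exists (fun e => exists x, Q (set_nth 0 e N x)); first exact: definable_exists_nth.

have snE xs y : size xs = N -> set_nth 0 xs N y = rcons xs y.
  by move=> <-; elim: xs => //= x xs ->.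
move=> xs sxs; split=> [[[//|y ys] [sys]]|[y]].
  rewrite -cat_rcons => Pxy; exists y.
  by rewrite snE//; apply/QP; rewrite ?size_rcons ?sxs//; exists ys.
rewrite snE// => /QP; rewrite size_rcons sxs => /(_ erefl)[ys sys].
by rewrite cat_rcons => Pxy; exists (y :: ys) => //=; rewrite sys.
Qed.

(** The degree in the last variable is bounded independently of the parameters [xs]; the uniformity
    of [definable_fibre_bound] starts here. *)
Lemma rterm_poly (t : GRing.term R) N : GRing.rterm t ->
  exists D, forall xs, size xs = N ->
    exists2 g : {poly R}, (size g <= D)%N &
      forall y, g.[y] = GRing.eval (rcons xs y) t.
Proof.
elim: t => //=.
- move=> i _; exists 2 => xs sxs; have [iN|iN] := eqVneq i N.
    by exists 'X; rewrite ?size_polyX// => y; rewrite hornerX nth_rcons sxs iN ltnn eqxx.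
  exists (xs`_i)%:P; first by rewrite (leq_trans (size_polyC_leq1 _)).
  move=> y; rewrite hornerC nth_rcons sxs (negbTE iN).
  by case: ltnP => // ?; rewrite nth_default// sxs.
- move=> c _; exists 1%N => xs _; exists c%:P; first exact: size_polyC_leq1.
  by move=> y; rewrite hornerC.
- move=> n _; exists 1%N => xs _; exists n%:R%:P; first exact: size_polyC_leq1.
  by move=> y; rewrite hornerC.
- move=> t1 IH1 t2 IH2 /andP[/IH1[D1 h1] /IH2[D2 h2]].
  exists (maxn D1 D2) => xs sxs.
  have [g1 s1 e1] := h1 xs sxs; have [g2 s2 e2] := h2 xs sxs.
  exists (g1 + g2) => [|y]; last by rewrite hornerD e1 e2.
  by rewrite (leq_trans (size_polyD _ _))// geq_max !leq_max s1 s2 !orbT.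
- move=> t1 IH1 /IH1[D1 h1]; exists D1 => xs sxs; have [g1 s1 e1] := h1 xs sxs.
  by exists (- g1) => [|y]; rewrite ?size_polyN// hornerN e1.
- move=> t1 IH1 n /IH1[D1 h1]; exists D1 => xs sxs; have [g1 s1 e1] := h1 xs sxs.
  exists (g1 *+ n) => [|y]; last by rewrite hornerMn e1.
  by rewrite -scaler_nat (leq_trans (size_scale_leq _ _)).
- move=> t1 IH1 t2 IH2 /andP[/IH1[D1 h1] /IH2[D2 h2]].
  exists (D1 + D2)%N => xs sxs.
  have [g1 s1 e1] := h1 xs sxs; have [g2 s2 e2] := h2 xs sxs.
  exists (g1 * g2) => [|y]; last by rewrite hornerM e1 e2.
  rewrite (leq_trans (size_polyMleq _ _))// (leq_trans (leq_pred _))//.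
  exact: leq_add.
- move=> t1 IH1 n /IH1[D1 h1]; exists ((D1 * n).+1)%N => xs sxs.
  have [g1 s1 e1] := h1 xs sxs.
  exists (g1 ^+ n) => [|y]; last by rewrite horner_exp e1.
  rewrite (leq_trans (size_poly_exp_leq _ _))// ltnS leq_mul2r.
  by rewrite (leq_trans (leq_pred _))// orbT.
Qed.

(* Away from the roots of g, the truth value of the formula is locally constant. *)
Lemma qf_locally_constant (f : ord.formula R) N : ord.qf_form f -> ord.rformula f ->
  exists D, forall xs, size xs = N ->
    exists g : {poly R}, [/\ g != 0, (size g <= D)%N &
      forall y, ~~ root g y -> exists2 e : R, 0 < e &
        forall z, `|z - y| < e ->
          ord.qf_eval (rcons xs z) f = ord.qf_eval (rcons xs y) f].
Proof.
(* An atomic relation depends only on the sign of t1 - t2, which is constant near any point where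
   this polynomial is nonzero. *)
have atom (op : rel R) t1 t2 : GRing.rterm t1 -> GRing.rterm t2 ->
    (forall a b c d, Num.sg (a - b) = Num.sg (c - d) -> op a b = op c d) ->
    exists D, forall xs, size xs = N ->
    exists g : {poly R}, [/\ g != 0, (size g <= D)%N &
      forall y, ~~ root g y -> exists2 e : R, 0 < e &
        forall z, `|z - y| < e ->
          op (GRing.eval (rcons xs z) t1) (GRing.eval (rcons xs z) t2) =
          op (GRing.eval (rcons xs y) t1) (GRing.eval (rcons xs y) t2)].
  move=> r1 r2 opP; have [|D h] := @rterm_poly (GRing.Add t1 (GRing.Opp t2)) N.
    by rewrite /= r1.
  exists (maxn D 1) => xs sxs; have [g sg gE] := h xs sxs.
  (* If the difference vanishes identically, the relation has a constant truth value and g = 1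
     serves; hence the [maxn D 1]. *)
  have [g0|g0] := eqVneq g 0.
    exists 1; split; rewrite ?oner_neq0 ?size_poly1 ?leq_max ?orbT//.
    move=> y _; exists 1 => // z _; apply: opP.
    by have := gE y; have := gE z; rewrite g0 /= !hornerC => <- <-.
  exists g; split; rewrite ?leq_max ?sg// => y gy.
  have : \forall z \near y, Num.sg g.[z] = Num.sg g.[y].
    have gc : {for y, continuous (horner g)} by exact: continuous_horner.
    have := gy; rewrite /root neq_lt => /orP[gy0|gy0].
      near=> z; rewrite !ltr0_sg//; near: z.
      exact: (cvgr_lt g.[y] gc).
    near=> z; rewrite !gtr0_sg//; near: z.
    exact: (cvgr_gt g.[y] gc).
  move=> /nbhs_ballP[e /= e0 he]; exists e => // z zy.
  apply: opP; have := gE y; have := gE z => /= <- <-; apply: he.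
  by rewrite /ball /= distrC.
(* For a connective, the product of the two polynomials has the roots of both. *)
have join (f1 f2 : seq R -> bool) (op : bool -> bool -> bool) :
  (exists D, forall xs, size xs = N ->
    exists g : {poly R}, [/\ g != 0, (size g <= D)%N &
      forall y, ~~ root g y -> exists2 e : R, 0 < e &
        forall z, `|z - y| < e -> f1 (rcons xs z) = f1 (rcons xs y)]) ->
  (exists D, forall xs, size xs = N ->
    exists g : {poly R}, [/\ g != 0, (size g <= D)%N &
      forall y, ~~ root g y -> exists2 e : R, 0 < e &
        forall z, `|z - y| < e -> f2 (rcons xs z) = f2 (rcons xs y)]) ->
  (exists D, forall xs, size xs = N ->
    exists g : {poly R}, [/\ g != 0, (size g <= D)%N &
      forall y, ~~ root g y -> exists2 e : R, 0 < e &
        forall z, `|z - y| < e ->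
          op (f1 (rcons xs z)) (f2 (rcons xs z)) =
          op (f1 (rcons xs y)) (f2 (rcons xs y))]).
  move=> [D1 h1] [D2 h2]; exists (D1 + D2)%N => xs sxs.
  have [g1 [n1 s1 l1]] := h1 xs sxs; have [g2 [n2 s2 l2]] := h2 xs sxs.
  exists (g1 * g2); split; first by rewrite mulf_neq0.
    rewrite (leq_trans (size_polyMleq _ _))// (leq_trans (leq_pred _))//.
    exact: leq_add.
  move=> y; rewrite rootM negb_or => /andP[/l1[e1 e10 E1] /l2[e2 e20 E2]].
  exists (Num.min e1 e2); first by rewrite lt_min e10.
  by move=> z; rewrite lt_min => /andP[/E1 -> /E2 ->].
elim: f => //=.
- move=> b _ _; exists 1%N => xs _; exists 1; split; rewrite ?oner_neq0 ?size_poly1//.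
  by move=> y _; exists 1.
- move=> t1 t2 _ /andP[r1 r2]; apply: (atom (fun a b => a == b)) => // a b c d sg.
  by rewrite -(subr_eq0 a b) -(subr_eq0 c d) -sgr_eq0 sg sgr_eq0.
- move=> t1 t2 _ /andP[r1 r2]; apply: (atom (fun a b => a < b)) => // a b c d sg.
  by rewrite -(subr_lt0 b a) -(subr_lt0 d c) -sgr_lt0 sg sgr_lt0.
- move=> t1 t2 _ /andP[r1 r2]; apply: (atom (fun a b => a <= b)) => // a b c d sg.
  by rewrite -(subr_le0 b a) -(subr_le0 d c) -sgr_le0 sg sgr_le0.
- move=> f1 I1 f2 I2 /andP[q1 q2] /andP[r1 r2].
  by apply: (join (fun e => ord.qf_eval e f1) (fun e => ord.qf_eval e f2) andb); auto.
- move=> f1 I1 f2 I2 /andP[q1 q2] /andP[r1 r2].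
  by apply: (join (fun e => ord.qf_eval e f1) (fun e => ord.qf_eval e f2) orb); auto.
- move=> f1 I1 f2 I2 /andP[q1 q2] /andP[r1 r2].
  by apply: (join (fun e => ord.qf_eval e f1) (fun e => ord.qf_eval e f2) implb); auto.
(* Negation is treated as a binary connective that ignores its second argument. *)
- move=> f1 I1 q1 r1; apply: (join (fun e => ord.qf_eval e f1) (fun=> true) (fun a _ => ~~ a)); first by auto.
  exists 1%N => xs _; exists 1; split; rewrite ?oner_neq0 ?size_poly1//.
  by move=> y _; exists 1.
Unshelve. all: by end_near. Qed.

(** A countable set has Lebesgue measure 0, while the interval has measure 2 e. *)
Lemma interval_uncountable (S : set R) (y e : R) : 0 < e ->
  (forall z, `|z - y| < e -> S z) -> ~ countable S.
Proof.
move=> e0 eS cS.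
have cI : countable `]y - e, y + e[%classic.
  apply: sub_countable cS; apply: subset_card_le => z /=.
  by rewrite in_itv /= => /andP[h1 h2]; apply: eS; rewrite ltr_norml; lra.
have := countable_lebesgue_measure0 cI.
rewrite lebesgue_measure_itv /= lte_fin ifT; last by lra.
by rewrite -EFinD => -[]; lra.
Qed.

(** A point of the fibre that is not a root of g has a whole interval around it in the fibre, which
    is then uncountable. So a countable fibre consists of roots of g, whose degree is bounded
    independently of [xs]. *)
Lemma definable_fibre_bound P N : definable P -> exists K, forall xs,
  size xs = N -> countable [set t | P (rcons xs t)] ->
  exists2 s : seq R, (size s <= K)%N & [set t | P (rcons xs t)] `<=` [set` s].
Proof.
move=> /definable_qf[f [qf rf fP]]; have [D h] := qf_locally_constant N qf rf.
exists D => xs sxs cS; have [g [g0 sg hg]] := h xs sxs.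
have rg x : (x \in polyrcf.rootsR g) = root g x.
  by rewrite -(polyrcf.roots_on_rootsR g0) itv_boundlr.
exists (polyrcf.rootsR g).
  rewrite (leq_trans _ sg)// ltnW// max_poly_roots//; last exact: polyrcf.uniq_roots.
  by apply/allP => x; rewrite rg.
move=> t /= Pt; rewrite rg; apply/negPn/negP => /hg[e e0 he].
apply: (@interval_uncountable _ t e e0 _ cS) => z /he hz /=.
apply/fP/(ord.qf_evalP _ qf); rewrite hz; apply/(ord.qf_evalP _ qf)/fP.
exact: Pt.
Qed.

Definition row_seq n (x : 'rV[R]_n) : seq R := [seq x ord0 i | i <- enum 'I_n].

Lemma size_row_seq n (x : 'rV[R]_n) : size (row_seq x) = n.
Proof. by rewrite size_map size_enum_ord. Qed.

Lemma nth_row_seq n (x : 'rV[R]_n) (i : 'I_n) : (row_seq x)`_i = x ord0 i.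
Proof. by rewrite (nth_map i) ?size_enum_ord ?nth_ord_enum. Qed.

Lemma rterm_mpoly n (t : GRing.term R) : GRing.rterm t ->
  exists f : mpoly.mpoly n R, forall x, peval f x = GRing.eval (row_seq x) t.
Proof.
rewrite /peval; elim: t => //=.
- move=> i _; have [ilt|ige] := ltnP i n.
    exists (mpoly.mpolyX R (mpoly.mnm1 (Ordinal ilt))) => x.
    by rewrite mpoly.mevalXU -nth_row_seq.
  (* A variable beyond the n-th reads the default value 0. *)
  exists 0 => x; rewrite raddf0 nth_default// size_row_seq//.
- by move=> c _; exists (mpoly.mpolyC n c) => x; rewrite mpoly.mevalC.
- by move=> k _; exists (k%:R) => x; rewrite rmorph_nat.
- move=> t1 I1 t2 I2 /andP[/I1[f1 h1] /I2[f2 h2]].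
  by exists (f1 + f2) => x; rewrite rmorphD /= h1 h2.
- by move=> t1 I1 /I1[f1 h1]; exists (- f1) => x; rewrite rmorphN /= h1.
- by move=> t1 I1 k /I1[f1 h1]; exists (f1 *+ k) => x; rewrite rmorphMn /= h1.
- move=> t1 I1 t2 I2 /andP[/I1[f1 h1] /I2[f2 h2]].
  by exists (f1 * f2) => x; rewrite rmorphM /= h1 h2.
- by move=> t1 I1 k /I1[f1 h1]; exists (f1 ^+ k) => x; rewrite rmorphXn /= h1.
Qed.

Lemma semialgebraic_ext n (S T : set 'rV[R]_n) : (forall x, S x <-> T x) ->
  semialgebraic S -> semialgebraic T.
Proof. by move=> ST; have -> : T = S by apply/seteqP; split => x /ST. Qed.

(** The Tarski-Seidenberg theorem: after quantifier elimination, the connectives become Boolean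
    operations on sets. *)
Lemma definable_semialgebraic n P : definable P ->
  semialgebraic [set x : 'rV[R]_n | P (row_seq x)].
Proof.
move=> /definable_qf[f [qf rf fP]].
apply: (@semialgebraic_ext _ [set x | ord.holds (row_seq x) f]).
  by move=> x /=; rewrite fP.
elim: f qf rf {P fP} => //=.
- case=> _ _.
    apply: semialgebraic_ext (semialgebraic_eq0 (0 : mpoly.mpoly n R)) => x /=.
    by rewrite /peval raddf0.
  apply: semialgebraic_ext (semialgebraic_gt0 (0 : mpoly.mpoly n R)) => x /=.
  by rewrite /peval raddf0 ltxx.
- move=> t1 t2 _ /andP[r1 r2].
  have [|g gE] := @rterm_mpoly n (GRing.Add t1 (GRing.Opp t2)); first by rewrite /= r1.
  apply: semialgebraic_ext (semialgebraic_eq0 g) => x /=; rewrite gE /=.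
  by split=> [/subr0_eq//|->]; rewrite subrr.
- move=> t1 t2 _ /andP[r1 r2].
  have [|g gE] := @rterm_mpoly n (GRing.Add t2 (GRing.Opp t1)); first by rewrite /= r1 r2.
  by apply: semialgebraic_ext (semialgebraic_gt0 g) => x /=; rewrite gE /= subr_gt0.
- move=> t1 t2 _ /andP[r1 r2].
  have [|g gE] := @rterm_mpoly n (GRing.Add t1 (GRing.Opp t2)); first by rewrite /= r1.
  apply: semialgebraic_ext (semialgebraicC (semialgebraic_gt0 g)) => x /=.
  by rewrite gE /= subr_gt0; split=> [/negP|/le_gtF ->//]; rewrite -leNgt.
- move=> f1 I1 f2 I2 /andP[/I1{}I1 /I2{}I2] /andP[/I1{}I1 /I2{}I2].
  apply: semialgebraic_ext (semialgebraicC (semialgebraicU (semialgebraicC I1)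
    (semialgebraicC I2))) => x.
  by rewrite setCU !setCK.
- move=> f1 I1 f2 I2 /andP[/I1{}I1 /I2{}I2] /andP[/I1{}I1 /I2{}I2].
  exact: semialgebraicU.
- move=> f1 I1 f2 I2 /andP[/I1{}I1 /I2{}I2] /andP[/I1{}I1 /I2{}I2].
  apply: semialgebraic_ext (semialgebraicU (semialgebraicC I1) I2) => x /=.
  by rewrite implyE.
- move=> f1 I1 /I1{}I1 /I1{}I1; exact: semialgebraicC.
Qed.

End Definable.

(** * Extending derivations from subrings to the whole of R *)

Section DualNumbers.
Variable R : realType.

(** The pair (a, a') stands for a + a' eps with eps^2 = 0; D is a derivation when a |-> a + D(a) eps
    respects sums and products. *)
Definition dual : Type := (R * R)%type.
HB.instance Definition _ := GRing.Zmodule.on dual.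

Definition dual_mul (x y : dual) : dual := (x.1 * y.1, x.1 * y.2 + x.2 * y.1).

Lemma dual_mulA : associative dual_mul.
Proof. by move=> x y z; rewrite /dual_mul /=; congr pair; ring. Qed.

Lemma dual_mulC : commutative dual_mul.
Proof. by move=> x y; rewrite /dual_mul /=; congr pair; ring. Qed.

Lemma dual_mul1 : left_id ((1, 0) : dual) dual_mul.
Proof. by case=> x y; rewrite /dual_mul /=; congr pair; ring. Qed.

Lemma dual_mulDl : left_distributive dual_mul +%R.
Proof. by move=> x y z; rewrite /dual_mul /=; congr pair => /=; ring. Qed.

Lemma dual_1neq0 : ((1, 0) : dual) != 0.
Proof. by apply/eqP => -[/eqP]; rewrite oner_eq0. Qed.

HB.instance Definition _ := GRing.Zmodule_isComNzRing.Build dual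
  dual_mulA dual_mulC dual_mul1 dual_mulDl dual_1neq0.

Lemma dualM1 (x y : dual) : (x * y).1 = x.1 * y.1. Proof. by []. Qed.
Lemma dualM2 (x y : dual) : (x * y).2 = x.1 * y.2 + x.2 * y.1. Proof. by []. Qed.
Lemma dualD1 (x y : dual) : (x + y).1 = x.1 + y.1. Proof. by []. Qed.
Lemma dualD2 (x y : dual) : (x + y).2 = x.2 + y.2. Proof. by []. Qed.

Lemma dualMn1 (x : dual) n : (x *+ n).1 = x.1 *+ n.
Proof. by elim: n => // n IHn; rewrite !mulrS dualD1 IHn. Qed.

Definition derivation (D : R -> R) : Prop :=
  {morph D : x y / x + y} /\ forall x y, D (x * y) = D x * y + x * D y.

(* Seen in the dual numbers, the graph of a derivation defined on a subring of R
   is a subring, so that Zorn's lemma can be applied to sets of dual numbers. *)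
Definition derivation_graph (G : set dual) : Prop :=
  [/\ G 1, (forall x y, G x -> G y -> G (x - y)), (forall x y, G x -> G y -> G (x * y))
    & forall y, G (0, y) -> y = 0].

Definition poly_over (G : set dual) (F : {poly dual}) : Prop := forall i, G F`_i.

Section Graph.
Variable G : set dual.
Hypothesis dG : derivation_graph G.

Let G1 : G 1. Proof. by case: dG. Qed.
Let GB x y : G x -> G y -> G (x - y). Proof. by case: dG => _ h _ _; exact: h. Qed.
Let GM x y : G x -> G y -> G (x * y). Proof. by case: dG => _ _ h _; exact: h. Qed.
Let G_eq0 x : G x -> x.1 = 0 -> x = 0.
Proof. by case: dG => _ _ _ h; case: x => a b /= Gab a0; rewrite a0 in Gab *; rewrite (h _ Gab). Qed.
Let G0 : G 0. Proof. by rewrite -(subrr 1); exact: GB. Qed.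
Let GD x y : G x -> G y -> G (x + y).
Proof. by move=> Gx Gy; have := GB Gx (GB G0 Gy); rewrite sub0r opprK. Qed.
Let GMn x n : G x -> G (x *+ n).
Proof. by move=> Gx; elim: n => // n IHn; rewrite mulrS; exact: GD. Qed.
Let Gsum (I : Type) (r : seq I) (F : I -> dual) :
  (forall i, G (F i)) -> G (\sum_(i <- r) F i).
Proof. by move=> h; elim/big_rec: _ => // i x _ Gx; exact: GD. Qed.

Lemma poly_overB F H : poly_over G F -> poly_over G H -> poly_over G (F - H).
Proof. by move=> GF GH i; rewrite coefB; exact: GB. Qed.

Lemma poly_overM F H : poly_over G F -> poly_over G H -> poly_over G (F * H).
Proof. by move=> GF GH i; rewrite coefM; apply: Gsum => j; exact: GM. Qed.

Lemma poly_overC x : G x -> poly_over G x%:P.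
Proof. by move=> Gx i; rewrite coefC; case: eqP. Qed.

Lemma poly_overXn n : poly_over G 'X^n.
Proof. by move=> i; rewrite coefXn; case: eqP. Qed.

Lemma poly_over_deriv F : poly_over G F -> poly_over G F^`().
Proof. by move=> GF i; rewrite coef_deriv; exact: GMn. Qed.

Lemma horner_dual1 (F : {poly dual}) a c : F.[(a, c)].1 = F.[(a, 0)].1.
Proof.
elim/poly_ind: F => [|F x IHF]; first by rewrite !horner0.
by rewrite !hornerMXaddC !dualD1 !dualM1 IHF.
Qed.

(** The Taylor formula F(a + c eps) = F(a) + c eps F'(a), read in the eps component. *)
Lemma horner_dual2 (F : {poly dual}) a c :
  F.[(a, c)].2 = F.[(a, 0)].2 + c * F^`().[(a, 0)].1.
Proof.
elim/poly_ind: F => [|F x IHF]; first by rewrite deriv0 !horner0 mulr0 addr0.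
rewrite derivMXaddC hornerD hornerMX !hornerMXaddC !dualD1 !dualD2 !dualM1 !dualM2.
by rewrite IHF horner_dual1 /=; ring.
Qed.

(** The subring generated by G and (a, c) consists of the values at (a, c) of polynomials over G;
    the hypothesis says exactly that it remains single-valued. *)
Lemma derivation_graph_adjoin a c :
  (forall F, poly_over G F -> F.[(a, c)].1 = 0 -> F.[(a, c)].2 = 0) ->
  let G' := [set x | exists2 F, poly_over G F & x = F.[(a, c)]] in
  [/\ derivation_graph G', G `<=` G' & G' (a, c)].
Proof.
move=> h /=; split; last 2 first.
- by move=> x Gx; exists x%:P; [exact: poly_overC | rewrite hornerC].
- by exists 'X; [have := poly_overXn 1; rewrite expr1 | rewrite hornerX].
split.
- by exists 1; [exact: (poly_overC G1) | rewrite hornerC].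
- move=> _ _ [F GF ->] [H GH ->]; exists (F - H); first exact: poly_overB.
  by rewrite hornerD hornerN.
- move=> _ _ [F GF ->] [H GH ->]; exists (F * H); first exact: poly_overM.
  by rewrite hornerM.
- by move=> y [F GF Fy]; have := h F GF; rewrite -Fy => /(_ erefl).
Qed.

(** If a satisfies a polynomial relation over G, differentiating one of minimal degree dictates c,
    and pseudo-division by it shows that every other relation is respected. Otherwise there is no
    relation to respect. *)
Lemma derivation_graph_alg a : exists c,
  forall F, poly_over G F -> F.[(a, c)].1 = 0 -> F.[(a, c)].2 = 0.
Proof.
have [|tr] := pselect (exists n, exists F, [/\ poly_over G F, F != 0,
    F.[(a, 0)].1 = 0 & size F = n]); last first.
  exists 0 => F GF Fa; have [->|F0] := eqVneq F 0; first by rewrite horner0.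
  by exfalso; apply: tr; exists (size F), F.
move=> /cid exn.
have {exn} [n0 Pn0] := exn.
have exb : exists n, `[< exists F, [/\ poly_over G F, F != 0,
    F.[(a, 0)].1 = 0 & size F = n] >] by exists n0; apply/asboolP.
case: (ex_minnP exb) => n /asboolP[F [GF F0 Fa sF]] nmin.
have minF H : poly_over G H -> H.[(a, 0)].1 = 0 -> (size H < size F)%N -> H = 0.
  move=> GH Ha sH; apply/eqP/negPn/negP => H0.
  have : (n <= size H)%N by apply: nmin; apply/asboolP; exists H.
  by rewrite -sF leqNgt sH.
have lcF : (lead_coef F).1 != 0.
  apply/eqP => l0; have := G_eq0 (GF _) l0.
  by move/eqP; rewrite -/(lead_coef F) lead_coef_eq0 (negbTE F0).
(* By minimality, a vanishing derivative at a would make F' zero. In characteristic 0 this makes F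
   constant, equal to its leading coefficient, which does not vanish. *)
have F'a : F^`().[(a, 0)].1 != 0.
  apply/eqP => F'a; have := minF _ (poly_over_deriv GF) F'a (lt_size_deriv F0).
  have [s1|s1] := leqP (size F) 1.
    move: Fa lcF; rewrite (size1_polyC s1) hornerC lead_coefC => ->.
    by rewrite eqxx.
  move=> /(congr1 (fun p : {poly dual} => (p`_(size F).-2).1)).
  rewrite coef_deriv coef0 dualMn1 -[(size F).-2.+1](_ : (size F).-1 = _).
    by apply/eqP; rewrite mulrn_eq0 negb_or lcF andbT; case: (size F) s1 => [|[]].
  by case: (size F) s1 => [|[]].
(* The solution in c of F(a + c eps) = 0, by the Taylor formula. *)
pose c := - F.[(a, 0)].2 / F^`().[(a, 0)].1.
have Fc : F.[(a, c)] = 0.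
  rewrite [LHS]surjective_pairing horner_dual1 Fa horner_dual2 /c.
  by rewrite divfK// subrr.
exists c => H; move: {2}(size H) (leqnn (size H)) => m.
elim: m H => [|m IHm] H.
  by rewrite leqn0 size_poly_eq0 => /eqP ->; rewrite horner0.
move=> sH GH; rewrite horner_dual1 => Ha.
have [sHF|sHF] := ltnP (size H) (size F); first by rewrite (minF H)// horner0.
(* Pseudo-division: G is only a subring, so the leading terms are cancelled by cross-multiplication
   instead of division. *)
pose H' := (lead_coef F)%:P * H - (lead_coef H)%:P * 'X^(size H - size F) * F.
have GH' : poly_over G H'.
  by apply: poly_overB; repeat apply: poly_overM => //; try exact: poly_overXn;
    apply: poly_overC; exact: GF || exact: GH.
have H'E : H'.[(a, c)] = lead_coef F * H.[(a, c)].
  by rewrite /H' hornerD hornerN !hornerM !hornerC Fc mulr0 subr0.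
have sH' : (size H' <= m)%N.
  apply/leq_sizeP => j mj; rewrite /H' coefB coefCM -mulrA coefCM coefXnM.
  have [jlt|jge] := ltnP j (size H - size F).
    by exfalso; have := F0; rewrite -size_poly_gt0; move: jlt mj sH; lia.
  have [jH|jH] := eqVneq j (size H).-1.
    have -> : (j - (size H - size F) = (size F).-1)%N.
      have := F0; rewrite -size_poly_gt0; move: sHF jH; lia.
    by rewrite jH -!/(lead_coef _) mulrC subrr.
  have h1 : (size H <= j)%N by move: jH mj sH; lia.
  have h2 : (size F <= j - (size H - size F))%N by move: h1 sHF; lia.
  by rewrite (nth_default _ h1) (nth_default _ h2) !mulr0 subr0.
have := IHm H' sH' GH'; rewrite !H'E dualM1 dualM2 horner_dual1 Ha mulr0 => /(_ erefl).
by rewrite mulr0 addr0 => /eqP; rewrite mulf_eq0 (negbTE lcF) => /eqP.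
Qed.

End Graph.

(** A maximal graph containing G is defined at every real number, because any missing number can be
    adjoined. *)
Lemma derivation_of_graph G : derivation_graph G ->
  exists D, derivation D /\ forall x, G x -> D x.1 = x.2.
Proof.
move=> dG.
pose P := [set H : set dual | H = set0 \/ derivation_graph H /\ G `<=` H].
have [H [PH Hmax]] : exists H, P H /\ forall B, H `<` B -> ~ P B.
  apply: Zorn_bigcup => F FP Ftot.
  have [[H0 FH0 [dH0 GH0]]|none] := pselect (exists2 H, F H & derivation_graph H /\ G `<=` H); last first.
    left; apply/seteqP; split => // x [X FX Xx].
    have [X0|X0] := FP _ FX; first by rewrite X0 in Xx.
    by exfalso; apply: none; exists X.
  have both x y : (\bigcup_(X in F) X) x -> (\bigcup_(X in F) X) y ->
      exists X, [/\ F X, derivation_graph X, X x & X y].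
    move=> [X FX Xx] [Y FY Yy].
    have dX : derivation_graph X.
      by case: (FP _ FX) => [X0|[h _]]; [rewrite X0 in Xx | exact: h].
    have dY : derivation_graph Y.
      by case: (FP _ FY) => [Y0|[h _]]; [rewrite Y0 in Yy | exact: h].
    have [XY|YX] := Ftot X Y FX FY; first by exists Y; split => //; exact: XY.
    by exists X; split => //; exact: YX.
  right; split; last by move=> x Gx; exists H0 => //; exact: GH0.
  split.
  - by exists H0 => //; case: dH0.
  - move=> x y Fx Fy; have [X [FX dX Xx Xy]] := both x y Fx Fy.
    by exists X => //; case: dX => _ h _ _; exact: h.
  - move=> x y Fx Fy; have [X [FX dX Xx Xy]] := both x y Fx Fy.
    by exists X => //; case: dX => _ _ h _; exact: h.
  - move=> y Fy; have [X [FX dX Xx _]] := both _ _ Fy Fy.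
    by case: dX => _ _ _; exact.
have {PH} [dH GH] : derivation_graph H /\ G `<=` H.
  case: PH => // H0; exfalso; apply: (Hmax G); last first.
    by rewrite /P /=; right; split.
  rewrite H0; split => // h.
  by case: dG => G1 _ _ _; have := h _ G1.
have tot a : exists c, H (a, c).
  have [c hc] := derivation_graph_alg dH a.
  have [dH' HH' Hac] := derivation_graph_adjoin dH hc.
  exists c; apply/not_notP => nHac.
  apply: (Hmax _ (conj HH' _)); last by right; split => // x /GH/HH'.
  by move=> h; apply: nHac; exact: h.
pose D a := xget 0 [set c | H (a, c)].
have HD a : H (a, D a).
  exact: (@xgetPex _ 0 [set c | H (a, c)] (tot a)).
have uniq a c c' : H (a, c) -> H (a, c') -> c = c'.
  case: dH => _ hB _ h0 Hc Hc'.
  apply/eqP; rewrite -subr_eq0; apply/eqP/h0.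
  rewrite -(subrr a).
  exact: (hB _ _ Hc Hc').
have DB x y : D (x - y) = D x - D y.
  by apply: uniq (HD _) _; case: dH => _ hB _ _; exact: (hB _ _ (HD x) (HD y)).
exists D; split; last by move=> [a c] /GH Hac; exact: uniq (HD a) Hac.
split=> [x y|x y].
  have D0 : D 0 = 0 by have := DB 0 0; rewrite subr0 subrr.
  have DN z : D (- z) = - D z by rewrite -sub0r DB D0 sub0r.
  by rewrite -[y in LHS]opprK DB DN opprK.
apply: uniq (HD _) _; case: dH => _ _ hM _.
by rewrite addrC; exact: (hM _ _ (HD x) (HD y)).
Qed.

End DualNumbers.

(** Completeness of the space of row vectors, for Baire's theorem. *)
HB.instance Definition _ (R : realType) (m n : nat) := Complete.on 'M[R]_(m, n).

(** * Points that are generic over a countable subring, and derivations with prescribed values *)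

Section Generic.
Variable R : realType.

Definition subring_set (K : set R) : Prop :=
  [/\ K 1, (forall x y, K x -> K y -> K (x - y)) & forall x y, K x -> K y -> K (x * y)].

Definition mpoly_over (K : set R) n (f : mpoly.mpoly n R) : Prop :=
  forall m, K (mpoly.mcoeff m f).

(** Algebraic independence of the coordinates over K; the zero polynomial is expressed as one that
    vanishes everywhere, which is the same over an infinite field. *)
Definition generic (K : set R) n (x : 'rV[R]_n) : Prop :=
  forall f, mpoly_over K f -> peval f x = 0 -> forall y, peval f y = 0.

Lemma countable_range (T : countType) (U : Type) (f : T -> U) : countable (range f).
Proof. by apply: card_le_trans (card_image_le _ _) (countableP _). Qed.

Lemma countable_subrange (T : Type) (C : set T) : countable C -> C !=set0 ->
  exists e : nat -> T, C `<=` range e.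
Proof.
move=> /pfcard_geP[->|[f]] [x Cx] //.
by exists f => y Cy; have [n _ <-] := 'surj_f Cy; exists n.
Qed.

(** A polynomial is coded by a finite list of monomials and indices of coefficients. The ring A is
    arbitrary so that integer polynomials are covered as well. *)
Lemma countable_mpoly_over (A : nzRingType) n (K : set A) (e : nat -> A) :
  K `<=` range e -> countable [set f : mpoly.mpoly n A | forall m, K (mpoly.mcoeff m f)].
Proof.
move=> Ke.
pose h (s : seq (mpoly.multinom n * nat)) : mpoly.mpoly n A :=
  \sum_(mi <- s) e mi.2 *: mpoly.mpolyX A mi.1.
apply: sub_countable (countable_range h); apply: subset_card_le => f Kf /=.
have /choice[i iE] : forall m, exists k, e k = mpoly.mcoeff m f.
  by move=> m; have [k _ kE] := Ke _ (Kf m); exists k.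
exists [seq (m, i m) | m <- mpoly.msupp f] => //.
rewrite /h big_map [RHS]mpoly.mpolyE; apply: eq_bigr => m _ /=.
by rewrite iE.
Qed.

Lemma countable_poly_over (K : set R) : countable K ->
  countable [set F : {poly R} | forall i, K F`_i].
Proof.
have [[a Ka]|none] := pselect (K !=set0); last first.
  move=> _; rewrite (_ : mkset _ = set0)//; apply/seteqP; split => // F KF.
  by apply: none; exists F`_0.
move=> /countable_subrange[|e Ke]; first by exists a.
apply: sub_countable (countable_range (fun s : seq nat => \poly_(i < size s) e s`_i)).
apply: subset_card_le => F KF /=.
have /choice[i iE] : forall m, exists k, e k = F`_m.
  by move=> m; have [k _ kE] := Ke _ (KF m); exists k.
exists (mkseq i (size F)) => //; apply/polyP => m; rewrite coef_poly size_mkseq.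
by case: ltnP => mF; [rewrite nth_mkseq | rewrite nth_default].
Qed.

Definition algebraic_over (K : set R) (a : R) : Prop :=
  exists F : {poly R}, [/\ F != 0, (forall i, K F`_i) & root F a].

Lemma countable_algebraic_over (K : set R) : countable K -> countable (algebraic_over K).
Proof.
move=> /countable_poly_over cK.
have h : countable (\bigcup_(F in [set F : {poly R} | forall i, K F`_i])
    [set` polyrcf.rootsR F]).
  by apply: bigcup_countable => // F _; apply: finite_set_countable; exact: finite_seq.
apply: sub_countable h; apply: subset_card_le => a [F [F0 KF Fa]].
by exists F => //=; rewrite -(polyrcf.roots_on_rootsR F0) itv_boundlr.
Qed.

(** The restriction of a polynomial to the line t |-> x + t c. Its derivative at 0 is the
    directional derivative along c, which defines derivations on K[x]. *)
Definition line_poly n (x c : 'rV[R]_n) : {rmorphism mpoly.mpoly n R -> {poly R}} :=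
  mpoly.mmap polyC (fun i => (x ord0 i)%:P + (c ord0 i) *: 'X).

Lemma horner_line_poly n (x c : 'rV[R]_n) f t :
  (line_poly x c f).[t] = peval f (x + t *: c).
Proof.
rewrite /line_poly /= /peval /mpoly.meval /mpoly.mmap horner_sum; apply: eq_bigr => m _.
rewrite hornerM hornerC /=; congr (_ * _).
rewrite /mpoly.mmap1 horner_prod; apply: eq_bigr => i _.
by rewrite horner_exp hornerD hornerC hornerZ hornerX !mxE mulrC.
Qed.

Lemma line_polyC n (x c : 'rV[R]_n) a : line_poly x c (mpoly.mpolyC n a) = a%:P.
Proof. by rewrite /line_poly /= mpoly.mmapC. Qed.

Lemma line_polyX n (x c : 'rV[R]_n) i :
  line_poly x c (mpoly.mpolyX R (mpoly.mnm1 i)) = (x ord0 i)%:P + (c ord0 i) *: 'X.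
Proof. by rewrite /line_poly /= mpoly.mmapX mpoly.mmap1U. Qed.

Lemma poly_eq0_on_interval (g : {poly R}) e : 0 < e ->
  (forall t, `|t| < e -> g.[t] = 0) -> g = 0.
Proof.
move=> e0 ge; apply/eqP/negPn/negP => g0.
(* As many distinct roots as the size of g; the denominators start at 2 to stay strictly below e. *)
pose s := [seq e / (i.+2)%:R | i <- iota 0 (size g)].
suff : (size s < size g)%N by rewrite size_map size_iota ltnn.
apply: max_poly_roots => //.
  apply/allP => _ /mapP[i _ ->]; apply/eqP/ge.
  rewrite gtr0_norm ?divr_gt0 ?ltr0n// ltr_pdivrMr ?ltr0n//.
  by rewrite ltr_pMr// ltr1n.
rewrite map_inj_uniq ?iota_uniq// => i j /(mulfI (lt0r_neq0 e0))/invr_inj/eqP.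
by rewrite eqr_nat => /eqP[].
Qed.

(** On the line from a point of O to y, f is a univariate polynomial that vanishes on an
    interval. *)
Lemma open_peval_eq0 n (f : mpoly.mpoly n R) (O : set 'rV[R]_n) :
  open O -> O !=set0 -> (forall x, O x -> peval f x = 0) -> forall y, peval f y = 0.
Proof.
move=> oO [x Ox] fO y.
have [e e0 he] : exists2 e, 0 < e & forall t, `|t| < e -> O (x + t *: (y - x)).
  have : \forall t \near (0 : R), O (x + t *: (y - x)).
    have hc : continuous (fun t : R => x + t *: (y - x)).
      move=> t; apply: cvgD; first exact: cvg_cst.
      by apply: cvgZ; [exact: cvg_id | exact: cvg_cst].
    apply: (hc 0); apply: open_nbhs_nbhs; split => //=.
    by rewrite scale0r addr0.
  move=> /nbhs_ballP[e /= e0 he]; exists e => // t te; apply: he.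
  by rewrite /ball /= sub0r normrN.
have g0 : line_poly x (y - x) f = 0.
  by apply: (poly_eq0_on_interval e0) => t te; rewrite horner_line_poly; apply/fO/he.
have := horner_line_poly x (y - x) f 1.
by rewrite g0 horner0 scale1r addrC subrK => <-.
Qed.

(** On K[x], let D send f(x) to the derivative of f at x along c. This is well defined because f(x)
    = 0 forces f = 0 when x is generic; then D is extended to R. *)
Lemma derivation_generic K n (x c : 'rV[R]_n) : subring_set K -> generic K x ->
  exists D, [/\ derivation D, forall a, K a -> D a = 0 & forall i, D (x ord0 i) = c ord0 i].
Proof.
move=> [K1 KB KM] gx.
have K0 : K 0 by rewrite -(subrr 1); exact: KB.
have KD a b : K a -> K b -> K (a + b).
  by move=> Ka Kb; have := KB _ _ Ka (KB _ _ K0 Kb); rewrite sub0r opprK.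
pose G : set (dual R) := [set z | exists2 f, mpoly_over K f &
  z = ((line_poly x c f).[0], (line_poly x c f)^`().[0])].
have GC a : K a -> G (a, 0).
  move=> Ka; exists (mpoly.mpolyC n a); last by rewrite line_polyC derivC !hornerC.
  by move=> m; rewrite mpoly.mcoeffC; case: eqP => _; rewrite ?mulr1 ?mulr0.
have GX i : G (x ord0 i, c ord0 i).
  exists (mpoly.mpolyX R (mpoly.mnm1 i)).
    by move=> m; rewrite mpoly.mcoeffX; case: eqP.
  rewrite line_polyX derivD derivC derivZ derivX !hornerE.
  by rewrite ?mulr0 ?addr0 ?mulr1 ?add0r.
have dG : derivation_graph G.
  split.
  - exact: GC.
  - move=> _ _ [f Kf ->] [g Kg ->]; exists (f - g).
      by move=> m; rewrite mpoly.mcoeffB; exact: KB.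
    by rewrite rmorphB /= derivB !hornerE.
  - move=> _ _ [f Kf ->] [g Kg ->]; exists (f * g).
      move=> m; rewrite mpoly.mcoeffM; elim/big_ind: _ => // i _; exact: KM.
    by rewrite rmorphM /= derivM !hornerE /GRing.mul /= /dual_mul /= addrC.
  - move=> y [f Kf [f0 ->]].
    have fx : peval f x = 0 by have := horner_line_poly x c f 0; rewrite scale0r addr0 -f0.
    suff -> : line_poly x c f = 0 by rewrite deriv0 horner0.
    apply: (@poly_eq0_on_interval _ 1) => // t _; rewrite horner_line_poly.
    exact: gx.
have [D [dD DG]] := derivation_of_graph dG; exists D; split => // [a Ka|i].
  exact: (DG _ (GC _ Ka)).
exact: (DG _ (GX i)).
Qed.

(** The pair (a, 1) is adjoined to the graph of the zero derivation on K; a satisfies no nonzero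
    relation that could obstruct this. *)
Lemma derivation_transcendental K a : subring_set K -> ~ algebraic_over K a ->
  exists D, [/\ derivation D, forall b, K b -> D b = 0 & D a = 1].
Proof.
move=> [K1 KB KM] tra.
pose G : set (dual R) := [set z | K z.1 /\ z.2 = 0].
have dG : derivation_graph G.
  split => //.
  - by move=> [u u'] [v v'] [/= Ku ->] [/= Kv ->]; split; [exact: KB | exact: subrr].
  - move=> [u u'] [v v'] [/= Ku ->] [/= Kv ->]; split; first exact: KM.
    by rewrite /= mulr0 mul0r addr0.
  - by move=> y [].
have h F : poly_over G F -> F.[(a, 1)].1 = 0 -> F.[(a, 1)].2 = 0.
  move=> GF Fa; suff -> : F = 0 by rewrite horner0.
  have F2 i : (F`_i).2 = 0 by case: (GF i).
  have F1 i : K (F`_i).1 by case: (GF i).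
  pose f := \poly_(i < size F) (F`_i).1.
  have fE i : f`_i = (F`_i).1.
    by rewrite coef_poly; case: ltnP => // iF; rewrite nth_default.
  have powE i : (((a, 1) : dual R) ^+ i).1 = a ^+ i.
    by elim: i => // i IHi; rewrite !exprS dualM1 IHi.
  have fa : f.[a] = 0.
    rewrite -Fa horner_poly horner_coef.
    rewrite (@big_morph _ _ (fun z : dual R => z.1) 0 +%R 0 +%R)//.
    by apply: eq_bigr => i _; rewrite dualM1 powE.
  have f0 : f = 0.
    apply/eqP/negPn/negP => f0; apply: tra; exists f; split => //.
      by move=> i; rewrite fE.
    by rewrite /root fa.
  apply/polyP => i; rewrite coef0 [LHS]surjective_pairing F2 -fE f0 coef0//.
have [dG' GG' G'a] := derivation_graph_adjoin dG h.
have [D [dD DG]] := derivation_of_graph dG'; exists D; split => // [b Kb|].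
  by apply: (DG (b, 0)); apply: GG'; split.
exact: (DG _ G'a).
Qed.

(** Injectivity of f gives k <= n, so only k = n has to be excluded; there f permutes the
    coordinates and carries an interior point back to S. *)
Lemma positive_codim_empty_interior n (S : set 'rV[R]_n) :
  interior S = set0 -> positive_codim S.
Proof.
move=> S0 k [f finj [z0 hz0]].
have kn : (k <= n)%N by have := leq_card f finj; rewrite !card_ord.
rewrite ltn_neqAle kn andbT; apply/eqP => kn'; subst k.
have [g fK gK] := injF_bij finj.
move: hz0 => /nbhs_ballP[e /= e0 he].
suff : interior S (colsub g z0) by rewrite S0.
apply/nbhs_ballP; exists e => //= y [_ yb].
have [x Sx xy] : [set colsub f x | x in S] (colsub f y).
  apply: he; split => // i j; rewrite !mxE.
  by have := yb i (f j); rewrite !mxE fK.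
suff -> : y = x by [].
by apply/rowP => j; have /rowP/(_ (g j)) := xy; rewrite !mxE gK.
Qed.

Lemma interior_peval_eq0 n (f : mpoly.mpoly n R) :
  (exists y, peval f y <> 0) -> interior [set x | peval f x = 0] = set0.
Proof.
move=> [y fy]; apply/seteqP; split => // x hx; apply: fy.
apply: (@open_peval_eq0 _ f (interior [set x | peval f x = 0])).
- exact: open_interior.
- by exists x.
- by move=> z /interior_subset.
Qed.

Lemma enum_mpoly_over K n : subring_set K -> countable K ->
  exists F : nat -> mpoly.mpoly n R, @mpoly_over K n `<=` range F.
Proof.
move=> [K1 KB _] cK; have [|e Ke] := countable_subrange cK; first by exists 1.
have K0 : K 0 by rewrite -(subrr 1); exact: KB.
apply: (countable_subrange (countable_mpoly_over n Ke)).
by exists 0 => m; rewrite mpoly.mcoeff0.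
Qed.

Lemma generic_point_generic K n : subring_set K -> countable K ->
  generic_point (fun x : 'rV[R]_n => generic K x).
Proof.
move=> sK cK; have [F FC] := enum_mpoly_over n sK cK.
(* The zero set of the i-th polynomial, replaced by the empty set when this polynomial vanishes
   identically. *)
pose Z i := [set x | peval (F i) x = 0 /\ exists y, peval (F i) y <> 0].
exists Z; last first.
  move=> x nZ f /FC[i _ <-] fx y; apply: contrapT => fy.
  by apply: nZ; exists i => //; split => //; exists y.
move=> i; rewrite /Z; have [[y Fy]|noty] := pselect (exists y, peval (F i) y <> 0).
  have -> : [set x | peval (F i) x = 0 /\ exists y, peval (F i) y <> 0] =
      [set x | peval (F i) x = 0].
    by apply/seteqP; split => [x []//|x Fx]; split => //; exists y.
  split; first exact: semialgebraic_eq0.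
  by apply: positive_codim_empty_interior; apply: interior_peval_eq0; exists y.
have -> : [set x | peval (F i) x = 0 /\ exists y, peval (F i) y <> 0] = set0.
  by apply/seteqP; split => // x [].
split; last by apply: positive_codim_empty_interior; rewrite interior0.
apply: semialgebraic_ext (semialgebraic_gt0 0) => x /=.
by rewrite /peval raddf0 ltxx.
Qed.

Lemma continuous_sum (T : topologicalType) (I : Type) (r : seq I) (Q : pred I)
    (F : I -> T -> R) :
  (forall i, continuous (F i)) -> continuous (fun x => \sum_(i <- r | Q i) F i x).
Proof.
move=> cF x; elim: r => [|i r IHr].
  by under eq_fun do rewrite big_nil; exact: cvg_cst.
under eq_fun do rewrite big_cons.
by case: (Q i) => //; apply: cvgD => //; exact: cF.
Qed.

Lemma continuous_prod (T : topologicalType) (I : Type) (r : seq I) (Q : pred I)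
    (F : I -> T -> R) :
  (forall i, continuous (F i)) -> continuous (fun x => \prod_(i <- r | Q i) F i x).
Proof.
move=> cF x; elim: r => [|i r IHr].
  by under eq_fun do rewrite big_nil; exact: cvg_cst.
under eq_fun do rewrite big_cons.
by case: (Q i) => //; apply: cvgM => //; exact: cF.
Qed.

Lemma continuous_peval n (f : mpoly.mpoly n R) : continuous (peval f).
Proof.
have -> : peval f = fun x => \sum_(m <- mpoly.msupp f)
    mpoly.mcoeff m f * \prod_i x ord0 i ^+ mpoly.fun_of_multinom m i.
  by apply/funext => x; rewrite /peval mpoly.mevalE.
apply: continuous_sum => m x.
apply: (@cvgM R _ (nbhs x) _ (fun=> mpoly.mcoeff m f)); first exact: cvg_cst.
apply: (@continuous_prod 'rV[R]_n) => i {}x.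
exact: (continuous_comp (@coord_continuous R _ _ ord0 i x)
  (@exprn_continuous R (mpoly.fun_of_multinom m i) _)).
Qed.

(** Baire's theorem: the zero sets of the countably many nonzero polynomials over K are closed with
    empty interior. *)
Lemma generic_dense K n (O : set 'rV[R]_n) : subring_set K -> countable K ->
  open O -> O !=set0 -> exists2 x, O x & generic K x.
Proof.
move=> sK cK oO O0; have [F FC] := enum_mpoly_over n sK cK.
pose U i := [set x | (forall y, peval (F i) y = 0) \/ peval (F i) x <> 0].
have [i|x [Ox Ux]] := @Baire R 'rV[R]_n U _ O O0 oO; last first.
  exists x => // f /FC[i _ <-] fx y.
  by have [//|] := Ux i I.
have [z0|/existsNP[y Fy]] := pselect (forall y, peval (F i) y = 0).
  have -> : U i = setT by apply/seteqP; split => // x _; left.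
  by split; [exact: openT | move=> O' [x O'x] _; exists x].
have -> : U i = ~` [set x | peval (F i) x = 0].
  apply/seteqP; split => x /=; last by right.
  by case=> // h; have := Fy (h y).
split.
  rewrite openC; apply: (@closed_comp _ _ (peval (F i)) [set 0]).
    by move=> z _; exact: continuous_peval.
  exact: closed_eq.
move=> O' O'0 oO'; apply: contrapT => none; apply: Fy.
apply: (open_peval_eq0 oO' O'0) => x O'x; apply: contrapT => Fx.
by apply: none; exists x.
Qed.

Lemma countable_subring (s : seq R) :
  exists K, [/\ subring_set K, countable K & forall x, x \in s -> K x].
Proof.
(* The subring generated by s is the image of the integer polynomials in [size s] variables. *)
pose ev (f : mpoly.mpoly (size s) int) : R := mpoly.mmap intr (fun i => s`_i) f.
have evE : ev = (mpoly.mmap intr (fun i : 'I_(size s) => s`_i) :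
  {rmorphism mpoly.mpoly (size s) int -> R}) by [].
exists (range ev); split.
- split.
  + by exists 1 => //; rewrite evE rmorph1.
  + by move=> _ _ [f _ <-] [g _ <-]; exists (f - g) => //; rewrite evE rmorphB.
  + by move=> _ _ [f _ <-] [g _ <-]; exists (f * g) => //; rewrite evE rmorphM.
- have e : countable [set: int] by exact: countableP.
  have [|g Zg] := countable_subrange e; first by exists 0.
  have c := countable_mpoly_over (size s) Zg.
  apply: card_le_trans (card_image_le _ _) _.
  by apply: sub_countable c; apply: subset_card_le => f _ m.
- move=> x xs; exists (mpoly.mpolyX int (mpoly.mnm1 (Ordinal (eq_ind_r is_true xs (index_mem x s))))) => //.
  by rewrite /ev mpoly.mmapX mpoly.mmap1U /= nth_index.
Qed.

End Generic.

(** * Matrices with polynomial entries, their encoding in lists, and lower bounds by compactness *)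

Section PolynomialMatrices.
Variable R : realType.

Definition polymx m n (g : seq R -> 'M[R]_(m, n)) : Prop :=
  forall i j, polyfun (fun e => g e i j).

Lemma polyfun_ext (g h : seq R -> R) : g =1 h -> polyfun g -> polyfun h.
Proof. by move=> /funext ->. Qed.

Lemma polymx_const m n (M : 'M[R]_(m, n)) : polymx (fun=> M).
Proof. by move=> i j; exact: polyfun_const. Qed.

Lemma polymxB m n (g h : seq R -> 'M[R]_(m, n)) :
  polymx g -> polymx h -> polymx (fun e => g e - h e).
Proof.
move=> pg ph i j; apply: polyfun_ext (polyfunB (pg i j) (ph i j)) => e.
by rewrite !mxE.
Qed.

Lemma polymxD m n (g h : seq R -> 'M[R]_(m, n)) :
  polymx g -> polymx h -> polymx (fun e => g e + h e).
Proof.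
move=> pg ph i j; apply: polyfun_ext (polyfunD (pg i j) (ph i j)) => e.
by rewrite !mxE.
Qed.

Lemma polymxZ m n (c : seq R -> R) (g : seq R -> 'M[R]_(m, n)) :
  polyfun c -> polymx g -> polymx (fun e => c e *: g e).
Proof.
move=> pc pg i j; apply: polyfun_ext (polyfunM pc (pg i j)) => e.
by rewrite !mxE.
Qed.

Lemma polymxM m n p (g : seq R -> 'M[R]_(m, n)) (h : seq R -> 'M[R]_(n, p)) :
  polymx g -> polymx h -> polymx (fun e => g e *m h e).
Proof.
move=> pg ph i j.
apply: (@polyfun_ext (fun e => \sum_k g e i k * h e k j)).
  by move=> e; rewrite mxE.
by apply: polyfun_sum => k; exact: polyfunM.
Qed.

Lemma polymx_tr m n (g : seq R -> 'M[R]_(m, n)) : polymx g -> polymx (fun e => (g e)^T).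
Proof. by move=> pg i j; apply: polyfun_ext (pg j i) => e; rewrite mxE. Qed.

Lemma polymx_sum m n (I : Type) (r : seq I) (g : I -> seq R -> 'M[R]_(m, n)) :
  (forall i, polymx (g i)) -> polymx (fun e => \sum_(i <- r) g i e).
Proof.
move=> pg i j; apply: (@polyfun_ext (fun e => \sum_(k <- r) g k e i j)).
  by move=> e; rewrite summxE.
by apply: polyfun_sum => k; exact: pg.
Qed.

Lemma polyfun_trace n (g : seq R -> 'M[R]_n) : polymx g -> polyfun (fun e => \tr (g e)).
Proof. by move=> pg; apply: polyfun_sum => i; exact: pg. Qed.

(** The squared Frobenius norm; left squared so that it is a polynomial in the entries. *)
Definition sqn m n (M : 'M[R]_(m, n)) : R := \sum_i \sum_j M i j ^+ 2.

Lemma polyfun_sqn m n (g : seq R -> 'M[R]_(m, n)) : polymx g -> polyfun (fun e => sqn (g e)).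
Proof.
move=> pg; apply: polyfun_sum => i; apply: polyfun_sum => j.
exact: (polyfunM (pg i j) (pg i j)).
Qed.

Lemma sqn_ge0 m n (M : 'M[R]_(m, n)) : 0 <= sqn M.
Proof. by apply: sumr_ge0 => i _; apply: sumr_ge0 => j _; exact: sqr_ge0. Qed.

Lemma sqn_entry m n (M : 'M[R]_(m, n)) i j : M i j ^+ 2 <= sqn M.
Proof.
rewrite /sqn (bigD1 i)//= (bigD1 j)//= -addrA lerDl addr_ge0//.
  by apply: sumr_ge0 => k _; exact: sqr_ge0.
by apply: sumr_ge0 => k _; apply: sumr_ge0 => j' _; exact: sqr_ge0.
Qed.

Lemma sqn_eq0 m n (M : 'M[R]_(m, n)) : (sqn M == 0) = (M == 0).
Proof.
apply/eqP/eqP => [M0|->]; last first.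
  by rewrite /sqn big1// => i _; rewrite big1// => j _; rewrite mxE expr0n.
apply/matrixP => i j; rewrite mxE; apply/eqP; rewrite -sqrf_eq0 eq_le sqr_ge0.
by rewrite -M0 sqn_entry.
Qed.

Lemma sqn0 m n : sqn (0 : 'M[R]_(m, n)) = 0.
Proof. by apply/eqP; rewrite sqn_eq0. Qed.

Lemma sqn_gt0 m n (M : 'M[R]_(m, n)) : (0 < sqn M) = (M != 0).
Proof. by rewrite lt0r sqn_ge0 sqn_eq0 andbT. Qed.

Lemma sqnZ m n c (M : 'M[R]_(m, n)) : sqn (c *: M) = c ^+ 2 * sqn M.
Proof.
rewrite /sqn mulr_sumr; apply: eq_bigr => i _; rewrite mulr_sumr.
by apply: eq_bigr => j _; rewrite mxE exprMn.
Qed.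

Lemma definable_mx_eq m n (g h : seq R -> 'M[R]_(m, n)) :
  polymx g -> polymx h -> definable (fun e => g e = h e).
Proof.
move=> pg ph.
apply: (@definable_ext _ (fun e => forall i j, g e i j = h e i j)).
  by move=> e; split=> [gh|-> //]; apply/matrixP.
apply: definable_forall_fin => i; apply: definable_forall_fin => j.
exact: definable_eq.
Qed.

(** Decodes the block of length m n at offset [off], in the order of [mxvec]; [mx_seq] is the
    encoding. *)
Definition mx_at (off m n : nat) (e : seq R) : 'M[R]_(m, n) :=
  \matrix_(i, j) e`_(off + mxvec_index i j).

Definition mx_seq m n (M : 'M[R]_(m, n)) : seq R := row_seq (mxvec M).

Lemma polymx_at off m n : polymx (@mx_at off m n).
Proof. by move=> i j; apply: polyfun_ext (polyfun_nth _ _) => e; rewrite mxE. Qed.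

Lemma size_mx_seq m n (M : 'M[R]_(m, n)) : size (mx_seq M) = (m * n)%N.
Proof. exact: size_row_seq. Qed.

Lemma mx_at_seq m n (xs zs : seq R) (M : 'M[R]_(m, n)) off : size xs = off ->
  mx_at off m n (xs ++ mx_seq M ++ zs) = M.
Proof.
move=> <-; apply/matrixP => i j; rewrite mxE nth_cat ltnNge leq_addr [~~ true]/= addKn.
by rewrite nth_cat size_mx_seq ltn_ord nth_row_seq mxvecE.
Qed.

Lemma row_seqK n (ys : seq R) : size ys = n -> row_seq (\row_(i < n) ys`_i) = ys.
Proof.
move=> sy; apply: (@eq_from_nth _ 0); rewrite size_row_seq// => i ilt.
by rewrite (nth_row_seq _ (Ordinal ilt)) mxE.
Qed.

Lemma mx_seq_le m n (M : 'M[R]_(m, n)) r :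
  (forall i j, `|M i j| <= r) -> forall y, y \in mx_seq M -> `|y| <= r.
Proof.
move=> Mr y /mapP[k _ ->]; case/mxvec_indexP: k => i j; by rewrite mxvecE.
Qed.

Lemma continuous_polyfun n (g : seq R -> R) : polyfun g ->
  continuous (fun z : 'rV[R]_n => g (row_seq z)).
Proof.
move=> [t rt gt]; have [f fE] := @rterm_mpoly _ n _ rt.
have -> : (fun z : 'rV[R]_n => g (row_seq z)) = peval f.
  by apply/funext => z; rewrite gt fE.
exact: continuous_peval.
Qed.

(** The zero set of h in the box of radius r is compact, so g attains a minimum there, positive by
    assumption. If the set is empty, c = 1 is taken. *)
Lemma polyfun_lower_bound n (g : seq R -> R) (h : seq R -> R) r :
  polyfun g -> polyfun h ->
  (forall e, size e = n -> h e = 0 -> 0 < g e) ->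
  exists2 c, 0 < c & forall e, size e = n -> (forall y, y \in e -> `|y| <= r) ->
    h e = 0 -> c <= g e.
Proof.
move=> pg ph gpos.
pose S := [set z : 'rV[R]_n | (forall i, `[- r, r]%classic (z ord0 i))] `&`
  [set z | h (row_seq z) = 0].
have [S0|nS] := pselect (S !=set0); last first.
  exists 1 => // e se er he; exfalso; apply: nS; exists (\row_i e`_i).
  split => /=; last by rewrite row_seqK.
  by move=> i; rewrite mxE /= in_itv /= -ler_norml er// mem_nth// se.
have cS : compact S.
  apply: compact_closedI.
    by apply: (@rV_compact _ _ (fun=> `[- r, r]%classic)) => i; exact: segment_compact.
  apply: (@closed_comp _ _ (fun z : 'rV[R]_n => h (row_seq z)) [set 0]).
    by move=> z _; exact: (continuous_polyfun ph).
  exact: closed_eq.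
have [c cS' cmin] := EVT_min_rV S0 cS
  (continuous_subspaceT (continuous_polyfun pg) : {within S, continuous _}).
move: (cS'); rewrite inE => -[_ hc].
exists (g (row_seq c)); first by apply: gpos => //; rewrite size_row_seq.
move=> e se er he; rewrite -(row_seqK se); apply: cmin; rewrite inE; split => /=.
  by move=> i; rewrite mxE /= in_itv /= -ler_norml er// mem_nth// se.
by rewrite row_seqK.
Qed.

End PolynomialMatrices.

(** * Derivations applied entrywise to matrices *)

Section DerivationMatrix.
Variables (R : realType) (D : R -> R).
Hypothesis dD : derivation D.

Lemma derivationD x y : D (x + y) = D x + D y.
Proof. by case: dD => ->. Qed.

Lemma derivationM x y : D (x * y) = D x * y + x * D y.
Proof. by case: dD => _ ->. Qed.

Lemma derivation0 : D 0 = 0.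
Proof. by apply: (addrI (D 0)); rewrite -derivationD !addr0. Qed.

Lemma derivation_sum (I : Type) (r : seq I) (Q : pred I) (F : I -> R) :
  D (\sum_(i <- r | Q i) F i) = \sum_(i <- r | Q i) D (F i).
Proof. exact: (big_morph D derivationD derivation0). Qed.

Lemma derivation_mulmx m n p (M : 'M[R]_(m, n)) (N : 'M[R]_(n, p)) :
  map_mx D (M *m N) = map_mx D M *m N + M *m map_mx D N.
Proof.
apply/matrixP => i j; rewrite !mxE derivation_sum -big_split; apply: eq_bigr => k _.
by rewrite !mxE derivationM.
Qed.

Lemma derivation_trace n (M : 'M[R]_n) : D (\tr M) = \tr (map_mx D M).
Proof. by rewrite /mxtrace derivation_sum; apply: eq_bigr => i _; rewrite mxE. Qed.

Lemma derivation_mx_eq0 m n (M : 'M[R]_(m, n)) :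
  (forall i j, D (M i j) = 0) -> map_mx D M = 0.
Proof. by move=> h; apply/matrixP => i j; rewrite !mxE. Qed.

(* With Y a generalised inverse of b, b = b Y b gives
   D b = D b Y b + b (D Y) b + b Y (D b), and B b = b B = 0. *)
Lemma trace_derivation_eq0 n (B b : 'M[R]_n) : B^T = - B -> b^T = - b -> B *m b = 0 ->
  \tr (B^T *m map_mx D b) = 0.
Proof.
move=> BT bT Bb0.
have bB0 : b *m B = 0.
  by apply: trmx_inj; rewrite trmx_mul BT bT mulNmx mulmxN opprK Bb0 trmx0.
have [Y bYb] : exists Y, b *m Y *m b = b by exists (pinvmx b); rewrite mulmxKpV.
rewrite BT mulNmx linearN /=; apply/eqP; rewrite oppr_eq0; apply/eqP.
have -> : map_mx D b = map_mx D b *m Y *m b +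
    b *m (map_mx D (Y) *m b + Y *m map_mx D b).
  by rewrite -{1}bYb !derivation_mulmx mulmxDl mulmxDr !mulmxA addrA.
rewrite (mulmxDr B) mxtraceD (mulmxA B b) Bb0 mul0mx mxtrace0 addr0.
by rewrite mxtrace_mulC -(mulmxA _ b B) bB0 mulmx0 mxtrace0.
Qed.

End DerivationMatrix.

(** * The generic condition on W, and the lower bound for B b *)

Section Planes.
Variables (R : realType) (d : nat).

Definition add_tr (B : 'M[R]_d) : 'M[R]_d := B + B^T.

Lemma add_tr_linear : linear add_tr.
Proof. by move=> a B C; rewrite /add_tr linearP /= scalerDr addrACA. Qed.

HB.instance Definition _ :=
  GRing.isLinear.Build R 'M[R]_d 'M[R]_d _ add_tr add_tr_linear.

Lemma mem_so (B : 'M[R]_d) : (B \in so R d) = (B^T == - B).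
Proof. by rewrite /so memv_ker (lfunE add_tr) /= /add_tr addrC addr_eq0. Qed.

(** No nonzero antisymmetric b that is orthogonal to W is killed by a nonzero B in W. This makes b
    controllable by its pairing with W together with B b. *)
Definition good_plane (W : {vspace 'M[R]_d}) : Prop :=
  forall B b : 'M[R]_d, B \in W -> B != 0 -> b^T = - b -> b != 0 -> B *m b = 0 ->
    exists2 M, M \in W & \tr (M^T *m b) != 0.

Lemma trace_tr_sqn (b : 'M[R]_d) : \tr (b^T *m b) = sqn b.
Proof.
rewrite /mxtrace /sqn exchange_big; apply: eq_bigr => i _; rewrite mxE.
by apply: eq_bigr => j _; rewrite mxE expr2.
Qed.

Lemma trace_span_eq0 n (X : n.-tuple 'M[R]_d) (b M : 'M[R]_d) :
  (forall i, \tr ((tnth X i)^T *m b) = 0) -> M \in <<X>>%VS -> \tr (M^T *m b) = 0.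
Proof.
move=> h /coord_span ->; rewrite linear_sum /= mulmx_suml linear_sum big1// => i _.
by rewrite linearZ /= -scalemxAl linearZ /= -tnth_nth h mulr0.
Qed.

(** In a chart the bad set is a projection of an algebraic condition, hence semialgebraic. If it had
    an interior point, it would contain an x generic over the entries of F and K. A derivation
    chosen for the corresponding w and b then turns tr(B^T D b) = 0 into a vanishing sum of squares,
    which makes b orthogonal to the whole of [so]. *)
Lemma gr_negligible_not_good_plane l :
  @gr_negligible_semialgebraic R _ (so R d) l [set W | ~ good_plane W].
Proof.
move=> m F K bFK.
have soE X : X \in F ++ K -> X^T = - X.
  move=> XFK; apply/eqP; rewrite -mem_so -(eqP (andP bFK).1); exact: memv_span.
pose M (x : 'rV[R]_(l * m)) i := tnth F i + \sum_j vec_mx x i j *: tnth K j.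
pose bad (x : 'rV[R]_(l * m)) (w : 'rV[R]_l) (b : 'M[R]_d) :=
  let B := \sum_i w ord0 i *: M x i in
  [/\ B <> 0, b^T = - b, b <> 0, B *m b = 0 & forall i, \tr ((M x i)^T *m b) = 0].
have badP x : [set W | ~ good_plane W] (gr_chart F K x) <-> exists w b, bad x w b.
  have -> : gr_chart F K x = <<[tuple M x i | i < l]>>%VS by [].
  split=> [|[w [b [B0 bT b0 Bb Mb]]] good]; last first.
    have BW : \sum_i w ord0 i *: M x i \in <<[tuple M x i | i < l]>>%VS.
      apply: memv_suml => i _; apply: memvZ; apply: memv_span.
      by apply/tnthP; exists i; rewrite tnth_mktuple.
    have [N NW] := good _ b BW (introN eqP B0) bT (introN eqP b0) Bb.
    move=> /eqP; apply; apply: trace_span_eq0 NW => i.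
    by rewrite tnth_mktuple.
  move=> /existsNP[B] /existsNP[b] /not_implyP[BW] /not_implyP[B0] /not_implyP[bT].
  move=> /not_implyP[b0] /not_implyP[Bb none].
  exists (\row_i coord [tuple M x i | i < l] i B), b.
  have BE : \sum_i (\row_i coord [tuple M x i | i < l] i B) ord0 i *: M x i = B.
    rewrite [RHS](coord_span BW); apply: eq_bigr => i _.
    by rewrite mxE -tnth_nth tnth_mktuple.
  split; rewrite ?BE//; [exact/eqP | exact/eqP |] => i.
  apply: contrapT => /eqP Mi; apply: none; exists (M x i) => //.
  by apply: memv_span; apply/tnthP; exists i; rewrite tnth_mktuple.
split.
  (* The list holds the chart coordinates, then w, then b; the last two blocks get quantified. *)
  pose Me (e : seq R) i := tnth F i + \sum_j mx_at 0 l m e i j *: tnth K j.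
  pose we (e : seq R) := mx_at (l * m) 1 l e.
  pose be (e : seq R) := mx_at (l * m + 1 * l) d d e.
  pose Be e := \sum_i we e ord0 i *: Me e i.
  pose P e := [/\ sqn (Be e) <> 0, (be e)^T = - be e, sqn (be e) <> 0,
    Be e *m be e = 0 & forall i, \tr ((Me e i)^T *m be e) = 0].
  have pM i : polymx (fun e => Me e i).
    apply: polymxD; first exact: polymx_const.
    apply: polymx_sum => j; apply: polymxZ; first exact: polymx_at.
    exact: polymx_const.
  have pB : polymx Be.
    by apply: polymx_sum => i; apply: polymxZ; [exact: polymx_at | exact: pM].
  have pb : polymx be by exact: polymx_at.
  have dP : definable P.
    apply: (@definable_ext _ (fun e => ~ (sqn (Be e) = 0) /\ ((be e)^T = 0 - be e) /\
      ~ (sqn (be e) = 0) /\ Be e *m be e = 0 /\ forall i, \tr ((Me e i)^T *m be e) = 0)).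
      by move=> e; rewrite sub0r; split=> [[? [? [? [? ?]]]]|[]].
    apply: definable_and.
      by apply: definable_not; apply: definable_eq;
        [exact: polyfun_sqn | exact: polyfun_const].
    apply: definable_and.
      apply: definable_mx_eq; first exact: polymx_tr.
      by apply: polymxB => //; exact: polymx_const.
    apply: definable_and.
      by apply: definable_not; apply: definable_eq;
        [exact: polyfun_sqn | exact: polyfun_const].
    apply: definable_and.
      by apply: definable_mx_eq; [exact: polymxM | exact: polymx_const].
    apply: definable_forall_fin => i; apply: definable_eq; last exact: polyfun_const.
    by apply: polyfun_trace; apply: polymxM => //; exact: polymx_tr.
  have [Q dQ QP] := definable_exists_block (l * m) (1 * l + d * d) dP.
  apply: semialgebraic_ext (definable_semialgebraic (l * m) dQ) => x /=.
  have Mx e' i : Me (row_seq x ++ e') i = M x i.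
    rewrite /Me /M; congr (_ + _); apply: eq_bigr => j _; congr (_ *: _).
    have := @mx_at_seq R l m [::] e' (vec_mx x) 0 erefl.
    by rewrite /= /mx_seq vec_mxK => ->.
  rewrite -QP ?size_row_seq//; apply: iff_trans (iff_sym (badP x)); split.
    move=> [ys sys]; set e := _ ++ ys => -[/eqP h1 h2 /eqP h3 h4 h5].
    exists (we e), (be e).
    have BE : \sum_i we e ord0 i *: M x i = Be e.
      by apply: eq_bigr => i _; rewrite -(Mx ys).
    split; rewrite ?BE//.
    - by apply/eqP; rewrite -sqn_eq0.
    - by apply/eqP; rewrite -sqn_eq0.
    - by move=> i; rewrite -(Mx ys).
  move=> [w [b [h1 h2 h3 h4 h5]]].
  exists (mx_seq w ++ mx_seq b); first by rewrite size_cat !size_mx_seq.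
  set e := _ ++ (_ ++ _).
  have wE : we e = w by apply: mx_at_seq; rewrite size_row_seq.
  have bE : be e = b.
    have := @mx_at_seq R d d (row_seq x ++ mx_seq w) [::] b _ _.
    rewrite cats0 -catA; apply.
    by rewrite size_cat size_mx_seq size_row_seq.
  have BE : Be e = \sum_i w ord0 i *: M x i.
    by rewrite /Be wE; apply: eq_bigr => i _; rewrite Mx.
  split; rewrite ?BE ?bE//.
  - by move/eqP; rewrite sqn_eq0 => /eqP.
  - by move/eqP; rewrite sqn_eq0 => /eqP.
  - by move=> i; rewrite Mx.
apply: positive_codim_empty_interior; apply/seteqP; split => // x0 hx0.
set Z := gr_chart F K @^-1` _ in hx0 *.
have [k [sk ck kFK]] := countable_subring
  (flatten [seq flatten [seq [seq X i j | j <- enum 'I_d] | i <- enum 'I_d] | X : 'M[R]_d <- F ++ K]).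
have kX X i j : X \in F ++ K -> k (X i j).
  move=> XFK; apply: kFK; apply/flattenP.
  exists (flatten [seq [seq X i j | j <- enum 'I_d] | i <- enum 'I_d]); first exact: map_f.
  apply/flattenP; exists [seq X i j | j <- enum 'I_d]; first by apply: map_f; rewrite mem_enum.
  by apply/mapP; exists j => //; rewrite mem_enum.
have [||x Zx gx] := @generic_dense _ k (l * m) (interior Z) sk ck.
- exact: open_interior.
- by exists x0.
have /badP[w [b [B0 bT b0 Bb Mb]]] := interior_subset Zx.
set B := \sum_i _ in B0 Bb.
have BT : B^T = - B.
  rewrite /B linear_sum -sumrN; apply: eq_bigr => i _; rewrite linearZ /= -scalerN.
  congr (_ *: _); rewrite /M linearD linear_sum opprD -sumrN /=.
  rewrite soE ?mem_cat ?mem_tnth//; congr (_ + _); apply: eq_bigr => j _.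
  by rewrite linearZ /= soE ?mem_cat ?mem_tnth ?orbT// scalerN.
have [i wi] : exists i, w ord0 i != 0.
  apply: contrapT => /forallNP w0; apply: B0; rewrite /B big1// => i _.
  by have /negP := w0 i; rewrite negbK => /eqP ->; rewrite scale0r.
pose t j := \tr ((tnth K j)^T *m b).
(* Differentiating tr(M_i^T b) = 0 gives tr(M_i^T D b) = - tr((D M_i)^T b). With D x_ij = w_i t_j,
   summing against w_i yields minus the sum of the squares of the w_i t_j. *)
have [D [dD Dk Dx]] := derivation_generic (mxvec (\matrix_(i, j) (w ord0 i * t j))) sk gx.
have DFK X : X \in F ++ K -> map_mx D X = 0.
  by move=> XFK; apply: derivation_mx_eq0 => u v; apply: Dk; exact: kX.
have DM i' : map_mx D (M x i') = \sum_j (w ord0 i' * t j) *: tnth K j.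
  apply/matrixP => u v; rewrite !mxE derivationD// !summxE derivation_sum//.
  have /matrixP/(_ u v) : map_mx D (tnth F i') = 0 by rewrite DFK// mem_cat mem_tnth.
  rewrite !mxE => ->; rewrite add0r; apply: eq_bigr => j _.
  have /matrixP/(_ u v) : map_mx D (tnth K j) = 0 by rewrite DFK// mem_cat mem_tnth orbT.
  rewrite !mxE => DK; rewrite derivationM// DK mulr0 addr0 Dx.
  by rewrite mxvecE mxE.
have sum0 : \sum_i' \sum_j (w ord0 i' * t j) ^+ 2 = 0.
  have := trace_derivation_eq0 dD BT (etrans bT erefl) Bb.
  have DMb i' : \tr ((M x i')^T *m map_mx D b) = - \tr ((map_mx D (M x i'))^T *m b).
    apply/eqP; rewrite -addr_eq0 addrC map_trmx -mxtraceD -derivation_mulmx//.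
    by rewrite -derivation_trace// Mb derivation0.
  rewrite /B linear_sum mulmx_suml linear_sum /= => tr0.
  apply: oppr_inj; rewrite oppr0 -[RHS]tr0 -sumrN; apply: eq_bigr => i' _.
  rewrite linearZ /= -scalemxAl linearZ /= DMb DM mulrN; congr (- _).
  rewrite linear_sum mulmx_suml linear_sum mulr_sumr; apply: eq_bigr => j _.
  by rewrite linearZ /= -scalemxAl linearZ /= -/(t j) expr2; ring.
have Kb j : t j = 0.
  have /eqP := sum0; rewrite psumr_eq0 => [/allP/(_ i)|i' _]; last first.
    by apply: sumr_ge0 => j' _; exact: sqr_ge0.
  rewrite mem_index_enum psumr_eq0 => [/(_ isT)/allP/(_ j)|j' _]; last exact: sqr_ge0.
  rewrite mem_index_enum sqrf_eq0 mulf_eq0 (negbTE wi) => /(_ isT)/eqP //.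
have Fb i' : \tr ((tnth F i')^T *m b) = 0.
  have := Mb i'; rewrite /M linearD linear_sum mulmxDl mulmx_suml mxtraceD linear_sum.
  rewrite /= big1 ?addr0// => j _.
  by rewrite linearZ /= -scalemxAl linearZ /= -/(t j) Kb mulr0.
(* Now b is orthogonal to the basis [F ++ K] of a space containing b, so it is orthogonal to
   itself. *)
apply: b0; apply/eqP; rewrite -sqn_eq0 -trace_tr_sqn; apply/eqP.
apply: (@trace_span_eq0 _ [tuple of F ++ K]); last first.
  by rewrite /= (eqP (andP bFK).1) mem_so bT.
move=> i'; have : tnth [tuple of F ++ K] i' \in F ++ K by exact: mem_tnth.
by rewrite mem_cat => /orP[]/tnthP[j ->]; [exact: Fb | exact: Kb].
Qed.

Definition lincomb l (A : l.-tuple 'M[R]_d) (w : 'rV[R]_l) : 'M[R]_d :=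
  \sum_k w ord0 k *: tnth A k.

(** For the antisymmetric matrix built from the modes of a critical point, this is the end point p
    (see [modes_pairing]). *)
Definition pairing l (A : l.-tuple 'M[R]_d) (b : 'M[R]_d) : 'rV[R]_l :=
  \row_k \tr ((tnth A k)^T *m b).

Lemma lincombT l (A : l.-tuple 'M[R]_d) w :
  (forall k, (tnth A k)^T = - tnth A k) -> (lincomb A w)^T = - lincomb A w.
Proof.
move=> AT; rewrite /lincomb linear_sum -sumrN; apply: eq_bigr => k _.
by rewrite linearZ /= AT scalerN.
Qed.

Lemma lincombZ l (A : l.-tuple 'M[R]_d) c w : lincomb A (c *: w) = c *: lincomb A w.
Proof.
by rewrite /lincomb scaler_sumr; apply: eq_bigr => k _; rewrite mxE scalerA.
Qed.

Lemma pairingZ l (A : l.-tuple 'M[R]_d) c b : pairing A (c *: b) = c *: pairing A b.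
Proof. by apply/rowP => k; rewrite !mxE -scalemxAr linearZ. Qed.

Lemma mx_at_pair l (w : 'rV[R]_l) (b : 'M[R]_d) :
  mx_at 0 1 l (mx_seq w ++ mx_seq b) = w /\
  mx_at (1 * l) d d (mx_seq w ++ mx_seq b) = b.
Proof.
split; first exact: (@mx_at_seq R 1 l [::] (mx_seq b) w 0).
have := @mx_at_seq R d d (mx_seq w) [::] b _ (size_mx_seq w).
by rewrite cats0.
Qed.

Lemma lincomb_eq0 l (A : l.-tuple 'M[R]_d) w : free A -> lincomb A w = 0 -> w = 0.
Proof.
move=> /freeP fA A0; apply/rowP => k; rewrite mxE; apply: (fA (fun k => w ord0 k)).
by rewrite -[RHS]A0; apply: eq_bigr => i _; rewrite -tnth_nth.
Qed.

(** If D kills K, then tr(B^T D b) is the sum of the w_k D p_k. Taking D p to be the i-th unit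
    vector, it equals w_i, while B b = 0 would make it vanish for every i. *)
Lemma generic_pairing_neq K l (A : l.-tuple 'M[R]_d) p w b :
  subring_set K -> (forall k i j, K (tnth A k i j)) -> generic K p ->
  (forall k, (tnth A k)^T = - tnth A k) -> b^T = - b ->
  w != 0 -> pairing A b = p -> lincomb A w *m b <> 0.
Proof.
move=> sK KA gp AT bT w0 Pb Bb; move/eqP: w0; apply; apply/rowP => i; rewrite mxE.
have [D [dD DK Dp]] := derivation_generic (delta_mx ord0 i) sK gp.
have := trace_derivation_eq0 dD (lincombT w AT) bT Bb.
rewrite /lincomb linear_sum mulmx_suml linear_sum (bigD1 i)//= big1 => [|k ki].
  rewrite addr0 linearZ /= -scalemxAl linearZ /=.
  have := Dp i; rewrite -Pb mxE derivation_trace// derivation_mulmx//.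
  rewrite -map_trmx (derivation_mx_eq0 (M := tnth A i)) ?trmx0 ?mul0mx ?add0r.
    by move=> ->; rewrite mxE !eqxx mulr1.
  by move=> u v; apply: DK.
rewrite linearZ /= -scalemxAl linearZ /=.
have := Dp k; rewrite -Pb mxE derivation_trace// derivation_mulmx//.
rewrite -map_trmx (derivation_mx_eq0 (M := tnth A k)) ?trmx0 ?mul0mx ?add0r.
  by move=> ->; rewrite mxE (negbTE ki) andbF mulr0.
by move=> u v; apply: DK.
Qed.

(** Both sides are quadratic in b, so b can be taken of norm 1. Then (w, b) ranges over a compact
    set on which [good_plane] keeps the right-hand side from vanishing. *)
Lemma pairing_lower_bound l (A : l.-tuple 'M[R]_d) (W : {vspace 'M[R]_d}) :
  basis_of W A -> good_plane W ->
  exists2 c : R, 0 < c & forall w b, sqn w = 1 -> b^T = - b ->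
    c * sqn b <= sqn (pairing A b) + sqn (lincomb A w *m b).
Proof.
move=> bA gW.
pose we (e : seq R) := mx_at 0 1 l e.
pose be (e : seq R) := mx_at (1 * l) d d e.
pose g e := sqn (pairing A (be e)) + sqn (lincomb A (we e) *m be e).
(* A sum of squares gathers the three constraints into one polynomial equation. *)
pose h e := (sqn (we e) - 1) ^+ 2 + (sqn (be e) - 1) ^+ 2 + sqn ((be e)^T + be e).
have pw : polymx we by exact: polymx_at.
have pb : polymx be by exact: polymx_at.
have pg : polyfun g.
  apply: polyfunD; apply: polyfun_sqn.
    move=> i j; apply: (@polyfun_ext _ (fun e => \tr ((tnth A j)^T *m be e))).
      by move=> e; rewrite mxE.
    by apply: polyfun_trace; apply: polymxM => //; exact: polymx_const.
  apply: polymxM => //; apply: polymx_sum => k; apply: polymxZ; first exact: pw.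
  exact: polymx_const.
have ph : polyfun h.
  apply: polyfunD; last by apply: polyfun_sqn; apply: polymxD => //; exact: polymx_tr.
  have p1 m n (M : seq R -> 'M[R]_(m, n)) : polymx M -> polyfun (fun e => (sqn (M e) - 1) ^+ 2).
    move=> pM; have q : polyfun (fun e => sqn (M e) - 1).
      by apply: polyfunB; [exact: polyfun_sqn | exact: polyfun_const].
    by apply: polyfun_ext (polyfunM q q) => e; rewrite expr2.
  by apply: polyfunD; exact: p1.
have hP e : h e = 0 <-> [/\ sqn (we e) = 1, sqn (be e) = 1 & (be e)^T = - be e].
  split=> [/eqP|[w1 b1 bT]]; last first.
    rewrite /h w1 b1 bT addNr !subrr expr0n /= !add0r; apply/eqP.
    by rewrite sqn_eq0.
  rewrite /h paddr_eq0 ?addr_ge0 ?sqr_ge0 ?sqn_ge0// paddr_eq0 ?sqr_ge0//.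
  rewrite !sqrf_eq0 !subr_eq0 sqn_eq0 addr_eq0.
  by move=> /andP[/andP[/eqP -> /eqP ->] /eqP ->].
have [|c c0 cP] := @polyfun_lower_bound _ (1 * l + d * d) g h 1 pg ph.
  move=> e _ /hP[w1 b1 bT]; rewrite lt0r addr_ge0 ?sqn_ge0// andbT.
  apply/eqP => /eqP; rewrite paddr_eq0 ?sqn_ge0// !sqn_eq0 => /andP[/eqP P0 /eqP Bb].
  have [|||M MW /eqP] := gW (lincomb A (we e)) (be e) _ _ bT _ Bb.
  - rewrite -(span_basis bA); apply: memv_suml => k _; apply: memvZ.
    by apply: memv_span; exact: mem_tnth.
  - apply/eqP => /(lincomb_eq0 (basis_free bA)) w0.
    by move/eqP: w1; rewrite w0 sqn0 eq_sym oner_eq0.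
  - by rewrite -sqn_eq0 b1 oner_eq0.
  apply; apply: (@trace_span_eq0 _ A); last by rewrite (span_basis bA).
  by move=> k; have /rowP/(_ k) := P0; rewrite !mxE.
exists c => // w b w1 bT.
have [->|b0] := eqVneq b 0.
  by rewrite sqn0 mulr0 addr_ge0 ?sqn_ge0.
have sb0 : 0 < sqn b by rewrite sqn_gt0.
pose r := (Num.sqrt (sqn b))^-1.
have r2 : r ^+ 2 = (sqn b)^-1 by rewrite /r exprVn sqr_sqrtr// ltW.
have rb1 : sqn (r *: b) = 1 by rewrite sqnZ r2 mulVf// gt_eqF.
have [wE bE] := mx_at_pair w (r *: b).
have := cP (mx_seq w ++ mx_seq (r *: b)).
have -> : g (mx_seq w ++ mx_seq (r *: b)) =
    (sqn b)^-1 * (sqn (pairing A b) + sqn (lincomb A w *m b)).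
  rewrite /g /we /be wE bE pairingZ -scalemxAr !sqnZ r2; ring.
rewrite ler_pdivlMl// mulrC; apply.
- by rewrite size_cat !size_mx_seq.
- have le1 m n (M : 'M[R]_(m, n)) : sqn M = 1 -> forall y, y \in mx_seq M -> `|y| <= 1.
    move=> M1; apply: mx_seq_le => i j.
    by rewrite -(@ler_sqr _ _ 1) ?nnegrE// real_normK ?num_real// expr1n -M1 sqn_entry.
  by move=> y; rewrite mem_cat => /orP[]; exact: le1.
- apply/hP; rewrite /we /be wE bE; split => //.
  by rewrite linearZ /= bT scalerN.
Qed.

(** After scaling w to norm 1, large b are handled by [pairing_lower_bound]; the remaining b form a
    compact set, where [generic_pairing_neq] excludes B b = 0. *)
Lemma lincomb_mul_lower_bound K l (A : l.-tuple 'M[R]_d) (W : {vspace 'M[R]_d}) p :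
  basis_of W A -> good_plane W -> (forall k, (tnth A k)^T = - tnth A k) ->
  subring_set K -> (forall k i j, K (tnth A k i j)) -> generic K p ->
  exists2 c : R, 0 < c & forall w b, b^T = - b -> pairing A b = p ->
    c * sqn w <= sqn (lincomb A w *m b).
Proof.
move=> bA gW AT sK KA gp.
have [c1 c10 c1P] := pairing_lower_bound bA gW.
(* Beyond this size of b, [pairing_lower_bound] leaves at least 1 for [sqn] of B b; this is the 1 in
   the final minimum. *)
pose rho := (sqn p + 1) / c1.
have rho0 : 0 <= rho by rewrite divr_ge0 ?addr_ge0 ?sqn_ge0// ltW.
pose we (e : seq R) := mx_at 0 1 l e.
pose be (e : seq R) := mx_at (1 * l) d d e.
pose g e := sqn (pairing A (be e) - p) + sqn (lincomb A (we e) *m be e).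
pose h e := (sqn (we e) - 1) ^+ 2 + sqn ((be e)^T + be e).
have pw : polymx we by exact: polymx_at.
have pb : polymx be by exact: polymx_at.
have pg : polyfun g.
  apply: polyfunD; apply: polyfun_sqn.
    apply: polymxB; last exact: polymx_const.
    move=> i j; apply: (@polyfun_ext _ (fun e => \tr ((tnth A j)^T *m be e))).
      by move=> e; rewrite mxE.
    by apply: polyfun_trace; apply: polymxM => //; exact: polymx_const.
  apply: polymxM => //; apply: polymx_sum => k; apply: polymxZ; first exact: pw.
  exact: polymx_const.
have ph : polyfun h.
  apply: polyfunD; last by apply: polyfun_sqn; apply: polymxD => //; exact: polymx_tr.
  have q : polyfun (fun e => sqn (we e) - 1).
    by apply: polyfunB; [exact: polyfun_sqn | exact: polyfun_const].
  by apply: polyfun_ext (polyfunM q q) => e; rewrite expr2.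
have hP e : h e = 0 <-> sqn (we e) = 1 /\ (be e)^T = - be e.
  split=> [/eqP|[w1 bT]]; last first.
    rewrite /h w1 bT addNr !subrr expr0n /= add0r; apply/eqP.
    by rewrite sqn_eq0.
  rewrite /h paddr_eq0 ?sqr_ge0 ?sqn_ge0// sqrf_eq0 subr_eq0 sqn_eq0 addr_eq0.
  by move=> /andP[/eqP -> /eqP ->].
(* An entry of a matrix with [sqn] at most s is at most 1 + s; here s is 1 for w and rho for b, and
   2 + rho covers both. *)
have [|c2 c20 c2P] := @polyfun_lower_bound _ (1 * l + d * d) g h (2 + rho) pg ph.
  move=> e _ /hP[w1 bT]; rewrite lt0r addr_ge0 ?sqn_ge0// andbT.
  apply/eqP => /eqP; rewrite paddr_eq0 ?sqn_ge0// !sqn_eq0 subr_eq0.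
  move=> /andP[/eqP P0 /eqP]; apply: (generic_pairing_neq sK KA gp AT bT _ P0).
  by rewrite -sqn_eq0 w1 oner_eq0.
exists (Num.min c2 1) => [|w b bT Pb]; first by rewrite lt_min c20 ltr01.
have [->|w0] := eqVneq w 0.
  by rewrite sqn0 mulr0 sqn_ge0.
have sw0 : 0 < sqn w by rewrite sqn_gt0.
pose r := (Num.sqrt (sqn w))^-1.
have r2 : r ^+ 2 = (sqn w)^-1 by rewrite /r exprVn sqr_sqrtr// ltW.
have rw1 : sqn (r *: w) = 1 by rewrite sqnZ r2 mulVf// gt_eqF.
suff : Num.min c2 1 <= sqn (lincomb A (r *: w) *m b).
  by rewrite lincombZ -scalemxAl sqnZ r2 ler_pdivlMl// mulrC.
have [brho|brho] := leP (sqn b) rho; last first.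
  have := c1P _ b rw1 bT; rewrite Pb => h1.
  rewrite ge_min; apply/orP; right.
  have : sqn p + 1 < c1 * sqn b by move: brho; rewrite /rho ltr_pdivrMr// mulrC.
  by lra.
have [wE bE] := mx_at_pair (r *: w) b.
have := c2P (mx_seq (r *: w) ++ mx_seq b); rewrite /g /we /be wE bE Pb subrr.
rewrite sqn0 add0r ge_min => h1; apply/orP; left; apply: h1.
- by rewrite size_cat !size_mx_seq.
- have le1 m n (M : 'M[R]_(m, n)) s : sqn M <= s -> 0 <= s ->
      forall y, y \in mx_seq M -> `|y| <= 1 + s.
    move=> Ms s0; apply: mx_seq_le => i j.
    rewrite -(@ler_sqr _ _ (1 + s)) ?nnegrE ?addr_ge0//.
    rewrite real_normK ?num_real//.
    by have := sqn_entry M i j; nra.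
  move=> y; rewrite mem_cat => /orP[/(@le1 _ _ _ 1)|/(@le1 _ _ _ rho)].
    by rewrite rw1 => /(_ (lexx _) ler01); lra.
  by move=> /(_ brho rho0); lra.
- by apply/hP; rewrite /we /be wE bE; split.
Qed.

End Planes.

(** * Modes, and the finiteness of the multipliers with given frequencies *)

Section Modes.
Variables (R : realType) (d l : nat) (A : l.-tuple 'M[R]_d).
Hypothesis AT : forall k, (tnth A k)^T = - tnth A k.

(* The columns a_j, b_j of a and b span invariant planes of the matrix
   B := lincomb A w, on which it acts with frequency nu_j. *)
Definition is_modes m (w : 'rV[R]_l) (nu : 'rV[R]_m) (a b : 'M[R]_(d, m))
    (p : 'rV[R]_l) : Prop :=
  [/\ lincomb A w *m a = - (b *m diag_mx nu),
      lincomb A w *m b = a *m diag_mx nu &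
      p = \row_k \tr (a^T *m tnth A k *m b)].

Definition dot (w p : 'rV[R]_l) : R := \sum_k w ord0 k * p ord0 k.

(** Summing the formula for p against w gives tr(a^T B b), and B b = a N with N the diagonal matrix
    of frequencies. So w.p is the sum of the nu_j |a_j|^2. *)
Lemma dot_modes m w (nu : 'rV_m) a b p : is_modes w nu a b p ->
  dot w p = \tr (a^T *m a *m diag_mx nu).
Proof.
move=> [_ Bb ->]; rewrite -mulmxA -Bb /lincomb mulmx_suml mulmx_sumr linear_sum.
apply: eq_bigr => k _; rewrite mxE -scalemxAl -scalemxAr linearZ /=.
by rewrite mulmxA.
Qed.

Lemma modes_sym m w (nu : 'rV_m) a b p : is_modes w nu a b p ->
  a^T *m lincomb A w = diag_mx nu *m b^T.
Proof.
move=> [Ba _ _]; apply: trmx_inj.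
by rewrite !trmx_mul !trmxK tr_diag_mx (lincombT w AT) mulNmx Ba opprK.
Qed.

Lemma dot_modes_b m w (nu : 'rV_m) a b p : is_modes w nu a b p ->
  dot w p = \tr (b^T *m b *m diag_mx nu).
Proof.
move=> M; rewrite (dot_modes M); case: (M) => _ Bb _.
by rewrite -mulmxA -Bb mulmxA (modes_sym M) -mulmxA mxtrace_mulC.
Qed.

(** Since D kills the A_k, the left-hand side is tr(Da^T B b) + tr(a^T B Db), that is tr(Da^T a N) +
    tr(b^T Db N). As D N = 0, these terms are half the derivatives of tr(a^T a N) and tr(b^T b N),
    both equal to w.p. *)
Lemma dot_derivation D m w (nu : 'rV_m) a b p : derivation D ->
  (forall k i j, D (tnth A k i j) = 0) -> (forall j, D (nu ord0 j) = 0) ->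
  is_modes w nu a b p ->
  \sum_k w ord0 k * D (p ord0 k) = D (dot w p).
Proof.
move=> dD DA Dnu M; have [Ba Bb pE] := M.
have DN : map_mx D (diag_mx nu) = 0.
  apply: derivation_mx_eq0 => i j; rewrite !mxE.
  by case: eqP => _; rewrite ?mulr1n ?mulr0n ?derivation0.
set N := diag_mx nu in Ba Bb DN *.
set Da := map_mx D a; set Db := map_mx D b.
have -> : \sum_k w ord0 k * D (p ord0 k) = \tr (Da^T *m a *m N) + \tr (b^T *m Db *m N).
  have -> : \tr (Da^T *m a *m N) = \tr (Da^T *m lincomb A w *m b).
    by rewrite -!mulmxA Bb.
  have -> : \tr (b^T *m Db *m N) = \tr (a^T *m lincomb A w *m Db).
    by rewrite (modes_sym M) mxtrace_mulC mulmxA.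
  rewrite /lincomb !mulmx_sumr !mulmx_suml !linear_sum -big_split; apply: eq_bigr => k _.
  rewrite pE mxE derivation_trace// !(derivation_mulmx dD) (derivation_mx_eq0 (M := tnth A k))//.
  rewrite mulmx0 addr0 -map_trmx -/Da -/Db mxtraceD mulrDr.
  by rewrite -!scalemxAr -!scalemxAl !linearZ.
have h m' (x y : 'M[R]_(m', m)) : \tr (x^T *m y *m N) = \tr (y^T *m x *m N).
  by rewrite -mxtrace_tr !trmx_mul trmxK tr_diag_mx mxtrace_mulC.
(* Each of the two expressions of w.p is used once. *)
have D2 : D (dot w p) + D (dot w p) = (\tr (Da^T *m a *m N) + \tr (b^T *m Db *m N)) *+ 2.
  rewrite {1}(dot_modes M) (dot_modes_b M) !(derivation_trace dD) !(derivation_mulmx dD).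
  rewrite DN !mulmx0 !addr0 !mulmxDl !mxtraceD -!map_trmx -/Da -/Db.
  by rewrite (h _ a Da) (h _ Db b) mulr2n; ring.
have := D2; rewrite -mulr2n => /eqP; rewrite eqrMn2r.
by move=> /eqP ->.
Qed.

Variable K : set R.
Hypotheses (sK : subring_set K) (cK : countable K) (KA : forall k i j, K (tnth A k i j)).

Lemma subring_nat n : K n%:R.
Proof.
have [K1 KB _] := sK; have K0 : K 0 by rewrite -(subrr 1); exact: KB.
elim: n => // n IHn; rewrite -natr1.
by have := KB _ _ IHn (KB _ _ K0 K1); rewrite sub0r opprK.
Qed.

(** The ring K[p]. It is again countable, hence so is the set of reals algebraic over it. *)
Definition extension (p : 'rV[R]_l) : set R :=
  [set peval f p | f in [set f | mpoly_over K f]].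

Lemma subring_extension p : subring_set (extension p).
Proof.
have [K1 KB KM] := sK; have K0 : K 0 by rewrite -(subrr 1); exact: KB.
have KD x y : K x -> K y -> K (x + y).
  by move=> Kx Ky; have := KB _ _ Kx (KB _ _ K0 Ky); rewrite sub0r opprK.
split.
- exists 1; last by rewrite /peval rmorph1.
  by move=> m; rewrite mpoly.mcoeff1; case: eqP.
- move=> _ _ [f Kf <-] [g Kg <-]; exists (f - g); last by rewrite /peval rmorphB.
  by move=> m; rewrite mpoly.mcoeffB; exact: KB.
- move=> _ _ [f Kf <-] [g Kg <-]; exists (f * g); last by rewrite /peval rmorphM.
  by move=> m; rewrite mpoly.mcoeffM; elim/big_ind: _ => // i _; exact: KM.
Qed.

Lemma countable_extension p : countable (extension p).
Proof.
have [K1 _ _] := sK; have [|e Ke] := countable_subrange cK; first by exists 1.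
by apply: card_le_trans (card_image_le _ _) _; exact: (countable_mpoly_over l Ke).
Qed.

Lemma extension_const p x : K x -> extension p x.
Proof.
have [K1 KB _] := sK; have K0 : K 0 by rewrite -(subrr 1); exact: KB.
move=> Kx; exists (mpoly.mpolyC l x); last by rewrite /peval mpoly.mevalC.
by move=> m; rewrite mpoly.mcoeffC; case: eqP => _; rewrite ?mulr1 ?mulr0.
Qed.

Lemma extension_coord p i : extension p (p ord0 i).
Proof.
have [K1 KB _] := sK; have K0 : K 0 by rewrite -(subrr 1); exact: KB.
exists (mpoly.mpolyX R (mpoly.mnm1 i)); last by rewrite /peval mpoly.mevalXU.
by move=> m; rewrite mpoly.mcoeffX; case: eqP.
Qed.

Definition energies m (nu : 'rV[R]_m) (p : 'rV[R]_l) : set R :=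
  [set J | exists w a b, is_modes w nu a b p /\ dot w p = J].

Lemma countable_energies m (nu : 'rV[R]_m) p : (forall j, K (nu ord0 j)) ->
  countable (energies nu p).
Proof.
move=> Knu; apply: sub_countable (countable_algebraic_over (countable_extension p)).
apply: subset_card_le => J [w [a [b [M J_eq]]]]; apply: contrapT => trJ.
have [D [dD DE DJ]] := derivation_transcendental (subring_extension p) trJ.
have := dot_derivation dD _ _ M; rewrite J_eq DJ big1 => [|k _]; last first.
  by rewrite DE ?mulr0//; exact: extension_coord.
move=> /(_ _ _)/eqP; rewrite eq_sym oner_eq0 => h; apply: notF; apply: h => *; apply: DE;
  apply: extension_const; auto.
Qed.

(** The i-th component of phi is the derivation D_i dual to p_i. It depends only on K and p, so one
    phi serves all numbers of modes and all frequencies in K. *)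
Lemma multiplier_of_energy p : generic K p ->
  exists phi : R -> 'rV[R]_l, forall m (nu : 'rV[R]_m) w a b,
    (forall j, K (nu ord0 j)) -> is_modes w nu a b p -> w = phi (dot w p).
Proof.
move=> gp.
have /choice[D DP] : forall i, exists D, [/\ derivation D, forall x, K x -> D x = 0 &
    forall k, D (p ord0 k) = (delta_mx ord0 i : 'rV[R]_l) ord0 k].
  by move=> i; exact: derivation_generic.
exists (fun J => \row_i D i J) => m nu w a b Knu M; apply/rowP => i; rewrite mxE.
have [dD DK Dp] := DP i.
rewrite -(dot_derivation dD _ _ M) => [|*|*]; [|exact: DK|exact: DK].
rewrite (bigD1 i)//= big1 => [|k ki]; first by rewrite Dp mxE !eqxx mulr1 addr0.
by rewrite Dp mxE (negbTE ki) andbF mulr0.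
Qed.

(** A single formula has the frequencies and p as parameters, as the uniform bound on fibres
    requires. *)
Lemma definable_energies m : exists2 P, definable P & forall (nu : 'rV[R]_m) p J,
  energies nu p J <-> P (rcons (mx_seq nu ++ mx_seq p) J).
Proof.
(* The list holds nu, p, then J at position N, then the quantified w, a and b. *)
pose N := (1 * m + 1 * l)%N.
pose nue (e : seq R) := mx_at 0 1 m e.
pose pe (e : seq R) := mx_at (1 * m) 1 l e.
pose we (e : seq R) := mx_at N.+1 1 l e.
pose ae (e : seq R) := mx_at (N.+1 + 1 * l) d m e.
pose be (e : seq R) := mx_at (N.+1 + 1 * l + d * m) d m e.
pose Ne (e : seq R) : 'M[R]_m := \matrix_(i, j) (nue e ord0 i *+ (i == j)).
have NE e : Ne e = diag_mx (nue e) by apply/matrixP => i j; rewrite !mxE.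
pose Q e := [/\ lincomb A (we e) *m ae e = 0 - (be e *m Ne e),
  lincomb A (we e) *m be e = ae e *m Ne e,
  pe e = \row_k \tr ((ae e)^T *m tnth A k *m be e) &
  dot (we e) (pe e) = e`_N].
have pN : polymx Ne.
  move=> i j; apply: (@polyfun_ext _ (fun e => if i == j then nue e ord0 i else 0)).
    by move=> e; rewrite [RHS]mxE; case: eqP => _; rewrite ?mulr1n ?mulr0n.
  by case: eqP => _; [exact: polymx_at | exact: polyfun_const].
have pa : polymx ae by exact: polymx_at.
have pb : polymx be by exact: polymx_at.
have pB : polymx (fun e => lincomb A (we e)).
  apply: polymx_sum => k; apply: polymxZ; first exact: polymx_at.
  exact: polymx_const.
have dQ : definable Q.
  apply: (@definable_ext _ (fun e => lincomb A (we e) *m ae e = 0 - (be e *m Ne e) /\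
    lincomb A (we e) *m be e = ae e *m Ne e /\
    pe e = \row_k \tr ((ae e)^T *m tnth A k *m be e) /\
    dot (we e) (pe e) = e`_N)).
    by move=> e; rewrite /Q; split=> [[? [? [? ?]]]|[]].
  apply: definable_and.
    apply: definable_mx_eq; first exact: polymxM.
    by apply: polymxB; [exact: polymx_const | exact: polymxM].
  apply: definable_and; first by apply: definable_mx_eq; exact: polymxM.
  apply: definable_and.
    apply: definable_mx_eq; first exact: polymx_at.
    move=> i k; apply: (@polyfun_ext _ (fun e => \tr ((ae e)^T *m tnth A k *m be e))).
      by move=> e; rewrite mxE.
    apply: polyfun_trace; apply: polymxM => //; apply: polymxM; first exact: polymx_tr.
    exact: polymx_const.
  apply: definable_eq; last exact: polyfun_nth.
  by apply: polyfun_sum => k; apply: polyfunM; exact: polymx_at.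
have [P dP PQ] := definable_exists_block N.+1 (1 * l + d * m + d * m) dQ.
exists P => // nu p J.
have sN : size (mx_seq nu ++ mx_seq p) = N by rewrite size_cat !size_mx_seq.
rewrite -PQ ?size_rcons ?sN//.
have QE ys : let e := rcons (mx_seq nu ++ mx_seq p) J ++ ys in
    [/\ nue e = nu, pe e = p & e`_N = J].
  move=> e; rewrite /e cat_rcons -catA; split.
  - exact: (@mx_at_seq _ _ _ [::] _ nu 0).
  - by apply: mx_at_seq; exact: size_mx_seq.
  - by rewrite catA nth_cat sN ltnn subnn.
split.
  move=> [w [a [b [[h1 h2 h3] h4]]]].
  exists (mx_seq w ++ mx_seq a ++ mx_seq b).
    by rewrite !size_cat !size_mx_seq addnA.
  set e := _ ++ (_ ++ _); have [e1 e2 e3] := QE (mx_seq w ++ mx_seq a ++ mx_seq b).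
  have wE : we e = w by apply: mx_at_seq; rewrite size_rcons sN.
  have aE : ae e = a.
    rewrite /e catA; apply: mx_at_seq.
    by rewrite size_cat size_mx_seq size_rcons sN.
  have bE : be e = b.
    have := @mx_at_seq R d m
      (rcons (mx_seq nu ++ mx_seq p) J ++ mx_seq w ++ mx_seq a) [::] b _ _.
    rewrite cats0 -2!catA; apply.
    by rewrite !(size_cat, size_rcons, size_mx_seq) addnA.
  by rewrite /Q NE wE aE bE e1 e2 e3 sub0r.
move=> [ys _]; have [e1 e2 e3] := QE ys.
set e := _ ++ ys; rewrite /Q NE sub0r e1 e2 e3 => -[h1 h2 h3 h4].
by exists (we e), (ae e), (be e).
Qed.

(** The fibre over (nu, p) is countable, hence of size at most a k independent of nu, and phi
    recovers w from its energy. *)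
Lemma finite_multipliers m p : generic K p ->
  exists k : nat, forall nu : 'rV[R]_m, (forall j, K (nu ord0 j)) ->
    exists2 s : seq 'rV[R]_l, (size s <= k)%N &
      forall w a b, is_modes w nu a b p -> w \in s.
Proof.
move=> gp; have [phi phiP] := multiplier_of_energy gp.
have [P dP PE] := definable_energies m.
have [k kP] := definable_fibre_bound (1 * m + 1 * l) dP.
exists k => nu Knu.
have [||s sk sE] := kP (mx_seq nu ++ mx_seq p).
- by rewrite size_cat !size_mx_seq.
- apply: sub_countable (countable_energies p Knu); apply: subset_card_le => J /=.
  by move=> h; apply/PE.
exists [seq phi J | J <- s]; first by rewrite size_map.
move=> w a b M; rewrite (phiP _ _ _ _ _ Knu M); apply: map_f.
by apply: sE; apply/PE; exists w, a, b.
Qed.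

End Modes.

(** * The conic version of Caratheodory's theorem *)

Section Caratheodory.
Variable R : realType.

Lemma linear_relation l m (v : 'I_m -> 'rV[R]_l) (S : {pred 'I_m}) : (l < #|S|)%N ->
  exists beta : 'I_m -> R, [/\ \sum_i beta i *: v i = 0,
    forall i, beta i != 0 -> i \in S & exists i, 0 < beta i].
Proof.
move=> lS.
pose V := \matrix_(i < #|S|) v (enum_val i).
have : kermx V != 0.
  rewrite kermx_eq0 /row_free; apply: contraTneq lS => <-.
  by rewrite -leqNgt rank_leq_col.
move=> /rowV0Pn[u /sub_kermxP uV u0].
(* Extends the coefficients by 0 from S to all indices; passing from u to - u at the end provides a
   positive coefficient. *)
pose be (u : 'rV[R]_#|S|) i := \sum_(k < #|S| | enum_val k == i) u ord0 k.
have beS u' i : be u' i != 0 -> i \in S.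
  apply: contraNT => iS; rewrite /be big_pred0// => k.
  by apply: contraNF iS => /eqP <-; exact: enum_valP.
have beE u' k : be u' (enum_val k) = u' ord0 k.
  by rewrite /be (big_pred1 k)// => k'; rewrite (inj_eq enum_val_inj).
have bev u' : u' *m V = 0 -> \sum_i be u' i *: v i = 0.
  move=> uV'; rewrite -[RHS]uV' mulmx_sum_row.
  under eq_bigr do rewrite /be scaler_suml.
  rewrite (exchange_big_dep xpredT)//=; apply: eq_bigr => k _.
  by rewrite (big_pred1 (enum_val k)) ?rowK// => i; rewrite eq_sym.
have [k uk] : exists k, u ord0 k != 0.
  by have /rV0Pn := u0.
have [uk0|uk0] := ltP 0 (u ord0 k).
  by exists (be u); split; [exact: bev | exact: beS | exists (enum_val k); rewrite beE].
exists (be (- u)); split; [|exact: beS|exists (enum_val k); rewrite beE].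
  by apply: bev; rewrite mulNmx uV oppr0.
by rewrite mxE oppr_gt0 lt_neqAle uk uk0.
Qed.

Lemma conic_caratheodory l m (v : 'I_m -> 'rV[R]_l) (c : 'I_m -> R) :
  (forall i, 0 <= c i) ->
  exists c' : 'I_m -> R, [/\ forall i, 0 <= c' i,
    \sum_i c' i *: v i = \sum_i c i *: v i & (#|[pred i | c' i != 0%R]| <= l)%N].
Proof.
move: {2}#|_| (leqnn #|[pred i | c i != 0%R]|) => n.
elim: n c => [|n IHn] c cn c0.
  by exists c; split => //; rewrite (leq_trans cn).
have [cl|cl] := leqP #|[pred i | c i != 0%R]| l; first by exists c.
have [be [bev beS [i1 bi1]]] := linear_relation v cl.
(* Moving along the relation until the first coefficient reaches 0 kills the one at i0 and keeps the
   others nonnegative. *)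
pose i0 := [arg min_(i < i1 | 0 < be i) (c i / be i)]%O.
have [i0_pos i0_min] : 0 < be i0 /\ forall i, 0 < be i -> c i0 / be i0 <= c i / be i.
  by rewrite /i0; case: Order.TotalTheory.arg_minP.
pose t := c i0 / be i0.
have t0 : 0 <= t by rewrite divr_ge0// ltW.
pose c1 i := c i - t * be i.
have c1i0 : c1 i0 = 0 by rewrite /c1 /t divfK ?subrr// gt_eqF.
have c10 i : 0 <= c1 i.
  rewrite subr_ge0; have [bi|bi] := ltP 0 (be i).
    by rewrite -ler_pdivlMr// i0_min.
  by rewrite (le_trans _ (c0 i))// mulr_ge0_le0.
have : [pred i | c1 i != 0%R] \proper [pred i | c i != 0%R].
  apply/fintype.properP; split.
    apply/fintype.subsetP => i; rewrite !inE; apply: contraNN => /eqP ci.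
    rewrite /c1 ci sub0r oppr_eq0 mulf_eq0; apply/orP; right.
    by apply: contraT => /beS; rewrite inE ci eqxx.
  exists i0; last by rewrite inE c1i0 eqxx.
  by apply: beS; rewrite gt_eqF.
move=> /proper_card/leq_trans/(_ cn); rewrite ltnS => /IHn/(_ c10)[c' [c'0 c'v c'l]].
exists c'; split => //; rewrite c'v /c1.
under eq_bigr do rewrite scalerBl -scalerA.
by rewrite sumrB -scaler_sumr bev scaler0 subr0.
Qed.

End Caratheodory.

(** * Reduction to l modes, and bounds on their frequencies *)

Section ModeBounds.
Variables (R : realType) (d l : nat) (A : l.-tuple 'M[R]_d).
Hypothesis AT : forall k, (tnth A k)^T = - tnth A k.

(** Recombining columns by an E that intertwines the frequency matrices preserves the two linear
    equations; p is quadratic in the columns, so its formula remains a hypothesis. *)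
Lemma modes_mulmx m m' w (nu : 'rV[R]_m) (nu' : 'rV[R]_m') a b p (E : 'M[R]_(m, m')) :
  is_modes A w nu a b p -> diag_mx nu *m E = E *m diag_mx nu' ->
  \row_k \tr ((a *m E)^T *m tnth A k *m (b *m E)) = p ->
  is_modes A w nu' (a *m E) (b *m E) p.
Proof.
move=> [Ba Bb _] NE pE; split => //.
  by rewrite mulmxA Ba mulNmx -!mulmxA NE.
by rewrite mulmxA Bb -!mulmxA NE.
Qed.

(** The vector p is the sum of the contributions v_i of the modes, and Caratheodory's theorem
    rewrites it as a conic combination of at most l of them. The predicate Q carries the bounds on
    frequencies through the selection. *)
Lemma reduce_modes m w (nu : 'rV[R]_m) a b p (Q : R -> Prop) :
  is_modes A w nu a b p -> (forall i, Q (nu ord0 i)) -> Q 1 ->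
  exists nu' : 'rV[R]_l, exists a', exists b',
    is_modes A w nu' a' b' p /\ forall j, Q (nu' ord0 j).
Proof.
move=> M Qnu Q1.
pose v i : 'rV[R]_l := \row_k (a^T *m tnth A k *m b) i i.
have [c [c0 cv cl]] := conic_caratheodory v (fun=> ler01).
pose s := enum [pred i | c i != 0%R].
have sl : (size s <= l)%N by rewrite -cardE.
(* Column j selects the j-th surviving mode. The weight is a square root because p is quadratic in
   the modes: E E^T has to be the diagonal matrix of the c_i. *)
pose E : 'M[R]_(m, l) := \matrix_(i, j) (Num.sqrt (c i) *+ ((j < size s)%N && (nth i s j == i))).
(* The columns left over are zero and get the conventional frequency 1, whence the assumption
   [Q 1]. *)
pose nu' : 'rV[R]_l := \row_(j < l)
  (if [pick i | (j < size s)%N && (nth i s j == i)] is Some i then nu ord0 i else 1).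
exists nu', (a *m E), (b *m E); split; last first.
  by move=> j; rewrite mxE; case: pickP => [i _|_].
apply: (modes_mulmx M).
  apply/matrixP => i j; rewrite mul_diag_mx mul_mx_diag !mxE.
  case: (boolP ((j < size s)%N && (nth i s j == i))) => [/andP[js ij]|_]; last first.
    by rewrite mulr0 mul0r.
  rewrite mulr1n mulrC; congr (_ * _); case: pickP => [i' /andP[_ /eqP i'j]|/(_ i)].
    by have := set_nth_default i' i js; rewrite (eqP ij) i'j => ->.
  by rewrite js ij.
case: M => _ _ ->; apply/rowP => k; rewrite !mxE.
have -> : \tr ((a *m E)^T *m tnth A k *m (b *m E)) =
    \tr (a^T *m tnth A k *m b *m (E *m E^T)).
  by rewrite trmx_mul -!mulmxA mxtrace_mulC !mulmxA.
have -> : E *m E^T = diag_mx (\row_i c i).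
  apply/matrixP => i i'; rewrite !mxE.
  have [ii'|ii'] := eqVneq i i'; last first.
    rewrite big1// => j _; rewrite !mxE.
    case: (boolP ((j < size s)%N && (nth i s j == i))) => [/andP[js ij]|_]; last by rewrite mul0r.
    case: (boolP ((j < size s)%N && (nth i' s j == i'))) => [/andP[_ ij']|_]; last by rewrite mulr0.
    have := set_nth_default i' i js; rewrite (eqP ij) (eqP ij') => e.
    by rewrite e eqxx in ii'.
  subst i'; rewrite mulr1n.
  have [ci|ci] := eqVneq (c i) 0.
    by rewrite big1 ?ci// => j _; rewrite !mxE ci sqrtr0 mul0rn mul0r.
  have is_ : i \in s by rewrite mem_enum inE.
  have jl : (index i s < l)%N by rewrite (leq_trans _ sl)// index_mem.
  rewrite (bigD1 (Ordinal jl))//= big1 => [|j jj]; rewrite !mxE /=.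
    by rewrite index_mem is_ nth_index// eqxx mulr1n addr0 -expr2 sqr_sqrtr.
  case: (boolP ((j < size s)%N && (nth i s j == i))) => [/andP[js ij]|_]; last by rewrite mul0r.
  have /eqP := index_uniq i js (enum_uniq _); rewrite (eqP ij) => /eqP e.
  by move: jj; rewrite -val_eqE /= e eqxx.
have /rowP/(_ k) := cv; rewrite !summxE => cvk.
transitivity (\sum_i (c i *: v i) ord0 k); last first.
  rewrite cvk; apply: eq_bigr => i _.
  by rewrite scale1r mxE.
by rewrite /mxtrace; apply: eq_bigr => i _; rewrite mul_mx_diag !mxE mulrC.
Qed.

(** The frequency of a zero column is arbitrary, so it is reset to 1; only the frequencies of
    nonzero columns can be bounded by w. *)
Lemma normalize_modes m w (nu : 'rV[R]_m) a b p (Q : R -> Prop) :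
  is_modes A w nu a b p -> Q 1 ->
  (forall j, (exists i, a i j != 0 \/ b i j != 0) -> Q (nu ord0 j)) ->
  exists2 nu' : 'rV[R]_m, is_modes A w nu' a b p & forall j, Q (nu' ord0 j).
Proof.
move=> [Ba Bb pE] Q1 Qnu.
pose z j := `[< exists i, a i j != 0 \/ b i j != 0 >].
pose nu' : 'rV[R]_m := \row_j if z j then nu ord0 j else 1.
exists nu'; last by move=> j; rewrite mxE; case: (boolP (z j)) => [/asboolP/Qnu|].
have zP (j : 'I_m) : ~~ z j -> forall i, a i j = 0 /\ b i j = 0.
  move=> /asboolPn nz i; split; apply/eqP/negPn/negP => h; apply: nz; exists i;
    [by left | by right].
split => //.
  rewrite Ba; congr (- _); apply/matrixP => i j; rewrite !mul_mx_diag !mxE.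
  by case: (boolP (z j)) => // /zP/(_ i)[_ ->]; rewrite !mul0r.
rewrite Bb; apply/matrixP => i j; rewrite !mul_mx_diag !mxE.
by case: (boolP (z j)) => // /zP/(_ i)[-> _]; rewrite !mul0r.
Qed.

(** This c is the antisymmetric matrix to which the lower bound on B b is applied. B c is minus the
    half sum of two weighted Gram matrices, each of trace w.p. *)
Lemma modes_pairing m w (nu : 'rV[R]_m) a b p : is_modes A w nu a b p ->
  let c := 2^-1 *: (a *m b^T - b *m a^T) in
  [/\ c^T = - c, pairing A c = p &
      lincomb A w *m c = - (2^-1 *: (a *m diag_mx nu *m a^T + b *m diag_mx nu *m b^T))].
Proof.
move=> [Ba Bb pE] c; split.
- by rewrite /c linearZ linearB /= !trmx_mul !trmxK -scalerN opprB.
- rewrite pE; apply/rowP => k; rewrite !mxE /c -scalemxAr linearZ /= AT.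
  rewrite mulNmx linearN /= mulmxBr linearB /=.
  have -> : \tr (tnth A k *m (b *m a^T)) = \tr (a^T *m tnth A k *m b).
    by rewrite mulmxA mxtrace_mulC mulmxA.
  have -> : \tr (tnth A k *m (a *m b^T)) = - \tr (a^T *m tnth A k *m b).
    rewrite -mxtrace_tr !trmx_mul trmxK AT mulmxN linearN /=; congr (- _).
    by rewrite -(mulmxA b) mxtrace_mulC.
  by set X := \tr (a^T *m tnth A k *m b); lra.
rewrite /c -scalemxAr mulmxBr !mulmxA Ba Bb -scalerN; congr (_ *: _).
by rewrite mulNmx opprD addrC.
Qed.

(** The trace of a positive semidefinite matrix bounds its entries, by |x y| <= (x^2 + y^2) / 2. *)
Lemma gram_entry_le m (nu : 'rV[R]_m) (a : 'M[R]_(d, m)) i j :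
  (forall k, 0 <= nu ord0 k) ->
  `|(a *m diag_mx nu *m a^T) i j| <= \tr (a^T *m a *m diag_mx nu).
Proof.
move=> nu0.
have gE i' j' : (a *m diag_mx nu *m a^T) i' j' = \sum_k nu ord0 k * (a i' k * a j' k).
  by rewrite mxE; apply: eq_bigr => k _; rewrite mul_mx_diag !mxE; ring.
have tE : \tr (a^T *m a *m diag_mx nu) = \sum_k \sum_i' nu ord0 k * a i' k ^+ 2.
  rewrite /mxtrace; apply: eq_bigr => k _; rewrite mul_mx_diag !mxE mulr_suml.
  by apply: eq_bigr => i' _; rewrite !mxE; ring.
rewrite gE tE (le_trans (ler_norm_sum _ _ _))//; apply: ler_sum => k _.
rewrite normrM ger0_norm// -mulr_sumr ler_wpM2l//.
have h : `|a i k * a j k| <= (a i k ^+ 2 + a j k ^+ 2) / 2.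
  have := sqr_ge0 (a i k + a j k); have := sqr_ge0 (a i k - a j k).
  by rewrite ler_norml => h1 h2; apply/andP; split; nra.
have le1 i' : a i' k ^+ 2 <= \sum_i' a i' k ^+ 2.
  by rewrite (bigD1 i')//= lerDl sumr_ge0// => ? _; exact: sqr_ge0.
by have := le1 i; have := le1 j; lra.
Qed.

Lemma modes_sqn_le m w (nu : 'rV[R]_m) a b p : is_modes A w nu a b p ->
  (forall k, 0 <= nu ord0 k) ->
  sqn (lincomb A w *m (2^-1 *: (a *m b^T - b *m a^T))) <= (d * d)%:R * dot w p ^+ 2.
Proof.
move=> M nu0; have [_ _ ->] := modes_pairing M.
have -> : (d * d)%:R * dot w p ^+ 2 = \sum_(i < d) \sum_(j < d) dot w p ^+ 2.
  by rewrite !sumr_const !card_ord -mulrnA mulr_natl.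
apply: ler_sum => i _; apply: ler_sum => j _.
set X := _ *m _ *m a^T; set Y := _ *m _ *m b^T.
have hX : `|X i j| <= dot w p by rewrite (dot_modes M); exact: gram_entry_le.
have hY : `|Y i j| <= dot w p by rewrite (dot_modes_b AT M); exact: gram_entry_le.
move: X Y hX hY => X Y hX hY; rewrite !mxE sqrrN -[leLHS]real_normK ?num_real//.
have J0 : 0 <= dot w p by exact: le_trans (normr_ge0 _) hX.
rewrite ler_sqr ?nnegrE// normrM ger0_norm ?invr_ge0//.
by have := ler_normD (X i j) (Y i j); lra.
Qed.

Lemma lincomb_entry_le w i j :
  `|lincomb A w i j| <= Num.sqrt (sqn w) * \sum_k `|tnth A k i j|.
Proof.
rewrite summxE (le_trans (ler_norm_sum _ _ _))// mulr_sumr; apply: ler_sum => k _.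
rewrite mxE normrM ler_wpM2r//.
rewrite -(@ler_sqr _ _ (Num.sqrt _)) ?nnegrE ?sqrtr_ge0// real_normK ?num_real//.
by rewrite sqr_sqrtr ?sqn_ge0// sqn_entry.
Qed.

(** A frequency is the modulus of an eigenvalue of B up to sign, hence bounded above by a norm of B.
    The mode equations are compared at the entry of largest modulus in column j of a and b. *)
Lemma mode_frequency_le : exists2 al : R, 0 <= al &
  forall m w (nu : 'rV[R]_m) a b p j, is_modes A w nu a b p ->
    (exists i, a i j != 0 \/ b i j != 0) -> nu ord0 j <= al * Num.sqrt (sqn w).
Proof.
pose al := \sum_i \sum_i' \sum_k `|tnth A k i i'|.
have al0 : 0 <= al by do 3!apply: sumr_ge0 => ? _.
exists al => // m w nu a b p j [Ba Bb _] [i0 ab0].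
pose mx i := Num.max `|a i j| `|b i j|.
pose i1 := [arg max_(i > i0) mx i]%O.
have mxle i : mx i <= mx i1.
  by rewrite /i1; case: Order.TotalTheory.arg_maxP => // i' _; apply.
have mx0 : 0 < mx i1.
  by rewrite (lt_le_trans _ (mxle i0))// lt_max !normr_gt0; apply/orP.
have nuE i : nu ord0 j * a i j = (lincomb A w *m b) i j /\
    nu ord0 j * b i j = - (lincomb A w *m a) i j.
  by rewrite Ba Bb !mul_mx_diag !mxE opprK ![nu _ _ * _]mulrC.
have Ble (c : 'M[R]_(d, m)) : (forall i, `|c i j| <= mx i1) -> forall i,
    `|(lincomb A w *m c) i j| <= al * Num.sqrt (sqn w) * mx i1.
  move=> cle i; rewrite mxE (le_trans (ler_norm_sum _ _ _))//.
  apply: (@le_trans _ _ (\sum_i' (\sum_k `|tnth A k i i'|) * Num.sqrt (sqn w) * mx i1)).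
    apply: ler_sum => i' _; rewrite normrM ler_pM// mulrC; exact: lincomb_entry_le.
  rewrite -!mulr_suml ler_wpM2r ?(ltW mx0)// ler_wpM2r ?sqrtr_ge0//.
  rewrite /al [leRHS](bigD1 i)//= lerDl.
  by do 3!apply: sumr_ge0 => ? _.
rewrite -(ler_pM2r mx0); case: (leP `|a i1 j| `|b i1 j|) => ab.
  have mxb : mx i1 = `|b i1 j| by rewrite /mx max_r.
  rewrite {1}mxb (le_trans _ (Ble a _ i1))//; last first.
    by move=> i; rewrite (le_trans _ (mxle i))// le_max lexx.
  have <- : `|nu ord0 j * b i1 j| = `|(lincomb A w *m a) i1 j|.
    by rewrite (nuE i1).2 normrN.
  by rewrite normrM ler_wpM2r// ler_norm.
have mxa : mx i1 = `|a i1 j| by rewrite /mx max_l// ltW.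
rewrite {1}mxa (le_trans _ (Ble b _ i1))//; last first.
  by move=> i; rewrite (le_trans _ (mxle i))// le_max lexx orbT.
by rewrite -(nuE i1).1 normrM ler_wpM2r// ler_norm.
Qed.

End ModeBounds.

(** * Integrals and primitives over [0, 2 pi] *)

Section Integrals.
Variable R : realType.
Notation mu := (@lebesgue_measure R).
Notation I := (@I2pi R).

Definition L1 (f : R -> R) : Prop := mu.-integrable I (EFin \o f).
Definition int (f : R -> R) : R := \int[mu]_(t in I) f t.
Definition prim (f : R -> R) (t : R) : R := \int[mu]_(s in `[0, t]) f s.

Lemma twopi_gt0 : 0 < 2 * pi :> R.
Proof. by rewrite mulr_gt0// pi_gt0. Qed.

Lemma I2piE t : I t <-> 0 <= t <= 2 * pi.
Proof. by rewrite /I2pi /= in_itv. Qed.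

Lemma mI : measurable (I : set (measurableTypeR R)).
Proof. exact: measurable_I2pi. Qed.

Lemma mu_I : mu I = (2 * pi)%:E.
Proof. by rewrite lebesgue_measure_itv /= lte_fin twopi_gt0 -EFinD subr0. Qed.

Lemma L1D f g : L1 f -> L1 g -> L1 (fun t => f t + g t).
Proof. by move=> Lf Lg; have := integrableD mI Lf Lg. Qed.

Lemma L1Z a f : L1 f -> L1 (fun t => a * f t).
Proof. by move=> Lf; have := integrableZl mI a Lf. Qed.

Lemma L1N f : L1 f -> L1 (fun t => - f t).
Proof. by move=> Lf; have := L1Z (-1) Lf; under eq_fun do rewrite mulN1r. Qed.

Lemma L1B f g : L1 f -> L1 g -> L1 (fun t => f t - g t).
Proof. by move=> Lf Lg; apply: L1D => //; exact: L1N. Qed.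

Lemma L1_cst c : L1 (fun=> c).
Proof.
apply: measurable_bounded_integrable => //; first exact: mI.
- by rewrite [X in (X < _)%E]mu_I ltry.
- exact: bounded_cst.
Qed.

Lemma L1_sum (J : Type) (r : seq J) (P : pred J) (F : J -> R -> R) :
  (forall j, L1 (F j)) -> L1 (fun t => \sum_(j <- r | P j) F j t).
Proof.
move=> LF; elim: r => [|j r IHr].
  by under eq_fun do rewrite big_nil; exact: L1_cst.
under eq_fun do rewrite big_cons; case: (P j) => //.
exact: L1D.
Qed.

Lemma eq_int f g : (forall t, 0 <= t <= 2 * pi -> f t = g t) -> int f = int g.
Proof. by move=> fg; apply: eq_Rintegral => t; rewrite inE => /I2piE; exact: fg. Qed.

Lemma intD f g : L1 f -> L1 g -> int (fun t => f t + g t) = int f + int g.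
Proof. by move=> Lf Lg; exact: RintegralD mI Lf Lg. Qed.

Lemma intB f g : L1 f -> L1 g -> int (fun t => f t - g t) = int f - int g.
Proof. by move=> Lf Lg; exact: RintegralB mI Lf Lg. Qed.

Lemma intZ a f : L1 f -> int (fun t => a * f t) = a * int f.
Proof. by move=> Lf; exact: RintegralZl mI Lf. Qed.

Lemma int_cst c : int (fun=> c) = c * (2 * pi).
Proof. by rewrite /int (Rintegral_cst mu mI) [X in fine X]mu_I. Qed.

Lemma int_sum (J : Type) (r : seq J) (P : pred J) (F : J -> R -> R) :
  (forall j, L1 (F j)) ->
  int (fun t => \sum_(j <- r | P j) F j t) = \sum_(j <- r | P j) int (F j).
Proof.
move=> LF; elim: r => [|j r IHr].
  rewrite big_nil; under [X in int X]eq_fun do rewrite big_nil.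
  by rewrite int_cst mul0r.
rewrite big_cons -IHr; under [X in int X]eq_fun do rewrite big_cons.
case: (P j) => //; apply: intD => //; exact: L1_sum.
Qed.

Lemma L1_sub f t : L1 f -> 0 <= t <= 2 * pi -> mu.-integrable `[0, t] (EFin \o f).
Proof.
move=> Lf /andP[t0 t2]; apply: integrableS Lf => //; first exact: mI.
by move=> s /=; rewrite in_itv /= => /andP[s0 st]; apply/I2piE; rewrite s0 (le_trans st).
Qed.

Lemma primD f g t : L1 f -> L1 g -> 0 <= t <= 2 * pi ->
  prim (fun s => f s + g s) t = prim f t + prim g t.
Proof. by move=> Lf Lg tI; apply: RintegralD => //; exact: L1_sub. Qed.

Lemma primZ a f t : L1 f -> 0 <= t <= 2 * pi ->
  prim (fun s => a * f s) t = a * prim f t.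
Proof. by move=> Lf tI; apply: RintegralZl => //; exact: L1_sub. Qed.

Lemma prim2pi f : prim f (2 * pi) = int f. Proof. by []. Qed.

Lemma prim_continuous f : L1 f -> {within I, continuous (prim f)}.
Proof. by move=> Lf; apply: parameterized_integral_continuous Lf; exact: ltW twopi_gt0. Qed.

Lemma within_continuous_measurable (f : R -> R) : {within I, continuous f} -> measurable_fun I f.
Proof. by move=> cf; apply: subspace_continuous_measurable_fun => //; exact: mI. Qed.

Lemma within_continuous_bounded (f : R -> R) : {within I, continuous f} -> exists M, forall t,
  0 <= t <= 2 * pi -> `|f t| <= M.
Proof.
move=> cf.
have cI : compact I by exact: segment_compact.
have : [set f x | x in I] = [set f x | x in I] by [].
have /compact_bounded[M [_ hM]] := continuous_compact cf cI.
exists (M + 1) => t tI; apply: (hM (M + 1)); first by rewrite ltrDl.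
by exists t => //; apply/I2piE.
Qed.

Lemma L1_mul_bounded (h g : R -> R) M : measurable_fun I h ->
  (forall t, 0 <= t <= 2 * pi -> `|h t| <= M) ->
  L1 g -> L1 (fun t => h t * g t).
Proof.
move=> mh bh Lg; have : [bounded h t | t in I].
  exists M; split; first exact: num_real.
  by move=> x Mx t /I2piE tI; exact: le_trans (bh _ tI) (ltW Mx).
by move=> hb; have := integrableMr mI mh hb Lg.
Qed.

Lemma L1_continuous_mul (h g : R -> R) : {within I, continuous h} -> L1 g ->
  L1 (fun t => h t * g t).
Proof.
move=> ch Lg; have [M hM] := within_continuous_bounded ch.
by apply: L1_mul_bounded hM Lg; exact: within_continuous_measurable.
Qed.

Lemma L1_continuous (h : R -> R) : {within I, continuous h} -> L1 h.
Proof.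
move=> ch; have := L1_continuous_mul ch (L1_cst 1).
by under eq_fun do rewrite mulr1.
Qed.

End Integrals.

(** * Integrability of controls *)

Section Controls.
Variables (R : realType) (d : nat).
Notation mu := (@lebesgue_measure R).
Notation I := (@I2pi R).
Implicit Types u v : control R d.

Lemma controlD u v i t : (u + v) i t = u i t + v i t.
Proof. by rewrite ffunE. Qed.

Lemma controlZ a u i t : (a *: u) i t = a * u i t.
Proof. by rewrite ffunE. Qed.

(** The space of controls uses a measure on the whole line for which the complement of the interval
    is null, whereas integrals are taken over the interval; this passes from one to the other. *)
Lemma leb2pi_integrable (f : R -> R) : (@leb2pi R).-integrable setT (EFin \o f) <->
  measurable_fun setT f /\ L1 f.
Proof.
have eqI (g : measurableTypeR R -> \bar R) : (\int[@leb2pi R]_(x in I) g x = \int[mu]_(x in I) g x)%E.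
  apply: eq_measure_integral => B mB BI.
  by rewrite /leb2pi /= /mrestr setIidl.
have mC : measurable (~` I : set (measurableTypeR R)) by apply: measurableC; exact: mI.
have C0 : @leb2pi R (~` I) = 0%E by rewrite /leb2pi /= /mrestr setICl measure0.
have eqT (g : measurableTypeR R -> \bar R) : measurable_fun setT g -> (forall x, 0 <= g x)%E ->
    (\int[@leb2pi R]_x g x = \int[mu]_(x in I) g x)%E.
  move=> mg g0; rewrite -eqI (ge0_negligible_integral mC)//.
  by rewrite setDE setCK setTI.
split.
  move=> /integrableP[mf fi]; have mf' := mf; move/measurable_EFinP: mf' => mf'.
  split => //; apply/integrableP; split.
    by apply: measurable_funS mf => //.
  by move: fi; rewrite eqT//; apply: measurableT_comp.
move=> [mf /integrableP[_ fi]]; have mf' : measurable_fun setT (EFin \o f).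
  exact/measurable_EFinP.
apply/integrableP; split => //.
by rewrite eqT//; apply: measurableT_comp.
Qed.

Lemma control_Lfun u i : (u i : R -> R) \in Lfun (@leb2pi R) 2%:E.
Proof. exact: LfunP. Qed.

Lemma control_mulL1 u v i j : L1 (fun t => u i t * v j t).
Proof.
have := Lfun2_mul_Lfun1 (control_Lfun u i) (control_Lfun v j).
by move=> /Lfun1_integrable/leb2pi_integrable[].
Qed.

Lemma bounded_Lfun (f : R -> R) M : measurable_fun setT f -> (forall t, `|f t| <= M) ->
  f \in Lfun (@leb2pi R) 2%:E.
Proof.
move=> mf fM; rewrite inE; apply/andP; split; rewrite inE//=.
rewrite /finite_norm unlock poweR_lty//.
apply: (@le_lt_trans _ _ (\int[@leb2pi R]_x (M ^+ 2)%:E)%E).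
  apply: ge0_le_integral => //.
  - by move=> x _; rewrite lee_fin powR_ge0.
  - apply/measurable_EFinP.
    apply/(@measurableT_comp _ _ _ _ _ _ (fun x : R => x `^ 2)%R) => //.
    exact/measurableT_comp.
  - move=> x _; rewrite lee_fin powR_mulrn// ler_sqr ?nnegrE//.
    exact: le_trans (fM x).
rewrite integral_cst// /leb2pi /= /mrestr setTI.
by rewrite [X in (_ * X)%E]mu_I -EFinM ltry.
Qed.

Lemma control_L1 u i : L1 (u i).
Proof.
have h : (fun=> 1 : R) \in Lfun (@leb2pi R) 2%:E.
  by apply: (@bounded_Lfun _ 1) => // t; rewrite normr1.
have := Lfun2_mul_Lfun1 (control_Lfun u i) h.
move=> /Lfun1_integrable/leb2pi_integrable[_] L.
have -> : (u i : R -> R) = (u i : R -> R) \* (fun=> 1).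
  by apply/funext => t /=; rewrite mulr1.
exact: L.
Qed.

End Controls.

(** * The first-order condition at a critical point *)

Section CriticalEquation.
Variables (R : realType) (d l : nat).
Notation mu := (@lebesgue_measure R).
Notation I := (@I2pi R).
Implicit Types u v w : control R d.

Definition ip u v : R := \sum_i int (fun t => u i t * v i t).

(** The bilinear moment of v against the primitive of u; q is half its contraction with the A_k (see
    [qmapE]). *)
Definition pj u v i j : R := int (fun t => prim (u i) t * v j t).

Lemma pj_L1 u v i j : L1 (fun t => prim (u i) t * v j t).
Proof. exact: L1_continuous_mul (prim_continuous (control_L1 u i)) (control_L1 v j). Qed.

Lemma pjDl u v w a i j : pj (u + a *: v) w i j = pj u w i j + a * pj v w i j.
Proof.
rewrite /pj -intZ -?intD; try exact: pj_L1; last by apply: L1Z; exact: pj_L1.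
apply: eq_int => t tI; rewrite mulrA -mulrDl; congr (_ * _).
rewrite -primZ//; last exact: control_L1.
rewrite -primD//; [|exact: control_L1|by apply: L1Z; exact: control_L1].
by congr prim; apply/funext => s; rewrite controlD controlZ.
Qed.

Lemma pjDr u v w a i j : pj w (u + a *: v) i j = pj w u i j + a * pj w v i j.
Proof.
rewrite /pj -intZ -?intD; try exact: pj_L1; last by apply: L1Z; exact: pj_L1.
by apply: eq_int => t tI; rewrite controlD controlZ; ring.
Qed.

Lemma ipDl u v w a : ip (u + a *: v) w = ip u w + a * ip v w.
Proof.
rewrite /ip mulr_sumr -big_split; apply: eq_bigr => i _ /=.
rewrite -intZ -?intD; try exact: control_mulL1; last by apply: L1Z; exact: control_mulL1.
by apply: eq_int => t tI; rewrite controlD controlZ; ring.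
Qed.

Lemma ipC u v : ip u v = ip v u.
Proof. by apply: eq_bigr => i _; apply: eq_int => t _; rewrite mulrC. Qed.

Lemma ip_ge0 u : 0 <= ip u u.
Proof.
by apply: sumr_ge0 => i _; apply: Rintegral_ge0 => t _; rewrite -expr2 sqr_ge0.
Qed.

Lemma norm2E u : norm2 u = Num.sqrt (ip u u).
Proof.
congr Num.sqrt; rewrite /ip -int_sum; last by move=> i; exact: control_mulL1.
by apply: eq_int => t _; apply: eq_bigr => i _; rewrite expr2.
Qed.

Lemma energyE u : energy u = 2^-1 * ip u u.
Proof. by rewrite /energy norm2E sqr_sqrtr// ip_ge0. Qed.

Lemma norm2Z a u : norm2 (a *: u) = `|a| * norm2 u.
Proof.
have ipZl w : ip (a *: u) w = a * ip u w.
  rewrite /ip mulr_sumr; apply: eq_bigr => i _; rewrite -intZ; last exact: control_mulL1.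
  by apply: eq_int => t _; rewrite controlZ mulrA.
by rewrite !norm2E ipZl ipC ipZl mulrA -expr2 sqrtrM ?sqr_ge0// sqrtr_sqr.
Qed.

Lemma qmapE (A : l.-tuple 'M[R]_d) u : qmap A u =
  \row_k (2^-1 * \sum_i \sum_j tnth A k i j * pj u u i j).
Proof.
apply/rowP => k; rewrite !mxE; congr (_ * _).
transitivity (int (fun t => \sum_i \sum_j tnth A k i j * (prim (u i) t * u j t))).
  apply: eq_int => t _; apply: eq_bigr => i _; rewrite mxE mulr_sumr.
  by apply: eq_bigr => j _; rewrite /prim; ring.
rewrite int_sum => [|i]; last by apply: L1_sum => j; apply: L1Z; exact: pj_L1.
apply: eq_bigr => i _; rewrite int_sum => [|j]; last by apply: L1Z; exact: pj_L1.
by apply: eq_bigr => j _; rewrite intZ//; exact: pj_L1.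
Qed.

Lemma HloopP u : Hloop u <-> forall i, int (u i) = 0.
Proof.
split=> [/rowP h i|h]; first by have := h i; rewrite !mxE.
by apply/rowP => i; rewrite !mxE; exact: h.
Qed.

(** Both q and J are quadratic along lines, so their differentials, of which only the existence is
    known, are read off as linear coefficients. *)
Lemma differential_unique (V : normedModType R) (f : control R d -> V) u df v L Q :
  is_differential f u df -> Hloop v ->
  (forall t : R, f (u + t *: v) = f u + t *: L + t ^+ 2 *: Q) -> df v = L.
Proof.
move=> [dlin _ dlim] Hv fE.
have H0 : Hloop (0 : control R d).
  apply/HloopP => i; rewrite -[RHS](mul0r (2 * pi)) -int_cst.
  by apply: eq_int => t _; rewrite ffunE.
have HZ t : Hloop (t *: v).
  apply/HloopP => i; move/HloopP/(_ i) : Hv => Hv.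
  transitivity (t * int (v i)); last by rewrite Hv mulr0.
  by rewrite -intZ; [apply: eq_int => s _; rewrite controlZ | exact: control_L1].
have df0 : df 0 = 0.
  have := dlin 1 0 0 H0 H0; rewrite scaler0 addr0 scale1r => /eqP.
  by rewrite -subr_eq subrr eq_sym => /eqP.
have dfZ t : df (t *: v) = t *: df v.
  by have := dlin t v 0 Hv H0; rewrite df0 !addr0.
have n0 : 0 <= norm2 v by rewrite norm2E sqrtr_ge0.
apply/eqP; rewrite eq_sym -subr_eq0 -normr_le0; apply/ler_addgt0Pl => e e0.
rewrite addr0.
(* Half of e pays for the error of the differential and, through the choice of t below, half for the
   quadratic term; the added 1's avoid zero denominators. *)
pose e1 := e / (2 * (norm2 v + 1)).
have e10 : 0 < e1 by rewrite divr_gt0// mulr_gt0// ltr_wpDl.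
have [dl dl0 dlP] := dlim e1 e10.
pose t := Num.min (dl / (norm2 v + 1)) (e / (2 * (`|Q| + 1))).
have n1 : 0 < norm2 v + 1 by rewrite ltr_wpDl.
have q1 : 0 < `|Q| + 1 by rewrite ltr_wpDl.
have t0 : 0 < t by rewrite lt_min !divr_gt0// mulr_gt0.
have t1 : t * (norm2 v + 1) <= dl by rewrite -ler_pdivlMr// ge_min lexx.
have t2 : t * (2 * (`|Q| + 1)) <= e by rewrite -ler_pdivlMr ?mulr_gt0// ge_min lexx orbT.
have tn : norm2 (t *: v) = t * norm2 v by rewrite norm2Z gtr0_norm.
have tdl : norm2 (t *: v) < dl.
  by rewrite tn (lt_le_trans _ t1)// ltr_pM2l// ltrDl.
have := dlP _ (HZ t) tdl; rewrite tn dfZ fE.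
have zid (x y z w : V) : x + y + z - x - w = y - w + z.
  by rewrite -(addrA x) (addrC x) addrK addrAC.
have -> : f u + t *: L + t ^+ 2 *: Q - f u - t *: df v = t *: (L - df v + t *: Q).
  by rewrite zid scalerDr scalerBr scalerA -expr2.
rewrite normrZ gtr0_norm// mulrCA ler_pM2l// => h.
have -> : L - df v = (L - df v + t *: Q) - t *: Q by rewrite addrK.
rewrite (le_trans (ler_normB _ _))// normrZ gtr0_norm//.
have e1n : e1 * (norm2 v + 1) = e / 2 by rewrite /e1; field; rewrite gt_eqF.
nra.
Qed.

Variables (A : l.-tuple 'M[R]_d) (p : 'rV[R]_l) (omega : {scalar 'rV[R]_l}).
Definition coords : 'rV[R]_l := \row_k omega (delta_mx ord0 k).

Lemma omegaE x : omega x = \sum_k coords ord0 k * x ord0 k.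
Proof.
rewrite {1}(row_sum_delta x) linear_sum; apply: eq_bigr => k _.
by rewrite linearZ /= mxE mulrC.
Qed.

Lemma critical_equation u v : critical_manifold A p omega u -> Hloop v ->
  2^-1 * (\sum_i \sum_j lincomb A coords i j * (pj u v i j + pj v u i j)) = ip u v.
Proof.
move=> [Hu qu [Dq [DJ [dq dJ DqJ]]]] Hv.
pose L := \row_k (2^-1 * \sum_i \sum_j tnth A k i j * (pj u v i j + pj v u i j)).
have DqE : Dq v = L.
  apply: (differential_unique dq Hv (Q := qmap A v)) => t.
  rewrite !qmapE; apply/rowP => k; rewrite !mxE.
  rewrite [t * _]mulrCA [t ^+ 2 * _]mulrCA -!mulrDr; congr (_ * _).
  rewrite !mulr_sumr -!big_split; apply: eq_bigr => i _ /=.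
  rewrite !mulr_sumr -!big_split; apply: eq_bigr => j _ /=.
  by rewrite pjDl !pjDr; ring.
have DJE : DJ v = ip u v.
  apply: (differential_unique dJ Hv (Q := energy v : R^o)) => t.
  rewrite !energyE ipDl ipC ipDl [ip _ (_ + _)]ipC ipDl [ip v u]ipC.
  by rewrite /GRing.scale /=; field.
rewrite -DJE -DqJ// DqE omegaE.
have LE k : L ord0 k = 2^-1 * \sum_i \sum_j tnth A k i j * (pj u v i j + pj v u i j).
  by rewrite mxE.
under [RHS]eq_bigr => k _ do rewrite LE mulrCA mulr_sumr.
rewrite -mulr_sumr; congr (_ * _); rewrite [RHS]exchange_big; apply: eq_bigr => i _.
under [RHS]eq_bigr => k _ do rewrite mulr_sumr.
rewrite exchange_big; apply: eq_bigr => j _ /=.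
by rewrite summxE mulr_suml; apply: eq_bigr => k _; rewrite mxE mulrA.
Qed.

(** Euler's identity for the quadratic maps q and J: the critical equation is taken at v = u. *)
Lemma energy_critical u : critical_manifold A p omega u -> energy u = dot coords p.
Proof.
move=> cu; have [Hu qu _] := cu; rewrite energyE -(critical_equation cu Hu) /dot.
have pE k : p ord0 k = 2^-1 * \sum_i \sum_j tnth A k i j * pj u u i j.
  by rewrite -qu qmapE mxE.
under [RHS]eq_bigr => k _ do rewrite pE mulrCA mulr_sumr.
rewrite -mulr_sumr; congr (_ * _); rewrite [RHS]exchange_big mulr_sumr; apply: eq_bigr => i _.
under [RHS]eq_bigr => k _ do rewrite mulr_sumr.
rewrite exchange_big mulr_sumr; apply: eq_bigr => j _ /=.
rewrite summxE mulr_suml mulr_sumr; apply: eq_bigr => k _; rewrite mxE.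
by rewrite -mulr2n -mulr_natl; field.
Qed.

End CriticalEquation.

(** * Integration by parts for integrable functions *)

Section IntegrationByParts.
Variable R : realType.
Notation mu := (@lebesgue_measure R).
Notation I := (@I2pi R).

Lemma L1_measurable_restrict (f : R -> R) : L1 f -> measurable_fun setT (f \_ I).
Proof.
move=> /integrableP[/measurable_EFinP mf _].
by apply/(measurable_restrictT _ _).1 => //; exact: mI.
Qed.

Lemma integral_EFin (D : set R) (f : R -> R) : measurable (D : set (measurableTypeR R)) ->
  mu.-integrable D (EFin \o f) ->
  (\int[mu]_(t in D) (f t)%:E)%E = (\int[mu]_(t in D) f t)%:E.
Proof. by move=> mD Lf; rewrite fineK//; exact: integrable_fin_num. Qed.

Lemma integral_restrictI (f : R -> R) : L1 f ->
  (\int[mu]_t ((f \_ I) t)%:E)%E = (int f)%:E.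
Proof.
move=> Lf; rewrite -integral_EFin//; last exact: mI.
by rewrite [RHS]integral_mkcond; apply: eq_integral => t _; rewrite restrict_EFin.
Qed.

Lemma integrable_scale (D : set R) c (f : R -> R) :
  measurable (D : set (measurableTypeR R)) -> mu.-integrable D (EFin \o f) ->
  mu.-integrable D (EFin \o (fun t => c * f t)).
Proof. by move=> mD Lf; have := integrableZl mD c Lf. Qed.

(* Fubini on the triangle [s <= t]. *)
Lemma int_prim_mul (f g : R -> R) : L1 f -> L1 g ->
  int (fun t => prim f t * g t) + int (fun t => f t * prim g t) = int f * int g.
Proof.
move=> Lf Lg.
(* Extension by 0 turns the double integral over the triangle into one over the plane. *)
pose fI := f \_ I; pose gI := g \_ I.
pose F (z : measurableTypeR R * measurableTypeR R) : R :=
  if z.1 <= z.2 then fI z.1 * gI z.2 else 0.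
have mfI : measurable_fun setT fI by exact: L1_measurable_restrict.
have mgI : measurable_fun setT gI by exact: L1_measurable_restrict.
have fIE t : 0 <= t <= 2 * pi -> fI t = f t.
  by move=> tI; rewrite /fI patchE ifT// inE; apply/I2piE.
have gIE t : 0 <= t <= 2 * pi -> gI t = g t.
  by move=> tI; rewrite /gI patchE ifT// inE; apply/I2piE.
have fI0 t : ~~ (0 <= t <= 2 * pi) -> fI t = 0.
  by move=> tI; rewrite /fI patchE ifF//; apply: contraNF tI; rewrite inE => /I2piE.
have gI0 t : ~~ (0 <= t <= 2 * pi) -> gI t = 0.
  by move=> tI; rewrite /gI patchE ifF//; apply: contraNF tI; rewrite inE => /I2piE.
have m1 : measurable_fun setT (fst : measurableTypeR R * measurableTypeR R -> measurableTypeR R).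
  exact: measurable_fst.
have m2 : measurable_fun setT (snd : measurableTypeR R * measurableTypeR R -> measurableTypeR R).
  exact: measurable_snd.
have mF : measurable_fun setT F.
  apply: measurable_fun_ifT => //; first exact: (measurable_fun_ler m1 m2).
  by apply: measurable_funM; [exact: (measurableT_comp mfI m1) |
    exact: (measurableT_comp mgI m2)].
have mF' : measurable_fun setT (EFin \o F) by exact/measurable_EFinP.
have Lprod (h k : R -> R) : L1 h -> {within I, continuous k} -> L1 (fun t => h t * k t).
  by move=> Lh ck; have := L1_continuous_mul ck Lh; under eq_fun do rewrite mulrC.
(* F is dominated by the product of |f(s)| and |g(t)|. *)
have iF : (mu \x mu)%E.-integrable setT (EFin \o F).
  apply/integrable12ltyP => //.
  have aI : L1 (fun t => `|f t|) by exact: integrable_norm.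
  have aJ : L1 (fun t => `|g t|) by exact: integrable_norm.
  apply: (@le_lt_trans _ _ (\int[mu]_s (`|fI s| * int (fun t => `|g t|))%:E)%E); last first.
    have -> : (\int[mu]_s (`|fI s| * int (fun t => `|g t|))%:E =
        \int[mu]_s (((fun s => `|f s| * int (fun t => `|g t|)) \_ I) s)%:E)%E.
      apply: eq_integral => s _; congr (_%:E); rewrite patchE /fI patchE.
      by case: ifP => // _; rewrite normr0 mul0r.
    rewrite integral_restrictI ?ltry//.
    by have := L1Z (int (fun t => `|g t|)) aI; under eq_fun do rewrite mulrC.
  apply: ge0_le_integral => //.
  - by move=> s _; apply: integral_ge0.
  - apply: (measurable_fun_fubini_tonelli_F (abse \o (EFin \o F))) => //=.
    exact: measurableT_comp.
  - apply/measurable_EFinP; apply: measurable_funM; last exact: measurable_cst.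
    exact: measurableT_comp.
  move=> s _.
  have mFs : measurable_fun setT (fun t : measurableTypeR R => F (s, t)).
    exact: (measurableT_comp mF (pair1_measurable s)).
  apply: (@le_trans _ _ (\int[mu]_t (((fun t => `|fI s| * `|g t|) \_ I) t)%:E)%E).
    apply: ge0_le_integral => //.
    - exact: (measurableT_comp (@abse_measurable R setT) (iffRL (measurable_EFinP _ _) mFs)).
    - apply/measurable_EFinP; apply: L1_measurable_restrict; exact: L1Z.
    - move=> t _; rewrite lee_fin /F /=.
      have -> : ((fun t => `|fI s| * `|g t|) \_ I) t = `|fI s| * `|gI t|.
        by rewrite /gI !(patchE _ I) /patch; case: (t \in I); rewrite ?normr0 ?mulr0.
      by case: (s <= t); rewrite ?normrM// normr0 mulr_ge0.
  rewrite integral_restrictI; last exact: L1Z.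
  by rewrite intZ.
have := Fubini iF => /=.
(* For fixed s, t runs from s to 2 pi; in the other order, s runs from 0 to t. *)
have -> : (\int[mu]_s \int[mu]_t (F (s, t))%:E =
    \int[mu]_s (((fun s => f s * (int g - prim g s)) \_ I) s)%:E)%E.
  apply: eq_integral => s _; rewrite patchE.
  case: (boolP (0 <= s <= 2 * pi)) => sI; last first.
    rewrite ifF; last by apply: contraNF sI; rewrite inE => /I2piE.
    rewrite (eq_integral (fun=> 0%E)) ?integral0// => t _.
    by rewrite /F /= fI0// mul0r if_same.
  rewrite ifT; last by rewrite inE; apply/I2piE.
  have /andP[s0 s2] := sI.
  have sub : `]s, 2 * pi] `<=` I.
    move=> t /=; rewrite in_itv /= => /andP[st t2]; apply/I2piE.
    by rewrite t2 (le_trans s0)// ltW.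
  have subc : `[s, 2 * pi] `<=` I.
    move=> t /=; rewrite in_itv /= => /andP[st t2]; apply/I2piE.
    by rewrite t2 (le_trans s0).
  have Lgo : mu.-integrable `]s, 2 * pi] (EFin \o g) by apply: integrableS Lg => //; exact: mI.
  have Lgc : mu.-integrable `[s, 2 * pi] (EFin \o g) by apply: integrableS Lg => //; exact: mI.
  have -> : int g - prim g s = \int[mu]_(t in `[s, 2 * pi]) g t.
    rewrite -Rintegral_itv_obnd_cbnd//.
    by apply: (@Rintegral_itvB _ g (BLeft 0) (BRight (2 * pi)) s); rewrite ?bnd_simp.
  rewrite -RintegralZl// -integral_EFin//; last first.
    exact: integrable_scale.
  rewrite [RHS]integral_mkcond; apply: eq_integral => t _.
  rewrite patchE mem_setE in_itv /= /F /=.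
  have [st|st] := leP s t; last by [].
  have [t2|t2] := leP t (2 * pi) => /=.
    by rewrite fIE// gIE// t2 (le_trans s0).
  by rewrite gI0 ?mulr0// negb_and -!ltNge t2 orbT.
have -> : (\int[mu]_t \int[mu]_s (F (s, t))%:E =
    \int[mu]_t (((fun t => prim f t * g t) \_ I) t)%:E)%E.
  apply: eq_integral => t _; rewrite patchE.
  case: (boolP (0 <= t <= 2 * pi)) => tI; last first.
    rewrite ifF; last by apply: contraNF tI; rewrite inE => /I2piE.
    rewrite (eq_integral (fun=> 0%E)) ?integral0// => s _.
    by rewrite /F /= gI0// mulr0 if_same.
  rewrite ifT; last by rewrite inE; apply/I2piE.
  have /andP[t0 t2] := tI.
  have Lt := L1_sub Lf tI.
  rewrite mulrC /prim -RintegralZl// -integral_EFin//; last exact: integrable_scale.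
  rewrite [RHS]integral_mkcond; apply: eq_integral => s _.
  rewrite patchE mem_setE in_itv /= /F /=.
  have [st|st] := leP s t; last by rewrite andbF.
  have [s0|s0] := leP 0 s => /=.
    by rewrite fIE ?gIE ?s0 ?(le_trans st) // mulrC.
  by rewrite fI0 ?mul0r// negb_and -!ltNge s0.
have cg := prim_continuous Lg.
have Lfg : L1 (fun s => f s * prim g s) by exact: Lprod.
rewrite !integral_restrictI; last 2 first.
- exact: L1_continuous_mul (prim_continuous Lf) Lg.
- under eq_fun do rewrite mulrBr mulrC.
  by apply: L1B => //; exact: L1Z.
move=> [<-].
transitivity (int (fun s => int g * f s - f s * prim g s) + int (fun t => f t * prim g t)).
  by congr (_ + _); apply: eq_int => s _; ring.
rewrite intB//; last exact: L1Z.
by rewrite subrK intZ// mulrC.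
Qed.

End IntegrationByParts.

(** * From the weak equation to the differential equation u + B x = const *)

Section CriticalODE.
Variable R : realType.
Notation mu := (@lebesgue_measure R).
Notation I := (@I2pi R).

Lemma within_continuous_sum (J : Type) (r : seq J) (F : J -> R -> R) :
  (forall j, {within I, continuous (F j)}) ->
  {within I, continuous (fun t => \sum_(j <- r) F j t)}.
Proof. by move=> cF; exact: (@continuous_sum R (subspace I) J r xpredT F cF). Qed.

Lemma within_continuousZ c (f : R -> R) : {within I, continuous f} ->
  {within I, continuous (fun t => c * f t)}.
Proof.
move=> cf x; apply: (@cvgM R (subspace I) (nbhs x) _ (fun=> c) f c (f x)).
  exact: cvg_cst.
exact: cf.
Qed.

Lemma prim_sqr_eq0 (v k : R -> R) t : L1 (fun s => v s * v s) ->
  int (fun s => v s * v s) = 0 -> L1 (fun s => k s * v s) -> 0 <= t <= 2 * pi ->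
  prim (fun s => k s * v s) t = 0.
Proof.
move=> Lvv v0 Lkv tI.
have mvv : measurable_fun I (EFin \o (fun s => v s * v s)) by case/integrableP : Lvv.
have : (\int[mu]_(s in I) `|(v s * v s)%:E| = 0)%E.
  have e : (\int[mu]_(s in I) (v s * v s)%:E)%E = 0%E.
    exact: etrans (integral_EFin (@mI R) Lvv) (congr1 EFin v0).
  by rewrite -[RHS]e; apply: eq_integral => s _; rewrite /= -expr2 ger0_norm ?sqr_ge0.
move=> /(ae_eq_integral_abs mu (@mI R) mvv) aev.
have Lt := L1_sub Lkv tI.
rewrite /prim /Rintegral (ae_eq_integral (cst 0%E))//.
- by rewrite integral0.
- by case/integrableP : Lt.
apply: filterS aev => s h /=; rewrite in_itv /= => /andP[s0 st].
have /andP[_ t2] := tI.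
have sI : I s by apply/I2piE; rewrite s0 (le_trans st).
have /= := h sI => -[/eqP]; rewrite mulf_eq0 orbb => /eqP ->.
by rewrite mulr0.
Qed.

Variables (d l : nat) (A : l.-tuple 'M[R]_d) (p : 'rV[R]_l) (omega : {scalar 'rV[R]_l}).
Hypothesis AT : forall k, (tnth A k)^T = - tnth A k.
Variable u : control R d.
Hypothesis cu : critical_manifold A p omega u.

Let B := lincomb A (coords omega).
Let Hu : Hloop u. Proof. by case: cu. Qed.

Let B_anti i j : B i j = - B j i.
Proof. by have /matrixP/(_ j i) := lincombT (coords omega) AT; rewrite !mxE. Qed.

(** Integration by parts removes the primitive of v, so that u + B x is orthogonal to all loops. *)
Lemma critical_ip v : Hloop v ->
  \sum_j int (fun t => v j t * (u j t + \sum_i B j i * prim (u i) t)) = 0.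
Proof.
move=> Hv.
have Lp i j : L1 (fun t => B j i * (prim (u i) t * v j t)) by apply: L1Z; exact: pj_L1.
(* The boundary term vanishes because v is a loop. *)
have swap i j : pj v u i j = - pj u v j i.
  apply/eqP; rewrite -addr_eq0; apply/eqP.
  have := int_prim_mul (control_L1 v i) (control_L1 u j).
  rewrite (HloopP _).1// mul0r /pj => <-; congr (_ + _).
  by apply: eq_int => t _; rewrite mulrC.
have := critical_equation cu Hv; rewrite -/B.
have -> : \sum_i \sum_j B i j * (pj u v i j + pj v u i j) =
    2 * \sum_j \sum_i B i j * pj u v i j.
  under eq_bigr => i _ do under eq_bigr => j _ do rewrite swap mulrBr.
  under eq_bigr => i _ do rewrite big_split /=.
  rewrite big_split /= mulr_natl mulr2n; congr (_ + _); first exact: exchange_big.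
  apply: eq_bigr => i _; apply: eq_bigr => j _.
  by rewrite B_anti; ring.
rewrite mulKf// => h.
transitivity (ip u v - \sum_j \sum_i B i j * pj u v i j); last by rewrite -h subrr.
rewrite /ip -sumrB; apply: eq_bigr => j _.
transitivity (int (fun t => u j t * v j t + \sum_i B j i * (prim (u i) t * v j t))).
  apply: eq_int => t _; rewrite mulrDr mulrC; congr (_ + _).
  by rewrite mulr_sumr; apply: eq_bigr => i _; ring.
rewrite intD; [|exact: control_mulL1|exact: L1_sum].
congr (_ + _); rewrite int_sum// -sumrN; apply: eq_bigr => i _.
by rewrite intZ ?(B_anti j i) ?mulNr//; exact: pj_L1.
Qed.

(** The du Bois-Reymond argument: u + B x minus its mean is itself an admissible test, hence is 0
    almost everywhere. Since u is only known almost everywhere, its continuous version y is compared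
    with it through integrals. *)
Lemma critical_ode : exists c : 'I_d -> R,
  let y j t := c j - \sum_i B j i * prim (u i) t in
  (forall j t, 0 <= t <= 2 * pi -> prim (u j) t = prim (y j) t) /\
  (forall i j, pj u u i j = int (fun t => prim (u i) t * y j t)).
Proof.
pose S j t := \sum_i B j i * prim (u i) t.
have cS j : {within I, continuous (S j)}.
  apply: within_continuous_sum => i; apply: within_continuousZ.
  exact: prim_continuous (control_L1 u i).
have LS j : L1 (S j) by exact: L1_continuous.
(* The mean of B x, hence of u + B x as u is a loop; subtracting it makes v a loop. *)
pose c j := (2 * pi)^-1 * int (S j).
have pi0 : 2 * pi != 0 :> R by rewrite gt_eqF// twopi_gt0.
(* Cut off outside the interval, to be bounded and measurable on the whole line as a control must
   be. *)
pose h j := (fun t => S j t - c j) \_ I.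
have hI j t : 0 <= t <= 2 * pi -> h j t = S j t - c j.
  by move=> tI; rewrite /h patchE ifT// inE; apply/I2piE.
have Lh j : L1 (fun t => S j t - c j) by apply: L1B => //; exact: L1_cst.
have hL j : h j \in Lfun (@leb2pi R) 2%:E.
  have [M hM] := within_continuous_bounded (cS j).
  have M0 : 0 <= M.
    by apply: le_trans (hM 0 _) => //; rewrite lexx ltW// twopi_gt0.
  apply: (@bounded_Lfun _ _ (M + `|c j|)); first exact: L1_measurable_restrict.
  move=> t; case: (boolP (0 <= t <= 2 * pi)) => tI.
    by rewrite hI// (le_trans (ler_normB _ _))// lerD2r hM.
  rewrite /h patchE ifF; last by apply: contraNF tI; rewrite inE => /I2piE.
  by rewrite normr0 addr_ge0.
pose v : control R d := [ffun j => u j + Lfun_Sub (lee1n 2) (hL j)].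
have vE j t : 0 <= t <= 2 * pi -> v j t = u j t + (S j t - c j).
  by move=> tI; rewrite ffunE -(hI j t tI).
have Hv : Hloop v.
  apply/HloopP => j.
  transitivity (int (fun t => u j t + (S j t - c j))); first by apply: eq_int => t /vE.
  rewrite intD//; last exact: control_L1.
  rewrite (HloopP _).1// intB//; last exact: L1_cst.
  by rewrite int_cst /c mulrAC mulVf// mul1r subrr addr0.
have intv j : int (v j) = 0 by exact: (HloopP _).1.
(* In [critical_ip], the factor multiplying v_j is v_j + c_j, and v_j has integral 0. *)
have v2 j : int (fun t => v j t * v j t) = 0.
  have : \sum_j int (fun t => v j t * v j t) = 0.
    rewrite -[RHS](critical_ip Hv); apply: eq_bigr => i _.
    transitivity (int (fun t => v i t * v i t + c i * v i t)).
      rewrite intD; [|exact: control_mulL1|by apply: L1Z; exact: control_L1].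
      by rewrite intZ ?intv ?mulr0 ?addr0//; exact: control_L1.
    by apply: eq_int => t tI; rewrite [in RHS]/= -/(S i t) !vE//; ring.
  move/eqP; rewrite psumr_eq0 => [/allP/(_ j)|i _]; last first.
    by apply: Rintegral_ge0 => t _; rewrite -expr2 sqr_ge0.
  by rewrite mem_index_enum => /(_ isT)/eqP.
exists c; split => [j t tI|i j].
  have := prim_sqr_eq0 (k := fun=> 1) (control_mulL1 v v j j) (v2 j) _ tI.
  have L1v : L1 (fun s => 1 * v j s) by apply: L1Z; exact: control_L1.
  move=> /(_ L1v) p0.
  have -> : prim (fun t => c j - \sum_i B j i * prim (u i) t) t =
      prim (fun t => u j t + (- 1) * (1 * v j t)) t.
    apply: eq_Rintegral => s; rewrite inE /= in_itv /= => /andP[s0 st].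
    have /andP[_ t2] := tI.
    rewrite vE; last by rewrite s0 (le_trans st).
    by rewrite -/(S j s); ring.
  rewrite primD//; [|exact: control_L1|exact: L1Z].
  by rewrite primZ// p0 mulr0 addr0.
have Lx : L1 (fun s => prim (u i) s * v j s) by exact: pj_L1.
have tI : (0 : R) <= 2 * pi <= 2 * (pi : R) by rewrite lexx ltW// twopi_gt0.
have := prim_sqr_eq0 (control_mulL1 v v j j) (v2 j) Lx tI; rewrite prim2pi => p0.
have Ly : L1 (fun t => prim (u i) t * (c j - S j t)).
  apply: L1_continuous_mul; first exact: prim_continuous (control_L1 u i).
  by apply: L1B => //; exact: L1_cst.
rewrite -[RHS]addr0 -[X in _ + X]p0 -intD//.
apply: eq_int => t tI' /=; rewrite vE// /S; ring.
Qed.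

End CriticalODE.

(** * A real form of the spectral theorem for antisymmetric matrices *)

Section SpectralReal.
Variable R : realType.
Notation C := (complex.complex R).
Notation Re := (@complex.Re R).
Notation Im := (@complex.Im R).
Implicit Types z : C.

Lemma ReD z1 z2 : Re (z1 + z2) = Re z1 + Re z2. Proof. by case: z1 z2 => [??] [??]. Qed.
Lemma ImD z1 z2 : Im (z1 + z2) = Im z1 + Im z2. Proof. by case: z1 z2 => [??] [??]. Qed.
Lemma ReM z1 z2 : Re (z1 * z2) = Re z1 * Re z2 - Im z1 * Im z2.
Proof. by case: z1 z2 => [??] [??]. Qed.
Lemma ImM z1 z2 : Im (z1 * z2) = Re z1 * Im z2 + Im z1 * Re z2.
Proof. by case: z1 z2 => [??] [??]. Qed.

Lemma Re_mulmx m n r (M : 'M[C]_(m, n)) (N : 'M[C]_(n, r)) :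
  map_mx Re (M *m N) = map_mx Re M *m map_mx Re N - map_mx Im M *m map_mx Im N.
Proof.
apply/matrixP => i j; rewrite !mxE (big_morph Re ReD (erefl _)) -sumrB.
by apply: eq_bigr => k _; rewrite ReM !mxE.
Qed.

Lemma Im_mulmx m n r (M : 'M[C]_(m, n)) (N : 'M[C]_(n, r)) :
  map_mx Im (M *m N) = map_mx Re M *m map_mx Im N + map_mx Im M *m map_mx Re N.
Proof.
apply/matrixP => i j; rewrite !mxE (big_morph Im ImD (erefl _)) -big_split/=.
by apply: eq_bigr => k _; rewrite ImM !mxE.
Qed.

(** Over the complex numbers B is normal with imaginary eigenvalues i mu. With P = P1 + i P2
    unitary, these are the real and imaginary parts of P B = i mu P and the real part of P^* P = 1.
    The rows of P1 and P2 are a redundant resolution of the identity, which avoids matching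
    conjugate eigenvalues. *)
Lemma antisymmetric_spectral d (B : 'M[R]_d) : B^T = - B ->
  exists P1 P2 : 'M[R]_d, exists mu : 'rV[R]_d,
    [/\ P1 *m B = - (diag_mx mu *m P2), P2 *m B = diag_mx mu *m P1
      & P1^T *m P1 + P2^T *m P2 = 1%:M].
Proof.
move=> BT; pose A := map_mx (fun x => complex.Complex x 0) B : 'M[C]_d.
pose star n m (M : 'M[C]_(m, n)) := map_mx (@complex.conjc R) M^T.
have starM m n r (M : 'M[C]_(m, n)) (N : 'M[C]_(n, r)) :
    star _ _ (M *m N) = star _ _ N *m star _ _ M.
  by rewrite /star trmx_mul map_mxM.
have starA : star _ _ A = - A.
  apply/matrixP => i j; have /matrixP/(_ i j) := BT; rewrite !mxE => ->.
  by apply/eqP; rewrite complex.eq_complex /= !eqxx.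
have /spectral.orthomx_spectralP : A \is spectral.normalmx.
  by apply/spectral.normalmxP; rewrite -[map_mx _ A^T]/(star _ _ A) starA mulmxN mulNmx.
set P := spectral.spectralmx A; set D := spectral.spectral_diag A.
have uP : P \is spectral.unitarymx by exact: spectral.spectral_unitarymx.
rewrite spectral.invmx_unitary// -[map_mx _ P^T]/(star _ _ P) => AE.
have PP : P *m star _ _ P = 1%:M by exact/spectral.unitarymxP.
have PP' : star _ _ P *m P = 1%:M by exact: mulmx1C.
have PA : P *m A = diag_mx D *m P by rewrite AE !mulmxA PP mul1mx.
have ReD0 j : Re (D ord0 j) = 0.
  have : star _ _ (diag_mx D) = - diag_mx D.
    have -> : diag_mx D = P *m A *m star _ _ P by rewrite PA -mulmxA PP mulmx1.
    have -> : star _ _ (P *m A *m star _ _ P) = star _ _ (star _ _ P) *m (star _ _ A *m star _ _ P).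
      by rewrite !starM.
    have -> : star _ _ (star _ _ P) = P.
      by apply/matrixP => i k; rewrite !mxE complex.conjcK.
    by rewrite starA mulNmx mulmxN mulmxA.
  move=> /matrixP/(_ j j); rewrite !mxE eqxx !mulr1n; case: (D ord0 j) => x y /=.
  by move=> /eqP; rewrite complex.eq_complex /= => /andP[/eqP h _]; lra.
have DRe : map_mx Re (diag_mx D) = 0.
  apply/matrixP => i j; rewrite !mxE; case: eqP => [->|_]; by rewrite ?mulr1n ?mulr0n ?ReD0.
have DIm : map_mx Im (diag_mx D) = diag_mx (map_mx Im D).
  apply/matrixP => i j; rewrite !mxE; case: eqP => [->|_]; by rewrite ?mulr1n ?mulr0n.
have ARe : map_mx Re A = B by apply/matrixP => i j; rewrite !mxE.
have AIm : map_mx Im A = 0 by apply/matrixP => i j; rewrite !mxE.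
exists (map_mx Re P), (map_mx Im P), (map_mx Im D); split.
- have := congr1 (map_mx Re) PA; rewrite !Re_mulmx DRe DIm ARe AIm.
  by rewrite mulmx0 subr0 mul0mx sub0r.
- have := congr1 (map_mx Im) PA; rewrite !Im_mulmx DRe DIm ARe AIm.
  by rewrite mulmx0 add0r mul0mx add0r.
- have := congr1 (map_mx Re) PP'; rewrite Re_mulmx.
  have -> : map_mx Re (star _ _ P) = (map_mx Re P)^T.
    by apply/matrixP => i j; rewrite !mxE; case: (P j i).
  have -> : map_mx Im (star _ _ P) = - (map_mx Im P)^T.
    by apply/matrixP => i j; rewrite !mxE; case: (P j i).
  rewrite mulNmx opprK => ->; apply/matrixP => i j; rewrite !mxE.
  by case: (i == j).
Qed.

End SpectralReal.

(** * Antiderivatives on [0, 2 pi] and rotations *)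

Section Antiderivative.
Variable R : realType.
Notation I := (@I2pi R).
Implicit Types F G f g : R -> R.

(** Continuity up to the end points and differentiability inside: what primitives satisfy, and what
    the mean value theorem requires. *)
Definition antider F f := {within I, continuous F} /\
  forall t : R, 0 < t < 2 * pi -> is_derive t 1 F (f t).

Lemma near_I2pi (t : R) : 0 < t < 2 * pi -> \forall s \near t, 0 <= s <= 2 * pi.
Proof.
move=> tI; have tin : t \in `]0, (2 * pi : R)[ by rewrite in_itv.
have := near_in_itvoo tin; apply: filterS => s; rewrite in_itv /= => /andP[? ?].
by rewrite !ltW.
Qed.

Lemma antider_ext F G f g : (forall t : R, 0 <= t <= 2 * pi -> F t = G t) ->
  (forall t : R, 0 < t < 2 * pi -> f t = g t) -> antider F f -> antider G g.
Proof.
move=> FG fg [cF dF]; split.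
  apply: (subspace_eq_continuous _ cF) => t; rewrite inE => /I2piE; exact: FG.
move=> t tI; rewrite -fg//; apply: (near_eq_is_derive (f := F)); last exact: dF.
near=> s; apply: FG; near: s; exact: near_I2pi.
Unshelve. all: by end_near.
Qed.

Lemma antider_cst c : antider (fun=> c) (fun=> 0).
Proof.
split; last by move=> t _; exact: is_derive_cst.
by move=> x; exact: cvg_cst.
Qed.

Lemma antiderD F G f g : antider F f -> antider G g ->
  antider (fun t => F t + G t) (fun t => f t + g t).
Proof.
move=> [cF dF] [cG dG]; split => [x|t tI].
  by apply: (@cvgD _ _ _ (nbhs x) _ F G (F x) (G x)); [exact: cF|exact: cG].
by apply: is_deriveD; [exact: dF|exact: dG].
Qed.

Lemma antiderM F G f g : antider F f -> antider G g ->
  antider (fun t => F t * G t) (fun t => f t * G t + F t * g t).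
Proof.
move=> [cF dF] [cG dG]; split => [x|t tI].
  by apply: (@cvgM _ _ (nbhs x) _ F G (F x) (G x)); [exact: cF|exact: cG].
apply: is_derive_eq; first exact: is_deriveM (dF t tI) (dG t tI).
by rewrite /GRing.scale /= addrC mulrC.
Qed.

Lemma antiderZ c F f : antider F f -> antider (fun t => c * F t) (fun t => c * f t).
Proof.
move=> aF; apply: antider_ext (antiderM (antider_cst c) aF) => // t _.
by rewrite mul0r add0r.
Qed.

Lemma antider_sum (J : Type) (r : seq J) (F f : J -> R -> R) :
  (forall j, antider (F j) (f j)) ->
  antider (fun t => \sum_(j <- r) F j t) (fun t => \sum_(j <- r) f j t).
Proof.
move=> aF; elim: r => [|j r IHr].
  by apply: antider_ext (antider_cst 0) => t _; rewrite big_nil.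
by apply: antider_ext (antiderD (aF j) IHr) => t _; rewrite big_cons.
Qed.

Lemma antider_constant F f t : antider F f ->
  (forall s : R, 0 < s < 2 * pi -> f s = 0) -> 0 <= t <= 2 * pi -> F t = F 0.
Proof.
move=> [cF dF] f0 /andP[t0 t2].
have [s sI||c cI] := @MVT_segment R F (fun=> 0) 0 t t0.
- move: sI; rewrite in_itv /= => /andP[s0 st].
  have sI : 0 < s < 2 * pi by rewrite s0 (lt_le_trans st).
  by rewrite -(f0 s sI); exact: dF.
- apply: continuous_subspaceW cF => s /=; rewrite in_itv /= => /andP[s0 st].
  by apply/I2piE; rewrite s0 (le_trans st).
by rewrite mul0r => /eqP; rewrite subr_eq0 => /eqP.
Qed.

Lemma prim0 f : prim f 0 = 0.
Proof. by rewrite /prim set_itv1 Rintegral_set1. Qed.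

Lemma antider_prim f : {within I, continuous f} -> antider (prim f) f.
Proof.
move=> cf; have Lf := L1_continuous cf; split; first exact: prim_continuous.
move=> t tI; have /andP[t0 t2] := tI.
have ct : {for t, continuous f}.
  by apply: (within_continuous_continuous (@twopi_gt0 R) cf); rewrite in_itv.
have [dF <-] := continuous_FTC1_closed t2 Lf t0 ct.
by rewrite derive1E; exact: derivableP.
Qed.

Lemma prim_antider F f t : {within I, continuous f} -> antider F f ->
  0 <= t <= 2 * pi -> prim f t = F t - F 0.
Proof.
move=> cf aF tI; have aD := antiderD (antider_prim cf) (antiderZ (-1) aF).
have f0 (s : R) : 0 < s < 2 * pi -> f s + -1 * f s = 0 by move=> _; ring.
have /= := antider_constant aD f0 tI; rewrite prim0 => e.
lra.
Qed.

Lemma int_antider F f : {within I, continuous f} -> antider F f ->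
  int f = F (2 * pi) - F 0.
Proof.
by move=> cf aF; rewrite -prim2pi; apply: prim_antider => //; rewrite lexx ltW ?twopi_gt0.
Qed.

Lemma antider_sin k : antider (fun t => sin (k * t)) (fun t => k * cos (k * t)).
Proof.
split.
  apply: continuous_subspaceT => t; apply: (@continuous_comp _ _ _ ( *%R k) sin).
    exact: mulrl_continuous.
  exact: continuous_sin.
move=> t _; have dk : is_derive t 1 ( *%R k) k.
  by apply: is_derive_eq; rewrite /GRing.scale /= mulr1.
rewrite mulrC; exact: (is_derive1_comp (is_derive_sin (k * t)) dk).
Qed.

Lemma antider_cos k : antider (fun t => cos (k * t)) (fun t => - (k * sin (k * t))).
Proof.
split.
  apply: continuous_subspaceT => t; apply: (@continuous_comp _ _ _ ( *%R k) cos).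
    exact: mulrl_continuous.
  exact: continuous_cos.
move=> t _; have dk : is_derive t 1 ( *%R k) k.
  by apply: is_derive_eq; rewrite /GRing.scale /= mulr1.
rewrite mulrC -mulNr; exact: (is_derive1_comp (is_derive_cos (k * t)) dk).
Qed.

(* (F + iG) exp(ikt) is constant; P0 and Q0 give its real and imaginary parts. *)
Lemma rotation_solution k F G : antider F (fun t => k * G t) ->
  antider G (fun t => - (k * F t)) -> forall t : R, 0 <= t <= 2 * pi ->
  F t = F 0 * cos (k * t) + G 0 * sin (k * t) /\
  G t = G 0 * cos (k * t) - F 0 * sin (k * t).
Proof.
move=> aF aG t tI; pose c s := cos (k * s); pose z s := sin (k * s).
have aP := antiderD (antiderM aF (antider_cos k)) (antiderZ (-1) (antiderM aG (antider_sin k))).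
have aQ := antiderD (antiderM aF (antider_sin k)) (antiderM aG (antider_cos k)).
have P0 : F t * c t + -1 * (G t * z t) = F 0 * c 0 + -1 * (G 0 * z 0).
  by apply: (antider_constant aP) tI => s _; rewrite /c /z; ring.
have Q0 : F t * z t + G t * c t = F 0 * z 0 + G 0 * c 0.
  by apply: (antider_constant aQ) tI => s _; rewrite /c /z; ring.
rewrite /c /z mulr0 cos0 sin0 in P0 Q0.
have e := cos2Dsin2 (k * t).
have -> : F 0 = F t * c t - G t * z t by rewrite /c /z; lra.
have -> : G 0 = F t * z t + G t * c t by rewrite /c /z; lra.
rewrite /c /z; split.
  by rewrite -[LHS]mulr1 -e; ring.
by rewrite -[LHS]mulr1 -e; ring.
Qed.

End Antiderivative.

(** * Decomposition of a periodic solution of y' = - B y into harmonics *)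

Section Harmonics.
Variable R : realType.
Notation I := (@I2pi R).

(** The fractional part r of |x| satisfies cos(2 pi r) = 1, so sin(pi r) = 0, which forces r = 0 on
    [0, 1). *)
Lemma cos_2pi_eq1 (x : R) : cos (x * (2 * pi)) = 1 -> exists n : nat, `|x| = n%:R.
Proof.
move=> x1; pose n := Num.truncn `|x|; exists n.
have /andP[nx xn] : n%:R <= `|x| < n.+1%:R by exact: truncn_itv.
have : cos ((`|x| - n%:R) * (2 * pi)) = 1.
  have -> : (`|x| - n%:R) * (2 * pi) = `|x| * (2 * pi) - (pi *+ 2) *+ n.
    by rewrite -[_ *+ n]mulr_natr -[pi *+ 2]mulr_natr; ring.
  rewrite -[LHS](periodicn (@cosD2pi R) n) subrK.
  by have [_|_] := ger0P x; last by rewrite mulNr cosN.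
set r := `|x| - n%:R; have -> : r * (2 * pi) = (r * pi) *+ 2.
  by rewrite -mulr_natr; ring.
rewrite cos_mulr2n => /eqP; rewrite subr_eq => /eqP c2.
have s0 : sin (r * pi) = 0.
  apply/eqP; rewrite -sqrf_eq0 sin2cos2; apply/eqP.
  move: c2; rewrite -mulr_natr => c2; lra.
have [r0|r0|/eqP] := ltgtP 0 r.
- have : 0 < sin (r * pi).
    apply: sin_gt0_pi; rewrite mulr_gt0 ?pi_gt0//= gtr_pMl ?pi_gt0//.
    by rewrite /r ltrBlDr -natr1 addrC in xn *.
  by rewrite s0 ltxx.
- by move: r0; rewrite /r subr_lt0 ltNge nx.
- by rewrite eq_sym subr_eq0 => /eqP.
Qed.

(** Periodicity makes the rotation by 2 pi k fix a nonzero vector, so |k| is a natural number; k = 0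
    would give constants, excluded by the vanishing means. *)
Lemma rotation_frequency k (F G : R -> R) : antider F (fun t => k * G t) ->
  antider G (fun t => - (k * F t)) -> F (2 * pi) = F 0 -> G (2 * pi) = G 0 ->
  int F = 0 -> int G = 0 ->
  (F 0 = 0 /\ G 0 = 0) \/ exists n : nat, `|k| = n.+1%:R.
Proof.
move=> aF aG pF pG iF iG.
have [|n0] := pselect (F 0 = 0 /\ G 0 = 0); [by left|right].
have tI : (0 : R) <= 2 * pi <= 2 * (pi : R) by rewrite lexx ltW// twopi_gt0.
have [e1 e2] := rotation_solution aF aG tI; rewrite pF in e1; rewrite pG in e2.
have pos : F 0 ^+ 2 + G 0 ^+ 2 != 0.
  apply/negP; rewrite paddr_eq0 ?sqr_ge0// !sqrf_eq0 => /andP[/eqP ? /eqP ?].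
  exact: n0.
have /cos_2pi_eq1[[|n] kn] : cos (k * (2 * pi)) = 1; last by exists n.
  apply: (mulfI pos); rewrite mulr1; set c := cos _ in e1 e2 *; set s := sin _ in e1 e2.
  transitivity (F 0 * (F 0 * c + G 0 * s) + G 0 * (G 0 * c - F 0 * s)); first by ring.
  by rewrite -e1 -e2; ring.
have k0 : k = 0 by apply/eqP; rewrite -normr_eq0 kn.
exfalso; apply: n0; split.
  move: iF; rewrite (eq_int (g := fun=> F 0)) => [|t tI'].
    by rewrite int_cst => /eqP; rewrite mulf_eq0 (gt_eqF (@twopi_gt0 R)) orbF => /eqP.
  have [-> _] := rotation_solution aF aG tI'.
  by rewrite k0 mul0r cos0 sin0 mulr1 mulr0 addr0.
move: iG; rewrite (eq_int (g := fun=> G 0)) => [|t tI'].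
  by rewrite int_cst => /eqP; rewrite mulf_eq0 (gt_eqF (@twopi_gt0 R)) orbF => /eqP.
have [_ ->] := rotation_solution aF aG tI'.
by rewrite k0 mul0r cos0 sin0 mulr1 mulr0 subr0.
Qed.

Lemma signed_rotation (k n t : R) : `|k| = n ->
  cos (k * t) = cos (n * t) /\ sin (k * t) = Num.sg k * sin (n * t).
Proof.
move=> <-; have [k0|k0] := leP 0 k.
  rewrite ger0_norm//; split => //; have [->|k1] := eqVneq k 0.
    by rewrite mul0r sin0 mulr0.
  by rewrite gtr0_sg ?mul1r// lt_def k1.
by rewrite ltr0_norm// ltr0_sg// mulNr cosN sinN mulN1r opprK.
Qed.

(** Along each row of P1 and P2, y becomes a plane rotation of frequency mu_k, which is either zero
    or of nonzero integer frequency. *)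
Lemma harmonic_decomposition d (B : 'M[R]_d) (y : 'I_d -> R -> R) :
  B^T = - B -> (forall j, antider (y j) (fun t => - \sum_i B j i * y i t)) ->
  (forall j, y j (2 * pi) = y j 0) -> (forall j, int (y j) = 0) ->
  exists N, exists a b : 'M[R]_(d, N), let nu := \row_n n.+1%:R in
  [/\ B *m a = - (b *m diag_mx nu), B *m b = a *m diag_mx nu &
      forall t, 0 <= t <= 2 * pi -> \col_j y j t =
        a *m (\col_n cos (nu ord0 n * t)) + b *m (\col_n sin (nu ord0 n * t))].
Proof.
move=> BT dy py iy; have [P1 [P2 [mu [P1B P2B PP]]]] := antisymmetric_spectral BT.
pose al k t := \sum_j P1 k j * y j t; pose be k t := \sum_j P2 k j * y j t.
have cy j : {within I, continuous (y j)} by case: (dy j).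
have Ly j : L1 (y j) by exact: L1_continuous.
have P1Bk k i : \sum_j P1 k j * B j i = - (mu ord0 k * P2 k i).
  by have /matrixP/(_ k i) := P1B; rewrite mul_diag_mx !mxE.
have P2Bk k i : \sum_j P2 k j * B j i = mu ord0 k * P1 k i.
  by have /matrixP/(_ k i) := P2B; rewrite mul_diag_mx !mxE.
have dal k : antider (al k) (fun t => mu ord0 k * be k t).
  have := @antider_sum R _ (index_enum _) (fun j t => P1 k j * y j t) _
    (fun j => antiderZ (P1 k j) (dy j)).
  apply: antider_ext => // t _ /=.
  under eq_bigr => j _ do rewrite mulrN mulr_sumr.
  rewrite sumrN exchange_big /= -sumrN mulr_sumr; apply: eq_bigr => i _.
  rewrite mulrA -[RHS]opprK -mulNr -P1Bk mulr_suml; congr (- _).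
  by apply: eq_bigr => j _; rewrite mulrA.
have dbe k : antider (be k) (fun t => - (mu ord0 k * al k t)).
  have := @antider_sum R _ (index_enum _) (fun j t => P2 k j * y j t) _
    (fun j => antiderZ (P2 k j) (dy j)).
  apply: antider_ext => // t _ /=.
  under eq_bigr => j _ do rewrite mulrN mulr_sumr.
  rewrite sumrN exchange_big /= mulr_sumr; congr (- _); apply: eq_bigr => i _.
  by rewrite mulrA -P2Bk mulr_suml; apply: eq_bigr => j _; rewrite mulrA.
have pal k : al k (2 * pi) = al k 0 by apply: eq_bigr => j _; rewrite py.
have pbe k : be k (2 * pi) = be k 0 by apply: eq_bigr => j _; rewrite py.
have ial k : int (al k) = 0.
  rewrite int_sum => [|j]; last exact: L1Z.
  by rewrite big1// => j _; rewrite intZ// iy mulr0.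
have ibe k : int (be k) = 0.
  rewrite int_sum => [|j]; last exact: L1Z.
  by rewrite big1// => j _; rewrite intZ// iy mulr0.
have yE t : \col_j y j t = \sum_k (al k t *: (row k P1)^T + be k t *: (row k P2)^T).
  have -> : \col_j y j t = (P1^T *m P1 + P2^T *m P2) *m (\col_j y j t).
    by rewrite PP mul1mx.
  apply/matrixP => j z; rewrite mulmxDl -!mulmxA [LHS]mxE [X in X + _]mxE [X in _ + X]mxE.
  rewrite -big_split /= summxE; apply: eq_bigr => k _; rewrite !mxE.
  by congr (_ + _); rewrite mulrC; congr (_ * _); apply: eq_bigr => i _; rewrite mxE.
have BP1 k : B *m (row k P1)^T = mu ord0 k *: (row k P2)^T.
  apply: trmx_inj; rewrite trmx_mul trmxK BT mulmxN -row_mul P1B linearN opprK.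
  by rewrite linearZ /= trmxK; apply/rowP => i; rewrite [LHS]mxE mul_diag_mx !mxE.
have BP2 k : B *m (row k P2)^T = - (mu ord0 k *: (row k P1)^T).
  apply: trmx_inj; rewrite trmx_mul trmxK BT mulmxN -row_mul P2B.
  by rewrite linearN linearZ /= trmxK; congr (- _); apply/rowP => i; rewrite [LHS]mxE mul_diag_mx !mxE.
(* Each k contributes one harmonic: an index n for the frequency n + 1, a cosine vector and a sine
   vector. *)
have /choice[f fP] k : exists nab : nat * 'cV[R]_d * 'cV[R]_d,
    [/\ B *m nab.1.2 = - (nab.1.1.+1%:R *: nab.2), B *m nab.2 = nab.1.1.+1%:R *: nab.1.2
      & forall t, 0 <= t <= 2 * pi ->
        al k t *: (row k P1)^T + be k t *: (row k P2)^T =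
        cos (nab.1.1.+1%:R * t) *: nab.1.2 + sin (nab.1.1.+1%:R * t) *: nab.2].
  have rot := rotation_solution (dal k) (dbe k).
  case: (rotation_frequency (dal k) (dbe k) (pal k) (pbe k) (ial k) (ibe k)).
    (* A vanishing rotation is recorded as zero vectors at frequency 1. *)
    move=> [a0 b0]; exists (0%N, 0, 0) => /=; split; rewrite ?mulmx0 ?scaler0 ?oppr0//.
    move=> t tI; have [-> ->] := rot t tI.
    by rewrite a0 b0 !mul0r subr0 addr0 !scale0r !scaler0.
  move=> [n kn]; pose a := al k 0 *: (row k P1)^T + be k 0 *: (row k P2)^T.
  pose b := be k 0 *: (row k P1)^T - al k 0 *: (row k P2)^T.
  have Ba : B *m a = - (mu ord0 k *: b).
    by rewrite mulmxDr -!scalemxAr BP1 BP2; apply/colP => i; rewrite !mxE; ring.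
  have Bb : B *m b = mu ord0 k *: a.
    by rewrite mulmxBr -!scalemxAr BP1 BP2; apply/colP => i; rewrite !mxE; ring.
  have sgm : Num.sg (mu ord0 k) * mu ord0 k = n.+1%:R by rewrite -normrEsg.
  have sgn : Num.sg (mu ord0 k) * n.+1%:R = mu ord0 k by rewrite -kn -numEsg.
  (* The sign of mu_k is absorbed in the sine vector, so that the recorded frequency is positive. *)
  exists (n, a, Num.sg (mu ord0 k) *: b) => /=; split.
  - by rewrite Ba scalerA mulrC sgn.
  - by rewrite -scalemxAr Bb scalerA sgm.
  - move=> t tI; have [-> ->] := rot t tI.
    have [-> ->] := signed_rotation t kn.
    by apply/colP => i; rewrite !mxE; ring.
(* One column per frequency up to the largest; the vectors of all k with the same frequency add up
   in that column. *)
pose N := (\max_k (f k).1.1).+1; pose e k : 'rV[R]_N := delta_mx ord0 (inord (f k).1.1).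
have fN k : ((f k).1.1 < N)%N by rewrite ltnS leq_bigmax.
pose nu : 'rV[R]_N := \row_n n.+1%:R.
have e_nu k : e k *m diag_mx nu = (f k).1.1.+1%:R *: e k.
  by rewrite -rowE row_diag_mx mxE inordK.
exists N, (\sum_k (f k).1.2 *m e k), (\sum_k (f k).2 *m e k) => /=; split.
- rewrite mulmx_sumr mulmx_suml -sumrN; apply: eq_bigr => k _.
  have [h _ _] := fP k.
  by rewrite mulmxA h mulNmx -scalemxAl -mulmxA e_nu -scalemxAr.
- rewrite mulmx_sumr mulmx_suml; apply: eq_bigr => k _.
  have [_ h _] := fP k.
  by rewrite mulmxA h -scalemxAl -mulmxA e_nu -scalemxAr.
- move=> t tI; rewrite yE !mulmx_suml -big_split /=; apply: eq_bigr => k _.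
  have [_ _ ->//] := fP k.
  rewrite -!mulmxA -!rowE; congr (_ + _).
    by rewrite [row _ _]mx11_scalar mul_mx_scalar !mxE inordK.
  by rewrite [row _ _]mx11_scalar mul_mx_scalar !mxE inordK.
Qed.

End Harmonics.

(** * Critical points as finite sums of harmonics *)

Section CriticalModes.
Variable R : realType.
Notation I := (@I2pi R).

Lemma cossin_2pin n : cos (n%:R * (2 * pi)) = 1 :> R /\ sin (n%:R * (2 * pi)) = 0 :> R.
Proof.
have c1 : cos (n%:R * (2 * pi)) = 1 :> R.
  have -> : n%:R * (2 * pi) = 0 + (pi *+ 2) *+ n :> R.
    by rewrite -[_ *+ n]mulr_natr -[pi *+ 2]mulr_natr; ring.
  by rewrite (periodicn (@cosD2pi R)) cos0.
by split=> //; apply/eqP; rewrite -sqrf_eq0 sin2cos2 c1 expr1n subrr.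
Qed.

Lemma continuous_cosM k : {within I, continuous (fun t => cos (k * t))}.
Proof. by case: (antider_cos k). Qed.

Lemma continuous_sinM k : {within I, continuous (fun t => sin (k * t))}.
Proof. by case: (antider_sin k). Qed.

Lemma L1_cos k : L1 (fun t : R => cos (k * t)).
Proof. by apply: L1_continuous; exact: continuous_cosM. Qed.

Lemma L1_sin k : L1 (fun t : R => sin (k * t)).
Proof. by apply: L1_continuous; exact: continuous_sinM. Qed.

Lemma int_cos (k : R) : k != 0 -> sin (k * (2 * pi)) = 0 ->
  int (fun t => cos (k * t)) = 0.
Proof.
move=> k0 sk; apply: (mulfI k0); rewrite mulr0 -(intZ k (L1_cos k)).
rewrite (int_antider _ (antider_sin k)); first by rewrite sk mulr0 sin0 subrr.
by apply: within_continuousZ; exact: continuous_cosM.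
Qed.

Lemma int_sin (k : R) : cos (k * (2 * pi)) = 1 -> int (fun t => sin (k * t)) = 0.
Proof.
move=> ck; have [->|k0] := eqVneq k 0.
  by rewrite (eq_int (g := fun=> 0)) ?int_cst ?mul0r// => t _; rewrite mul0r sin0.
have Nk0 : - k != 0 by rewrite oppr_eq0.
apply: (mulfI Nk0); rewrite mulr0 -(intZ (- k) (L1_sin k)).
have aF : antider (fun t => cos (k * t)) (fun t => - k * sin (k * t)).
  by apply: antider_ext (antider_cos k) => // t _; rewrite mulNr.
rewrite (int_antider _ aF); first by rewrite ck mulr0 cos0 subrr.
by apply: within_continuousZ; exact: continuous_sinM.
Qed.

(** Index n stands for frequency n + 1, since no constant term occurs. *)
Let cs (n : nat) (t : R) := cos (n.+1%:R * t).
Let sn (n : nat) (t : R) := sin (n.+1%:R * t).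

Lemma cossin_2piD n m : let k := n.+1%:R + m.+1%:R : R in
  cos (k * (2 * pi)) = 1 /\ sin (k * (2 * pi)) = 0.
Proof. by rewrite /= -natrD; exact: cossin_2pin. Qed.

Lemma cossin_2piB n m : let k := n.+1%:R - m.+1%:R : R in
  cos (k * (2 * pi)) = 1 /\ sin (k * (2 * pi)) = 0.
Proof.
have [c1 s1] := cossin_2pin n.+1; have [c2 s2] := cossin_2pin m.+1.
by rewrite /= mulrBl sinB cosB c1 s1 c2 s2 !(mulr0, mul0r, mulr1) subrr addr0.
Qed.

Lemma int_sin_cos n m : int (fun t => sn n t * cs m t) = 0.
Proof.
rewrite (eq_int (g := fun t => 2^-1 * (sin ((n.+1%:R + m.+1%:R) * t) +
    sin ((n.+1%:R - m.+1%:R) * t)))) => [|t _]; last first.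
  by rewrite mulrDl mulrBl sinD sinB /sn /cs; field.
rewrite intZ; last by apply: L1D; exact: L1_sin.
rewrite intD; [|exact: L1_sin|exact: L1_sin].
by rewrite !int_sin ?addr0 ?mulr0//; [case: (cossin_2piB n m)|case: (cossin_2piD n m)].
Qed.

Lemma int_cosB n m : int (fun t => cos ((n.+1%:R - m.+1%:R) * t)) =
  (n == m)%:R * (2 * pi) :> R.
Proof.
have [->|nm] := eqVneq n m.
  by rewrite -int_cst; apply: eq_int => t _; rewrite subrr mul0r cos0.
rewrite mul0r int_cos//; last by case: (cossin_2piB n m).
by rewrite subr_eq0 eqr_nat eqSS.
Qed.

Lemma int_cosD n m : int (fun t => cos ((n.+1%:R + m.+1%:R) * t)) = 0 :> R.
Proof.
by rewrite int_cos//; case: (cossin_2piD n m).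
Qed.

Lemma int_cos_cos n m : int (fun t => cs n t * cs m t) = (n == m)%:R * pi.
Proof.
rewrite (eq_int (g := fun t => 2^-1 * (cos ((n.+1%:R + m.+1%:R) * t) +
    cos ((n.+1%:R - m.+1%:R) * t)))) => [|t _]; last first.
  by rewrite mulrDl mulrBl cosD cosB /cs; field.
rewrite intZ; last by apply: L1D; exact: L1_cos.
rewrite intD; [|exact: L1_cos|exact: L1_cos].
by rewrite int_cosD int_cosB; field.
Qed.

Lemma int_sin_sin n m : int (fun t => sn n t * sn m t) = (n == m)%:R * pi.
Proof.
rewrite (eq_int (g := fun t => 2^-1 * (cos ((n.+1%:R - m.+1%:R) * t) -
    cos ((n.+1%:R + m.+1%:R) * t)))) => [|t _]; last first.
  by rewrite mulrBl mulrDl cosB cosD /sn; field.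
rewrite intZ; last by apply: L1B; exact: L1_cos.
rewrite intB; [|exact: L1_cos|exact: L1_cos].
by rewrite int_cosD int_cosB; field.
Qed.

Lemma L1_trig (f g : R -> R) : {within I, continuous f} -> {within I, continuous g} ->
  L1 (fun t => f t * g t).
Proof. by move=> cf cg; apply: L1_continuous_mul => //; exact: L1_continuous. Qed.

(** Parseval's identity, from the orthogonality of the harmonics. *)
Lemma int_harmonic_product N (a b a' b' : 'I_N -> R) :
  int (fun t => (\sum_n (a n * sn n t + b n * cs n t)) *
                (\sum_m (a' m * sn m t + b' m * cs m t))) =
  pi * \sum_n (a n * a' n + b n * b' n).
Proof.
have Lss n m : L1 (fun t => sn n t * sn m t) by apply: L1_trig; exact: continuous_sinM.
have Lcc n m : L1 (fun t => cs n t * cs m t) by apply: L1_trig; exact: continuous_cosM.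
have Lsc n m : L1 (fun t => sn n t * cs m t).
  by apply: L1_trig; [exact: continuous_sinM|exact: continuous_cosM].
pose T n m t := a n * a' m * (sn n t * sn m t) + b n * b' m * (cs n t * cs m t)
  + (a n * b' m * (sn n t * cs m t) + b n * a' m * (sn m t * cs n t)).
rewrite (eq_int (g := fun t => \sum_(n < N) \sum_(m < N) T n m t)) => [|t _]; last first.
  rewrite mulr_suml; apply: eq_bigr => n _; rewrite mulr_sumr.
  by apply: eq_bigr => m _; rewrite /T; ring.
have LT n m : L1 (T n m) by do !apply: L1D; apply: L1Z.
rewrite int_sum => [|n]; last exact: L1_sum.
rewrite mulr_sumr; apply: eq_bigr => n _; rewrite int_sum//.
have intT m : int (T n m) = (n == m)%:R * (pi * (a n * a' m + b n * b' m)).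
  rewrite intD; [|by apply: L1D; apply: L1Z|by apply: L1D; apply: L1Z].
  rewrite !intD; try by apply: L1Z.
  by rewrite !intZ// int_sin_sin int_cos_cos !int_sin_cos -val_eqE /=; ring.
rewrite (bigD1 n)//= big1 ?addr0 ?intT ?eqxx ?mul1r// => m mn.
by rewrite intT eq_sym (negPf mn) mul0r.
Qed.

(** The continuous version y of u solves y' = - B y, is periodic because the primitive of u vanishes
    at both ends, and has mean 0; its harmonics, rescaled, are the modes. *)
Lemma critical_modes d l (A : l.-tuple 'M[R]_d) p omega u :
  (forall k, (tnth A k)^T = - tnth A k) -> critical_manifold A p omega u ->
  exists N, exists a b : 'M[R]_(d, N),
    is_modes A (coords omega) (\row_n n.+1%:R) a b p.
Proof.
move=> AT cu; have [Hu pE _] := cu; set w := coords omega; pose B := lincomb A w.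
have BT : B^T = - B := lincombT w AT.
have [c [uy pjE]] := critical_ode AT cu.
pose X i t := prim (u i) t.
pose y j t := c j - \sum_i B j i * X i t.
have {}uy j t : 0 <= t <= 2 * pi -> X j t = prim (y j) t by exact: uy.
have {}pjE i j : pj u u i j = int (fun t => X i t * y j t) by exact: pjE.
have cy j : {within I, continuous (y j)}.
  have cS : {within I, continuous (fun t => \sum_i B j i * X i t)}.
    apply: within_continuous_sum => i; apply: within_continuousZ.
    exact: prim_continuous (control_L1 u i).
  move=> x; apply: (@cvgB _ _ _ (nbhs x) _ (fun=> c j) _ (c j)); first exact: cvg_cst.
  exact: cS.
have dX i : antider (X i) (y i).
  by apply: antider_ext (antider_prim (cy i)) => // t tI; rewrite uy.
have dy j : antider (y j) (fun t => - \sum_i B j i * y i t).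
  have := antiderD (antider_cst (c j)) (antiderZ (-1)
    (@antider_sum R _ (index_enum _) (fun i t => B j i * X i t) _
      (fun i => antiderZ (B j i) (dX i)))).
  by apply: antider_ext => t _; rewrite mulN1r ?add0r.
have intu j : int (u j) = 0 by exact: (HloopP _).1.
have t2I : (0 : R) <= 2 * pi <= 2 * (pi : R) by rewrite lexx ltW// twopi_gt0.
have py j : y j (2 * pi) = y j 0.
  rewrite /y; congr (_ - _); apply: eq_bigr => i _.
  by rewrite /X prim2pi intu prim0.
have iy j : int (y j) = 0 by rewrite -prim2pi -uy// /X prim2pi.
have [N [a [b [Ba Bb yE]]]] := harmonic_decomposition BT dy py iy.
have {}yE j t : 0 <= t <= 2 * pi -> y j t = \sum_n (b j n * sn n t + a j n * cs n t).
  move=> /yE/matrixP/(_ j ord0); rewrite !mxE => ->; rewrite -big_split /=.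
  by apply: eq_bigr => n _; rewrite !mxE addrC.
(* A termwise antiderivative of y; it differs from X by a constant, which disappears against y of
   mean 0. *)
pose Y i t := \sum_(n < N) (a i n / n.+1%:R * sn n t + - (b i n / n.+1%:R) * cs n t).
have dY i : antider (Y i) (y i).
  have dn (n : 'I_N) : antider (fun t => a i n / n.+1%:R * sn n t + - (b i n / n.+1%:R) * cs n t)
      (fun t => b i n * sn n t + a i n * cs n t).
    have := antiderD (antiderZ (a i n / n.+1%:R) (antider_sin n.+1%:R))
      (antiderZ (- (b i n / n.+1%:R)) (antider_cos n.+1%:R)).
    by apply: antider_ext => // t _; rewrite /sn /cs; field.
  apply: antider_ext (antider_sum _ dn) => // t /andP[t0 t2].
  by rewrite yE// !ltW.
have XY i t : 0 <= t <= 2 * pi -> X i t = Y i t - Y i 0.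
  by move=> tI; rewrite uy// (prim_antider (cy i) (dY i)).
have LYy i j : L1 (fun t => Y i t * y j t) by apply: L1_trig => //; case: (dY i).
have {}pjE i j : pj u u i j =
    pi * \sum_n (a i n * b j n - b i n * a j n) / n.+1%:R.
  rewrite pjE (eq_int (g := fun t => Y i t * y j t - Y i 0 * y j t)) => [|t tI]; last first.
    by rewrite XY// mulrBl.
  rewrite intB//; last by apply: L1Z; exact: L1_continuous.
  rewrite intZ; last exact: L1_continuous.
  rewrite iy mulr0 subr0.
  rewrite (eq_int (g := fun t => Y i t * \sum_n (b j n * sn n t + a j n * cs n t))); last first.
    by move=> t tI; rewrite yE.
  rewrite int_harmonic_product; congr (_ * _); apply: eq_bigr => n _.
  by field.
(* Parseval gives the n-th harmonic the weight pi / (n + 1) in p; its square root is put on each of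
   a and b. *)
pose e : 'rV[R]_N := \row_n Num.sqrt (pi / n.+1%:R).
have e2 n : e ord0 n * e ord0 n = pi / n.+1%:R.
  by rewrite mxE -expr2 sqr_sqrtr// divr_ge0// pi_ge0.
exists N, (a *m diag_mx e), (b *m diag_mx e); split.
- by rewrite mulmxA Ba mulNmx -!mulmxA diag_mxC.
- by rewrite mulmxA Bb -!mulmxA diag_mxC.
- rewrite -pE qmapE; apply/rowP => k; rewrite !mxE.
  pose M i j n := tnth A k i j * (a i n * b j n) * (pi / n.+1%:R).
  have AE i j : tnth A k i j = - tnth A k j i.
    by have /matrixP/(_ j i) := AT k; rewrite !mxE.
  (* By antisymmetry of A_k, the two terms of each moment contribute equally, which cancels the
     factor 1/2 of q. *)
  transitivity (\sum_i \sum_j \sum_n M i j n).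
    transitivity (2^-1 * (\sum_i \sum_j \sum_n M i j n + \sum_i \sum_j \sum_n M j i n)).
      congr (_ * _); rewrite -big_split /=; apply: eq_bigr => i _.
      rewrite -big_split /=; apply: eq_bigr => j _; rewrite pjE mulrCA mulrA mulr_sumr.
      rewrite -big_split /=; apply: eq_bigr => n _; rewrite /M (AE j i).
      by field.
    by rewrite [X in _ + X]exchange_big /=; field.
  transitivity (\sum_n \sum_j \sum_i M i j n).
    under eq_bigr => i _ do rewrite exchange_big /=.
    rewrite exchange_big /=; apply: eq_bigr => n _; exact: exchange_big.
  rewrite !mul_mx_diag; apply: eq_bigr => n _; rewrite mxE; apply: eq_bigr => j _.
  rewrite mxE [in RHS]mxE mulr_suml; apply: eq_bigr => i _.
  by rewrite /M -e2 !mxE; ring.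
Qed.

End CriticalModes.

(** * Counting multipliers and critical manifolds *)

Section Counting.
Variables (R : realType) (d l : nat) (A : l.-tuple 'M[R]_d).
Hypothesis AT : forall k, (tnth A k)^T = - tnth A k.
Variable K : set R.
Hypotheses (sK : subring_set K) (cK : countable K).
Hypothesis KA : forall k i j, K (tnth A k i j).
Variables (W : {vspace 'M[R]_d}) (p : 'rV[R]_l).
Hypotheses (bA : basis_of W A) (gW : good_plane W) (gp : generic K p).

(** There are M^l tuples of frequencies, all integers and hence in K, and each carries at most k
    multipliers with k independent of the tuple. *)
Lemma multipliers_with_frequencies_below : exists k : nat, forall M : nat,
  exists2 s : seq 'rV[R]_l, (size s <= k * M ^ l)%N &
    forall w (nu : 'rV[R]_l) a b, is_modes A w nu a b p ->
      (forall j, exists2 n : nat, (n < M)%N & nu ord0 j = n.+1%:R) -> w \in s.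
Proof.
have [k hk] := finite_multipliers AT sK cK KA l gp; exists k => M.
pose nu (f : {ffun 'I_l -> 'I_M}) : 'rV[R]_l := \row_j (f j).+1%:R.
have /choice[S SP] f : exists s : seq 'rV[R]_l, (size s <= k)%N /\
    forall w a b, is_modes A w (nu f) a b p -> w \in s.
  have [|s ss sP] := hk (nu f); last by exists s.
  by move=> j; rewrite mxE; exact: subring_nat.
exists (flatten [seq S f | f <- enum {ffun 'I_l -> 'I_M}]).
  rewrite size_flatten /shape -map_comp sumnE big_map big_enum /=.
  apply: (@leq_trans (\sum_(f : {ffun 'I_l -> 'I_M}) k)%N).
    by apply: leq_sum => f _; case: (SP f).
  by rewrite sum_nat_const card_ffun !card_ord mulnC.
move=> w nu' a b Mo hnu; have /choice[g gP] j : exists n : 'I_M, nu' ord0 j = n.+1%:R.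
  by have [n nM ->] := hnu j; exists (Ordinal nM).
have nuE : nu' = nu [ffun j => g j] by apply/rowP => j; rewrite mxE ffunE.
apply/flattenP; exists (S [ffun j => g j]).
  by apply/mapP; exists [ffun j => g j] => //; rewrite mem_enum.
by have [_ h] := SP [ffun j => g j]; apply: h; rewrite -nuE; exact: Mo.
Qed.

Lemma multiplier_frequencies : exists2 c0 : R, 1 <= c0 &
  forall s omega u, 1 <= s -> critical_manifold A p omega u -> energy u < s ->
  exists nu : 'rV[R]_l, exists a, exists b, is_modes A (coords omega) nu a b p /\
    forall j, exists2 n : nat, (n < Num.truncn (c0 * s))%N & nu ord0 j = n.+1%:R.
Proof.
have [c c0 hc] := lincomb_mul_lower_bound bA gW AT sK KA gp.
have [al al0 hal] := mode_frequency_le A.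
(* From c |w|^2 <= |B b|^2 <= d^2 J^2, |w| is at most C1 s, so the frequencies are at most al C1 s.
   The added 1 makes C s >= 1. *)
pose C1 := Num.sqrt ((d * d)%:R / c); pose C := al * C1 + 1.
have C1_ge0 : 0 <= C1 by exact: sqrtr_ge0.
have C1' : 1 <= C by rewrite lerDr mulr_ge0.
exists C => // s omega u s1 cu us; have s0 : 0 <= s by exact: le_trans s1.
have [N [a [b Mo]]] := critical_modes AT cu; set w := coords omega in Mo *.
have nu0 (j : 'I_N) : 0 <= (\row_(n < N) n.+1%:R : 'rV[R]_N) ord0 j by rewrite mxE.
have [cT cp _] := modes_pairing AT Mo; have := modes_sqn_le AT Mo nu0.
rewrite -(energy_critical cu) => Bc.
have e0 : 0 <= energy u by rewrite mulr_ge0// sqr_ge0.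
have sw : Num.sqrt (sqn w) <= C1 * s.
  rewrite -(ger0_norm s0) -sqrtr_sqr -sqrtrM; last by rewrite divr_ge0// ltW.
  apply: ler_wsqrtr; rewrite mulrAC ler_pdivlMr// mulrC.
  apply: le_trans (hc w _ cT cp) (le_trans Bc _).
  by rewrite ler_wpM2l// ler_sqr ?nnegrE// ltW.
pose Q (x : R) := exists2 n : nat, (n < Num.truncn (C * s))%N & x = n.+1%:R.
(* The conventional frequency 1 of zero columns must be within the bound; this is where s >= 1 and C
   >= 1 are used. *)
have Q1 : Q 1 by exists 0%N => //; rewrite truncn_gt0 mulr_ege1.
have [|nu' Mo' Q'] := normalize_modes Mo Q1.
  move=> j nz; exists j; last by rewrite mxE.
  rewrite truncn_gt_nat; have := hal _ _ _ _ _ _ _ Mo nz; rewrite mxE => /le_trans; apply.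
  rewrite mulrDl mul1r -mulrA ler_wpDr//.
  by rewrite ler_wpM2l.
have [nu [a' [b' [Mo2 Q2]]]] := reduce_modes Mo' Q' Q1.
by exists nu, a', b'.
Qed.

Lemma critical_manifold_coords (omega omega' : {scalar 'rV[R]_l}) :
  coords omega = coords omega' ->
  critical_manifold A p omega = critical_manifold A p omega'.
Proof.
move=> e; have eq x : omega x = omega' x by rewrite !omegaE e.
by apply/seteqP; split => u [Hu qu [Dq [DJ [dq dJ h]]]]; split => //; exists Dq, DJ;
  split => // v /h; rewrite eq.
Qed.

Lemma card_critical_manifolds_below : exists2 C : R, 0 < C &
  \forall s \near +oo, exists2 N : nat,
    (critical_manifolds_below A p s #= `I_N)%card & N%:R <= C * s ^+ l.
Proof.
have [k hk] := multipliers_with_frequencies_below.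
have [c0 c1 hc0] := multiplier_frequencies.
have c0_gt0 : 0 < c0 by exact: lt_le_trans c1.
(* k + 1 instead of k keeps the constant positive when k = 0. *)
exists (k.+1%:R * c0 ^+ l); first by rewrite mulr_gt0// exprn_gt0.
near=> s; have s1 : 1 <= s by near: s; exact: nbhs_pinfty_ge.
have s0 : 0 <= s by exact: le_trans s1.
have [S sS SP] := hk (Num.truncn (c0 * s)).
(* A critical manifold depends only on the coordinates of its multiplier, so this union over omega
   recovers it from w. Every manifold counted is thus the image under g of an entry of S. *)
pose g w := [set u | exists2 omega, coords omega = w & critical_manifold A p omega u].
have sub : critical_manifolds_below A p s `<=` [set g (nth 0 S i) | i in `I_(size S)].
  move=> _ [omega [_ -> [u cu us]]].
  have [nu [a [b [Mo nuP]]]] := hc0 _ _ _ s1 cu us.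
  have wS := SP _ _ _ _ Mo nuP.
  exists (index (coords omega) S); first by rewrite /= index_mem.
  rewrite nth_index//; apply/seteqP; split => v; last by move=> cv; exists omega.
  by move=> [omega' e]; rewrite (critical_manifold_coords e).
have [N cN] : exists N, (critical_manifolds_below A p s #= `I_N)%card.
  by apply/finite_setP; apply: sub_finite_set sub _; exact/finite_image/finite_II.
exists N => //; have NS : (N <= size S)%N.
  rewrite -card_le_II -(card_le_eql cN).
  by apply: card_le_trans (subset_card_le sub) _; exact: card_image_le.
apply: (@le_trans _ _ (k * Num.truncn (c0 * s) ^ l)%:R).
  by rewrite ler_nat (leq_trans NS).
rewrite natrM natrX -mulrA -exprMn; apply: ler_pM => //.
  by rewrite ler_nat.
have cs0 : 0 <= c0 * s by rewrite mulr_ge0// ltW.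
by rewrite lerXn2r ?nnegrE ?truncn_le.
Unshelve. all: by end_near.
Qed.

End Counting.

Theorem theorem21 (R : realType) (d l : nat) :
  generic_plane (so R d) l (fun W : {vspace 'M[R]_d} =>
    forall A : l.-tuple 'M[R]_d, basis_of W A ->
      generic_point (fun p : 'rV[R]_l =>
        exists2 C : R, 0 < C &
          \forall s \near +oo, exists2 N : nat,
            (critical_manifolds_below A p s #= `I_N)%card &
            N%:R <= C * s ^+ l)).
Proof.
(* One exceptional set suffices for W, repeated as a constant sequence. The exceptional p are
   determined below by a countable ring K that contains the entries of the basis A. *)
exists (fun=> [set W | ~ good_plane W]); first by move=> _; exact: gr_negligible_not_good_plane.
move=> W [Wso _] nW A bA.
have gW : good_plane W by apply: contrapT => h; apply: nW; exists 0%N.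
have AT k : (tnth A k)^T = - tnth A k.
  apply/eqP; rewrite -mem_so; apply: (subvP Wso).
  by rewrite (basis_mem bA)// mem_tnth.
pose entries := [seq tnth A x.1 x.2.1 x.2.2 | x : 'I_l * ('I_d * 'I_d)].
have [K [sK cK KP]] := countable_subring entries.
have KA k i j : K (tnth A k i j).
  by apply: KP; apply/mapP; exists (k, (i, j)) => //; rewrite mem_enum.
have [Y Yn YP] := @generic_point_generic R K l sK cK; exists Y => // p /YP gp.
exact: (card_critical_manifolds_below AT sK cK KA bA gW gp).
Qed.
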